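(* Let $G$, $\pi$, $V$, $f_v$, $f_v^\infty$, $N_\pi$ be as defined in the context, let $v\in V\setminus\{0\}$, and put $L:=N_\pi^2$. Suppose that $\inf_{g \in G} \|\pi(g)v\| = 0$. Let $(x_k)_{k\ge 0}$ be the gradient-descent sequence in $P_n\cap G$ defined by $$x_{k+1} = \exp_{x_k} \Bigl(- \frac{1}{L} \nabla f_v(x_k)\Bigr),\qquad x_0 = I,$$ and let $(u_k)_{k\ge1}$ be the sequence in $S_I$ defined by $x_k = e^{d(x_k,I)u_k}$. Then $u_k$ converges to the unique minimizer $\xi^*$ of $f_v^{\infty}$ over $S_I$, and $t \mapsto e^{t\xi^*}$ is a maximally destabilizing $1$-parameter subgroup, i.e., a $1$-parameter subgroup of $G$ with $\lim_{t\to\infty}\pi(e^{t\xi^*})v=0$ that is obtained from the unique minimizer of $f_v^\infty$ over $S_I$.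
   Context: $G\subseteq GL_n(\mathbb{C})$ is a connected reductive algebraic group over $\mathbb{C}$ with $G=G^\dagger$, where $\dagger$ is conjugate transpose. $K=G\cap U_n$ is its maximal compact subgroup with Lie algebra $\mathfrak{k}$; the Lie algebra of $G$ is $\mathfrak{g}=\mathfrak{k}+i\mathfrak{k}$, where $i\mathfrak{k}$ consists of Hermitian matrices. $\mathfrak g$ carries the inner product $\langle X,Y\rangle:=\mathrm{Re}\,\mathrm{tr}\,XY^\dagger$ with norm $\|\cdot\|$. $V$ is a finite-dimensional complex vector space with a $K$-invariant Hermitian inner product $(\cdot,\cdot)$ and norm $\|\cdot\|$; $\pi:G\to GL(V)$ is a rational representation with Lie algebra representation $\Pi(X):=\frac{d}{dt}\pi(e^{tX})|_{t=0}$. $N_\pi$ is the maximum of the norm of a weight for $\pi$: for $T$ a maximal torus of $K$ with Lie algebra $\mathfrak{t}$, a weight is an $\omega\in i\mathfrak{t}$ such that for some nonzero $w\in V$, $\Pi(H)w=\langle\omega,H\rangle w$ for all $H\in i\mathfrak t$; its norm is $\|\omega\|$. $P_n$ is the manifold of $n\times n$ positive definite Hermitian matrices with Riemannian metric $\langle X,Y\rangle_x=\mathrm{tr}\,x^{-1}Xx^{-1}Y$; $P_n\cap G$ is a totally geodesic submanifold (a Hadamard manifold) with $T_I(P_n\cap G)=i\mathfrak{k}$, exponential map $\exp_x(H)=x^{1/2}e^{x^{-1/2}Hx^{-1/2}}x^{1/2}$ and Riemannian distance $d$. $S_I$ is the unit sphere in $T_I(P_n\cap G)=i\mathfrak{k}$.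 The Kempf–Ness function is $f_v(x):=\log(\pi(x)v,v)$ for $x\in P_n\cap G$; $\nabla f_v$ is its Riemannian gradient; its recession function is $f_v^\infty(\xi):=\lim_{t\to\infty}f_v(e^{t\xi})/t$ for $\xi\in i\mathfrak{k}$. A destabilizing 1-parameter subgroup is a 1-parameter subgroup $t\mapsto e(t)$ of $G$ with $\lim_{t\to\infty}\pi(e(t))v=0$. *)

(* Defs.v *)
From HB Require Import structures.
From mathcomp Require Import all_boot all_order all_algebra.
From mathcomp Require Import complex sesquilinear spectral.
From mathcomp Require Import all_classical all_reals all_analysis.
From mathcomp Require mpoly.

Set Implicit Arguments.
Unset Strict Implicit.
Unset Printing Implicit Defensive.

Import Order.TTheory GRing.Theory Num.Theory Num.Def.
Import numFieldNormedType.Exports.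

Local Open Scope classical_set_scope.
Local Open Scope ring_scope.
Local Open Scope sesquilinear_scope.
Local Open Scope complex_scope.

(* The norm topology of the complex numbers; it induces the usual (entrywise)
   topology on complex matrices. *)
HB.instance Definition _ (R : realType) := NormedModule.copy R[i] R[i]^o.


Section AlgebraicGroups.
Variables (R : realType) (n : nat).
Local Notation C := R[i].
Implicit Types (G U Z A B : set 'M[C]_n) (g : 'M[C]_n).

Definition eval_entries (p : mpoly.mpoly (n * n) C) g : C :=
  mpoly.meval (fun i => mxvec g 0 i) p.

(* Closed in GL_n; inverting the determinant gives no further closed sets. *)
Definition zariski_closed Z := exists P : set (mpoly.mpoly (n * n) C),
  Z = [set g | g \in unitmx /\ forall p, P p -> eval_entries p g = 0].

Definition zariski_connected Z := forall A B,
  zariski_closed A -> zariski_closed B ->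
  Z = A `|` B -> A `&` B = set0 -> A = set0 \/ B = set0.

Definition matrix_group G := [/\ G `<=` [set g | g \in unitmx], G 1%:M,
  forall g h, G g -> G h -> G (g *m h) & forall g, G g -> G (invmx g)].

Definition algebraic_group G := matrix_group G /\ zariski_closed G.

Definition normal_in U G :=
  U `<=` G /\ forall g u, G g -> U u -> U (g *m u *m invmx g).

Definition unipotent U :=
  forall u, U u -> exists k : nat, (u - 1%:M) ^+ k = 0.

(* Algebraic group with trivial unipotent radical. *)
Definition reductive G := algebraic_group G /\
  forall U, algebraic_group U -> zariski_connected U -> normal_in U G ->
    unipotent U -> U = [set 1%:M].

End AlgebraicGroups.


Section MatrixAnalysis.
Variables (R : realType) (n : nat).
Local Notation C := R[i].
Implicit Types (G S T : set 'M[C]_n) (X Y x : 'M[C]_n).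

Definition expmx X : 'M[C]_n :=
  limn (series (fun k : nat => (k`!%:R : C)^-1 *: X ^+ k)).

Definition mxdot X Y : R := complex.Re (\tr (X *m Y^t*)).

Definition mxnorm X : R := Num.sqrt (mxdot X X).

Definition has_velocity (c : R -> 'M[C]_n) (t : R) (X : 'M[C]_n) :=
  (fun h : R => (h^-1)%:C *: (c (t + h) - c t)) @ 0^' --> X.

Definition maxcompact G : set 'M[C]_n :=
  G `&` [set g | g \is unitarymx].

Definition lie S : set 'M[C]_n :=
  [set X | forall t : R, S (expmx (t%:C *: X))].

Definition ilie S : set 'M[C]_n := [set 'i%C *: X | X in lie S].

Definition torus_in T S := [/\ matrix_group T, T `<=` S, compact T,
  connected T & forall g h, T g -> T h -> g *m h = h *m g].

Definition maximal_torus T S := torus_in T S /\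
  forall T', torus_in T' S -> T `<=` T' -> T' = T.

Definition posdef x := x^t* = x /\
  forall w : 'cV[C]_n, w != 0 -> 0 < (w^t* *m x *m w) 0 0.

Definition one_param_subgroup G (e : R -> 'M[C]_n) :=
  [/\ forall t, G (e t), forall s t, e (s + t) = e s *m e t & continuous e].

End MatrixAnalysis.


Section PositivePart.
Variables (R : realType) (n : nat) (G : set 'M[R[i]]_n).
Local Notation C := R[i].
Implicit Types (x y X Y : 'M[C]_n) (f : 'M[C]_n -> R).

Definition pospart : set 'M[C]_n := @posdef R n `&` G.

Definition riem x X Y : R :=
  complex.Re (\tr (invmx x *m X *m invmx x *m Y)).

Definition sqrtmx x : 'M[C]_n := xget 0 [set y | posdef y /\ y *m y = x].

Definition riem_exp x X : 'M[C]_n :=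
  let s := sqrtmx x in
  s *m expmx (invmx s *m X *m invmx s) *m s.

Definition curve_at x (c : R -> 'M[C]_n) X :=
  [/\ forall t, pospart (c t), c 0 = x & has_velocity c 0 X].

Definition tangent x : set 'M[C]_n := [set X | exists c, curve_at x c X].

Definition is_gradient f x X := tangent x X /\
  forall c Y, curve_at x c Y -> is_derive (0 : R) (1 : R) (f \o c) (riem x X Y).

Definition gradient f x : 'M[C]_n := xget 0 [set X | is_gradient f x X].

Definition C1_path x y (c c' : R -> 'M[C]_n) :=
  [/\ {within `[0%R, 1%R], continuous c}, {within `[0%R, 1%R], continuous c'},
      forall t : R, 0 < t < 1 -> has_velocity c t (c' t),
      forall t : R, 0 <= t <= 1 -> pospart (c t) &
      c 0 = x /\ c 1 = y].

Definition path_length (c c' : R -> 'M[C]_n) : R :=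
  Rintegral lebesgue_measure `[0%R, 1%R]
    (fun t => Num.sqrt (riem (c t) (c' t) (c' t))).

(* Piecewise C^1 paths would give the same infimum: slow down at the corners. *)
Definition riem_dist x y : R :=
  inf [set l | exists c c', C1_path x y c c' /\ l = path_length c c'].

(* The tangent space at the identity is i times the Lie algebra of the
   maximal compact subgroup, and riem 1%:M is mxdot on it. *)
Definition unit_sphere : set 'M[C]_n :=
  [set X | ilie (maxcompact G) X /\ mxnorm X = 1].

Definition is_minimizer f (S : set 'M[C]_n) X :=
  S X /\ forall Y, S Y -> f X <= f Y.

Definition unique_minimizer f (S : set 'M[C]_n) X :=
  is_minimizer f S X /\ forall Y, is_minimizer f S Y -> Y = X.

Definition recession f X : R :=
  lim ((fun t : R => f (expmx (t%:C *: X)) / t) @ +oo).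

End PositivePart.


Section Representations.
Variables (R : realType) (n : nat) (V : vectType R[i]).
Local Notation C := R[i].
Variables (G : set 'M[C]_n) (ip : {dot V for conjC}) (pi : 'M[C]_n -> 'End(V)).

(* Matrix coefficients are regular functions on G: restrictions of elements of
   the coordinate ring of GL_n. Only the values of pi on G are relevant. *)
Definition rational_representation :=
  [/\ pi 1%:M = \1%VF,
      forall g h, G g -> G h -> pi (g *m h) = (pi g \o pi h)%VF &
      forall (w : V) (l : 'Hom(V, C^o)),
        exists (p : mpoly.mpoly (n * n) C) (k : nat),
          forall g, G g -> l (pi g w) = eval_entries p g / \det g ^+ k].

Definition vnorm (w : V) : R := Num.sqrt (complex.Re (ip w w)).

Definition invariant_under (S : set 'M[C]_n) :=
  forall k, S k -> forall w z, ip (pi k w) (pi k z) = ip w z.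

(* Derivative at t = 0 of pi (exp (t X)) w, for the norm of V. *)
Definition lie_rep (X : 'M[C]_n) (w : V) : V :=
  xget 0 [set z | (fun t : R =>
    vnorm ((t^-1)%:C *: (pi (expmx (t%:C *: X)) w - w) - z)) @ 0^' --> (0 : R)].

Definition weight (T : set 'M[C]_n) (omega : 'M[C]_n) := ilie T omega /\
  exists2 w : V, w != 0 &
    forall H, ilie T H -> lie_rep H w = (mxdot omega H)%:C *: w.

(* The set of weights is finite, so that the supremum is a maximum. *)
Definition weight_norm (T : set 'M[C]_n) : R :=
  sup [set mxnorm omega | omega in weight T].

Definition kempf_ness (v : V) (x : 'M[C]_n) : R :=
  ln (complex.Re (ip (pi x v) v)).

Definition destabilizing (v : V) (e : R -> 'M[C]_n) :=
  one_param_subgroup G e /\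
  (fun t : R => vnorm (pi (e t) v)) @ +oo --> (0 : R).

Definition maximally_destabilizing (v : V) (e : R -> 'M[C]_n) :=
  destabilizing v e /\
  exists X, unique_minimizer (recession (kempf_ness v)) (unit_sphere G) X /\
    e = (fun t : R => expmx (t%:C *: X)).

End Representations.

(* Main.v *)
(* In an orthonormal basis of V the representation becomes a matrix representation rho of G,
   unitary on K and with Hermitian derivative D on ik. The function f_v is convex along the
   geodesics of the positive part, and its gradient at g* g corresponds to the moment map
   mu (rho g v), which is determined by <mu w, Z> = (D Z w, w) / (w, w). Hence the descent
   lifts to g_{k+1} = e^{- mu_k / (2 L)} g_k with mu_k = mu (rho g_k v). As D Z has norm at
   most N_pi |Z|, one gets |mu_{k+1}|^2 <= <mu_{k+1}, mu_k>; thus the |mu_k| decrease to some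
   kappa, which is positive by the Hilbert-Mumford criterion (from the Cartan decomposition and
   the weights of a maximal torus). Summing the decrements yields
   f_v(x_k) <= C - kappa d(x_k, I) with d(x_k, I) -> oo, and by convexity the same bound holds
   along the whole geodesic from I to x_k. On the other hand convexity at x_k shows that
   f_v >= C' - (kappa + e) d(., I) for every e > 0. If two unit directions both satisfied the
   former bound at a large time t while staying apart, the midpoint of the two endpoints would,
   by the CAT(0) inequality, be too close to I for the latter. So the u_k converge; their limit
   has slope - kappa, the minimum of the recession function, and the same argument gives
   uniqueness. *)
From HB Require Import structures.
Require Import Defs.
From mathcomp Require Import all_boot all_order all_algebra.
From mathcomp Require Import fingroup perm.
From mathcomp Require Import complex sesquilinear spectral.
From mathcomp Require Import all_classical all_reals all_analysis.
From mathcomp Require mpoly.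
From mathcomp Require Import ring lra.

Set Implicit Arguments.
Unset Strict Implicit.
Unset Printing Implicit Defensive.

Import Order.TTheory GRing.Theory Num.Theory Num.Def.
Import numFieldNormedType.Exports Normc.

Local Open Scope classical_set_scope.
Local Open Scope ring_scope.
Local Open Scope sesquilinear_scope.
Local Open Scope complex_scope.

(** The geometry is carried by Hermitian logarithms. Since [y |-> g^* y g] is an isometry, the
    distance from [g^* g] to [g^* e^Y g] is expressed by [fnorm Y], and the triangle inequality, the
    comparison with the flat metric and CAT(0) become inequalities between norms of logarithms. All
    three rest on one majorization statement, [upper_diag_le], about the diagonal of a triangular
    matrix with given Gram matrix. As [x = g^* g], a step [1 / L] in the positive part is a step
    [1 / (2 L)] of the lift [g]. On the algebraic side the obstacle is to pass between polynomial
    equations, the compact group and the positive part. A polynomial evaluated along [z |-> e^(zX)],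
    [X] Hermitian, is a finite sum of exponentials with real frequencies; it vanishes identically as
    soon as it vanishes on the imaginary axis or at the naturals. Both the bound on [D Z] and the
    Hilbert-Mumford direction are read off the weights of the given maximal torus. This is why
    conjugation into a maximal torus is proved, with the surjectivity of its exponential as a
    preparation. *)

HB.lock Definition fdot (R : realType) m n (X Y : 'M[R[i]]_(m, n)) : R :=
  complex.Re (\tr (X *m Y^t*)).

(** One norm for rectangular shapes: it is [mxnorm] on square matrices and, on columns, the norm of
    [V] in orthonormal coordinates. *)
HB.lock Definition fnorm (R : realType) m n (X : 'M[R[i]]_(m, n)) : R :=
  Num.sqrt (fdot X X).

(** * The Frobenius inner product and norm *)

Section Frobenius.
Variable R : realType.
Local Notation C := R[i].

Lemma adjmxE m n (A : 'M[C]_(m, n)) i j : (A^t*) i j = (A j i)^*%C.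
Proof. by rewrite !mxE. Qed.

Lemma adjmxM m n p (A : 'M[C]_(m, n)) (B : 'M[C]_(n, p)) :
  (A *m B)^t* = B^t* *m A^t*.
Proof. by rewrite trmx_mul map_mxM. Qed.

Lemma adjmxD m n (A B : 'M[C]_(m, n)) : (A + B)^t* = A^t* + B^t*.
Proof. by rewrite linearD map_mxD. Qed.

Lemma adjmxN m n (A : 'M[C]_(m, n)) : (- A)^t* = - A^t*.
Proof. by rewrite linearN map_mxN. Qed.

Lemma adjmxB m n (A B : 'M[C]_(m, n)) : (A - B)^t* = A^t* - B^t*.
Proof. by rewrite adjmxD adjmxN. Qed.

Lemma adjmxZ m n a (A : 'M[C]_(m, n)) : (a *: A)^t* = a^*%C *: A^t*.
Proof. by rewrite linearZ map_mxZ. Qed.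

Lemma adjmxZr m n (a : R) (A : 'M[C]_(m, n)) : (a%:C *: A)^t* = a%:C *: A^t*.
Proof. by rewrite adjmxZ conjc_real. Qed.

Lemma adjmx1 n : (1%:M : 'M[C]_n)^t* = 1%:M.
Proof. by rewrite trmx1 map_mx1. Qed.

Lemma adjmx0 m n : (0 : 'M[C]_(m, n))^t* = 0.
Proof. by rewrite trmx0 map_mx0. Qed.

Lemma adjmx_sum m n I (r : seq I) (F : I -> 'M[C]_(m, n)) :
  (\sum_(i <- r) F i)^t* = \sum_(i <- r) (F i)^t*.
Proof. by rewrite raddf_sum (raddf_sum (@map_mx _ _ Num.conj n m)). Qed.

Lemma ReD (x y : C) : complex.Re (x + y) = complex.Re x + complex.Re y.
Proof. by case: x; case: y. Qed.

Lemma ReZ (a : R) (x : C) : complex.Re (a%:C * x) = a * complex.Re x.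
Proof. by case: x => b c /=; rewrite mul0r subr0. Qed.

Lemma ReN (x : C) : complex.Re (- x) = - complex.Re x.
Proof. by case: x. Qed.

Lemma ReJ (x : C) : complex.Re (x^*%C) = complex.Re x.
Proof. by case: x. Qed.

Lemma Re_sum I (r : seq I) (P : pred I) (F : I -> C) :
  complex.Re (\sum_(i <- r | P i) F i) = \sum_(i <- r | P i) complex.Re (F i).
Proof. by apply: (big_morph _ ReD). Qed.

Lemma Re_le_normc (z : C) : `|complex.Re z| <= normc z.
Proof.
by case: z => a b /=; rewrite -[leLHS]sqrtr_sqr ler_wsqrtr// lerDl sqr_ge0.
Qed.

Lemma Im_le_normc (z : C) : `|complex.Im z| <= normc z.
Proof.
by case: z => a b /=; rewrite -[leLHS]sqrtr_sqr ler_wsqrtr// lerDr sqr_ge0.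
Qed.

Lemma normc_le (z : C) : normc z <= `|complex.Re z| + `|complex.Im z|.
Proof.
case: z => a b /=; rewrite -[leRHS]ger0_norm ?addr_ge0// -sqrtr_sqr ler_wsqrtr//.
have := mulr_ge0 (normr_ge0 a) (normr_ge0 b); rewrite sqrrD !real_normK ?num_real//; lra.
Qed.

Lemma normc_ge0 (z : C) : 0 <= normc z.
Proof. by case: z => a b; exact: sqrtr_ge0. Qed.

Lemma normcR (a : R) : normc a%:C = `|a|.
Proof. by rewrite /= expr0n addr0 sqrtr_sqr. Qed.

Lemma normc_conj (z : C) : normc (z^*%C) = normc z.
Proof. by case: z => a b /=; rewrite sqrrN. Qed.

Lemma normc_sum I (r : seq I) (P : pred I) (F : I -> C) :
  normc (\sum_(i <- r | P i) F i) <= \sum_(i <- r | P i) normc (F i).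
Proof.
elim/big_ind2: _ => [|x1 x2 y1 y2 h1 h2|//]; first by rewrite normc0.
by apply: le_trans (le_normcD _ _) _; rewrite lerD.
Qed.

Lemma mul_conj_normc (z : C) : z * z^*%C = (normc z ^+ 2)%:C.
Proof. by rewrite -sqr_normc -rmorphXn. Qed.

Lemma fdotE m n (X Y : 'M[C]_(m, n)) :
  fdot X Y = \sum_i \sum_j complex.Re (X i j * (Y i j)^*%C).
Proof.
rewrite fdot.unlock /mxtrace Re_sum; apply: eq_bigr => i _.
by rewrite mxE Re_sum; apply: eq_bigr => j _; rewrite adjmxE.
Qed.

Lemma fdotC m n (X Y : 'M[C]_(m, n)) : fdot X Y = fdot Y X.
Proof.
rewrite !fdotE; apply: eq_bigr => i _; apply: eq_bigr => j _.
by rewrite -ReJ rmorphM /= conjcK mulrC.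
Qed.

Lemma fdotDl m n (X Y Z : 'M[C]_(m, n)) : fdot (X + Y) Z = fdot X Z + fdot Y Z.
Proof. by rewrite fdot.unlock mulmxDl mxtraceD ReD. Qed.

Lemma fdotDr m n (X Y Z : 'M[C]_(m, n)) : fdot Z (X + Y) = fdot Z X + fdot Z Y.
Proof. by rewrite ![fdot Z _]fdotC fdotDl. Qed.

Lemma fdotZl m n a (X Y : 'M[C]_(m, n)) : fdot (a%:C *: X) Y = a * fdot X Y.
Proof. by rewrite fdot.unlock -scalemxAl mxtraceZ ReZ. Qed.

Lemma fdotZr m n a (X Y : 'M[C]_(m, n)) : fdot X (a%:C *: Y) = a * fdot X Y.
Proof. by rewrite ![fdot X _]fdotC fdotZl. Qed.

Lemma fdotNl m n (X Y : 'M[C]_(m, n)) : fdot (- X) Y = - fdot X Y.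
Proof. by rewrite fdot.unlock mulNmx linearN ReN. Qed.

Lemma fdotNr m n (X Y : 'M[C]_(m, n)) : fdot X (- Y) = - fdot X Y.
Proof. by rewrite ![fdot X _]fdotC fdotNl. Qed.

Lemma fdotBl m n (X Y Z : 'M[C]_(m, n)) : fdot (X - Y) Z = fdot X Z - fdot Y Z.
Proof. by rewrite fdotDl fdotNl. Qed.

Lemma fdotBr m n (X Y Z : 'M[C]_(m, n)) : fdot Z (X - Y) = fdot Z X - fdot Z Y.
Proof. by rewrite fdotDr fdotNr. Qed.

Lemma fdot0l m n (X : 'M[C]_(m, n)) : fdot 0 X = 0.
Proof. by rewrite fdot.unlock mul0mx mxtrace0. Qed.

Lemma fdot0r m n (X : 'M[C]_(m, n)) : fdot X 0 = 0.
Proof. by rewrite fdotC fdot0l. Qed.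

Lemma fdot_suml m n I (r : seq I) (F : I -> 'M[C]_(m, n)) Y :
  fdot (\sum_(i <- r) F i) Y = \sum_(i <- r) fdot (F i) Y.
Proof. by elim/big_ind2: _ => [|A a B b <- <-|//]; rewrite ?fdot0l ?fdotDl. Qed.

Lemma fdot_sumr m n I (r : seq I) (F : I -> 'M[C]_(m, n)) Y :
  fdot Y (\sum_(i <- r) F i) = \sum_(i <- r) fdot Y (F i).
Proof. by elim/big_ind2: _ => [|A a B b <- <-|//]; rewrite ?fdot0r ?fdotDr. Qed.

Lemma fdotXX m n (X : 'M[C]_(m, n)) :
  fdot X X = \sum_i \sum_j normc (X i j) ^+ 2.
Proof.
rewrite fdotE; apply: eq_bigr => i _; apply: eq_bigr => j _.
by rewrite mul_conj_normc.
Qed.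

Lemma fdot_ge0 m n (X : 'M[C]_(m, n)) : 0 <= fdot X X.
Proof.
by rewrite fdotXX; apply: sumr_ge0 => i _; apply: sumr_ge0 => j _; rewrite sqr_ge0.
Qed.

Lemma fnorm_ge0 m n (X : 'M[C]_(m, n)) : 0 <= fnorm X.
Proof. by rewrite fnorm.unlock sqrtr_ge0. Qed.

Lemma fnorm_sqr m n (X : 'M[C]_(m, n)) : fnorm X ^+ 2 = fdot X X.
Proof. by rewrite fnorm.unlock sqr_sqrtr ?fdot_ge0. Qed.

Lemma fdot_eq0 m n (X : 'M[C]_(m, n)) : fdot X X = 0 -> X = 0.
Proof.
rewrite fdotXX => /eqP; rewrite psumr_eq0 => [/allP h|i _]; last first.
  by apply: sumr_ge0 => j _; rewrite sqr_ge0.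
apply/matrixP => i j; rewrite mxE; apply: eq0_normc.
have := h i (mem_index_enum _); rewrite psumr_eq0 => [/allP/(_ j)|k _]; last exact: sqr_ge0.
by rewrite mem_index_enum sqrf_eq0 => /(_ isT)/eqP.
Qed.

Lemma fnorm_eq0 m n (X : 'M[C]_(m, n)) : fnorm X = 0 -> X = 0.
Proof. by move=> h; apply: fdot_eq0; rewrite -fnorm_sqr h expr0n. Qed.

Lemma fnorm0 m n : fnorm (0 : 'M[C]_(m, n)) = 0.
Proof. by rewrite fnorm.unlock fdot0l sqrtr0. Qed.

Lemma fnorm_gt0 m n (X : 'M[C]_(m, n)) : X != 0 -> 0 < fnorm X.
Proof.
move=> X0; rewrite lt_neqAle fnorm_ge0 andbT eq_sym.
by apply: contraNneq X0 => /fnorm_eq0 ->.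
Qed.

Lemma fdot_sqr_le m n (X Y : 'M[C]_(m, n)) :
  fdot X Y ^+ 2 <= fdot X X * fdot Y Y.
Proof.
have [->|Y0] := eqVneq Y 0; first by rewrite fdot0r expr0n fdot0r mulr0.
have yy : 0 < fdot Y Y by rewrite -fnorm_sqr exprn_gt0// fnorm_gt0.
(* The component of [X] orthogonal to [Y], scaled by [fdot Y Y] to avoid a division; its square is
   [fdot Y Y] times the claimed difference. *)
have := fdot_ge0 ((fdot Y Y)%:C *: X - (fdot X Y)%:C *: Y).
rewrite fdotBl !fdotBr !fdotZl !fdotZr (fdotC Y X) => h.
suff : 0 <= fdot Y Y * (fdot X X * fdot Y Y - fdot X Y ^+ 2).
  by rewrite pmulr_rge0// subr_ge0.
by apply: le_trans h _; rewrite le_eqVlt; apply/orP; left; apply/eqP; ring.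
Qed.

Lemma fdot_le m n (X Y : 'M[C]_(m, n)) : `|fdot X Y| <= fnorm X * fnorm Y.
Proof.
rewrite -[leRHS]ger0_norm ?mulr_ge0 ?fnorm_ge0// -ler_sqr ?nnegrE//.
by rewrite !real_normK ?num_real// exprMn !fnorm_sqr fdot_sqr_le.
Qed.

Lemma fnormD m n (X Y : 'M[C]_(m, n)) : fnorm (X + Y) <= fnorm X + fnorm Y.
Proof.
rewrite -ler_sqr ?nnegrE ?addr_ge0 ?fnorm_ge0// sqrrD !fnorm_sqr.
rewrite fdotDl !fdotDr (fdotC Y X).
have := le_trans (ler_norm _) (fdot_le X Y); lra.
Qed.

Lemma fnormZ m n a (X : 'M[C]_(m, n)) : fnorm (a *: X) = normc a * fnorm X.
Proof.
rewrite -[RHS]ger0_norm ?mulr_ge0 ?fnorm_ge0 ?normc_ge0// -sqrtr_sqr exprMn.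
rewrite fnorm_sqr fnorm.unlock; congr Num.sqrt; rewrite !fdotXX mulr_sumr.
by under eq_bigr do under eq_bigr do rewrite mxE normcM exprMn;
  apply: eq_bigr => i _; rewrite mulr_sumr.
Qed.

Lemma fnormZr m n (a : R) (X : 'M[C]_(m, n)) : fnorm (a%:C *: X) = `|a| * fnorm X.
Proof. by rewrite fnormZ normcR. Qed.

Lemma fnormN m n (X : 'M[C]_(m, n)) : fnorm (- X) = fnorm X.
Proof. by rewrite fnorm.unlock fdotNl fdotNr opprK. Qed.

Lemma fnormB m n (X Y : 'M[C]_(m, n)) : fnorm (X - Y) <= fnorm X + fnorm Y.
Proof. by rewrite -(fnormN Y) fnormD. Qed.

Lemma fnormBC m n (X Y : 'M[C]_(m, n)) : fnorm (X - Y) = fnorm (Y - X).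
Proof. by rewrite -fnormN opprB. Qed.

Lemma fnorm_sum m n I (r : seq I) (P : pred I) (F : I -> 'M[C]_(m, n)) :
  fnorm (\sum_(i <- r | P i) F i) <= \sum_(i <- r | P i) fnorm (F i).
Proof.
elim/big_ind2: _ => [|x1 x2 y1 y2 h1 h2|//]; first by rewrite fnorm0.
by apply: le_trans (fnormD _ _) _; rewrite lerD.
Qed.

Lemma normc_le_fnorm m n (X : 'M[C]_(m, n)) i j : normc (X i j) <= fnorm X.
Proof.
rewrite -ler_sqr ?nnegrE ?fnorm_ge0 ?normc_ge0// fnorm_sqr fdotXX (bigD1 i)//=.
rewrite (bigD1 j)//= -addrA lerDl addr_ge0//; first by apply: sumr_ge0 => k _; rewrite sqr_ge0.
by apply: sumr_ge0 => k _; apply: sumr_ge0 => l _; rewrite sqr_ge0.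
Qed.

Lemma fnorm_delta m n (a : C) i j : fnorm (a *: delta_mx i j : 'M[C]_(m, n)) = normc a.
Proof.
rewrite fnormZ; suff -> : fnorm (delta_mx i j : 'M[C]_(m, n)) = 1 by rewrite mulr1.
rewrite fnorm.unlock fdotXX (bigD1 i)//= (bigD1 j)//= !big1 ?addr0 => [|k ki|k kj].
- by rewrite mxE !eqxx normc1 expr1n sqrtr1.
- by rewrite big1// => l _; rewrite mxE (negPf ki) normc0 expr0n.
- by rewrite mxE (negPf kj) andbF normc0 expr0n.
Qed.

Lemma fnorm_le_sum m n (X : 'M[C]_(m, n)) :
  fnorm X <= \sum_i \sum_j normc (X i j).
Proof.
rewrite {1}(matrix_sum_delta X); apply: le_trans (fnorm_sum _ _ _) _.
apply: ler_sum => i _; apply: le_trans (fnorm_sum _ _ _) _.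
by apply: ler_sum => j _; rewrite fnorm_delta.
Qed.

(** Obtained from [fdot_sqr_le] by encoding the two real families as complex rows; it serves the
    submultiplicativity of [fnorm]. *)
Lemma sum_mul_sqr_le (I : finType) (a b : I -> R) :
  (\sum_i a i * b i) ^+ 2 <= (\sum_i a i ^+ 2) * (\sum_i b i ^+ 2).
Proof.
pose X (c : I -> R) : 'rV[C]_#|I| := \row_k (c (enum_val k))%:C.
have XE c d : fdot (X c) (X d) = \sum_i c i * d i.
  rewrite fdotE big_ord1 (reindex_onto (@enum_val I predT) enum_rank) /=; last by move=> ? _; rewrite enum_rankK.
  under [in RHS]eq_bigl do rewrite enum_valK eqxx.
  by apply: eq_bigr => k _; rewrite !mxE conjc_real -rmorphM.
by have := fdot_sqr_le (X a) (X b); rewrite !XE.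
Qed.

Lemma fnormM m n p (X : 'M[C]_(m, n)) (Y : 'M[C]_(n, p)) :
  fnorm (X *m Y) <= fnorm X * fnorm Y.
Proof.
rewrite -ler_sqr ?nnegrE ?mulr_ge0 ?fnorm_ge0// exprMn !fnorm_sqr !fdotXX.
rewrite mulr_suml; apply: ler_sum => i _.
rewrite [X in _ * X]exchange_big mulr_sumr /=; apply: ler_sum => j _.
apply: le_trans (sum_mul_sqr_le _ _); rewrite ler_sqr ?nnegrE ?normc_ge0//; last first.
  by apply: sumr_ge0 => k _; rewrite mulr_ge0 ?normc_ge0.
by rewrite mxE; apply: le_trans (normc_sum _ _ _) _; under eq_bigr do rewrite normcM.
Qed.

Lemma fnorm_adj m n (X : 'M[C]_(m, n)) : fnorm (X^t*) = fnorm X.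
Proof.
rewrite fnorm.unlock !fdotXX exchange_big; congr Num.sqrt.
by apply: eq_bigr => i _; apply: eq_bigr => j _; rewrite adjmxE normc_conj.
Qed.

Lemma fdot_mulmxl m n p (A : 'M[C]_(m, n)) (X : 'M[C]_(n, p)) Y :
  fdot (A *m X) Y = fdot X (A^t* *m Y).
Proof. by rewrite fdot.unlock adjmxM trmxCK mulmxA [in RHS]mxtrace_mulC mulmxA. Qed.

Lemma fdot_mulmxr m n p (A : 'M[C]_(n, p)) (X : 'M[C]_(m, n)) Y :
  fdot (X *m A) Y = fdot X (Y *m A^t*).
Proof. by rewrite fdot.unlock adjmxM trmxCK -mulmxA. Qed.

Lemma fnorm_unitaryl m n (U : 'M[C]_m) (X : 'M[C]_(m, n)) :
  U \is unitarymx -> fnorm (U *m X) = fnorm X.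
Proof.
by move=> hU; rewrite fnorm.unlock fdot_mulmxl mulmxA -(invmx_unitary hU) mulVmx ?mul1mx// unitarymx_unit.
Qed.

Lemma fnorm_unitaryr m n (U : 'M[C]_n) (X : 'M[C]_(m, n)) :
  U \is unitarymx -> fnorm (X *m U) = fnorm X.
Proof.
by move=> /unitarymxP hU; rewrite fnorm.unlock fdot_mulmxr -mulmxA hU mulmx1.
Qed.

End Frobenius.

(** * The topology of matrix spaces in terms of the Frobenius norm *)

Section MatrixTopology.
Variable R : realType.
Local Notation C := R[i].

Lemma normc_lt (z : C) (e : R) : (`|z| < e%:C) = (normc z < e).
Proof. by rewrite -ltcR. Qed.

Lemma pos_complexR (e : C) : 0 < e -> exists2 r : R, 0 < r & e = r%:C.
Proof.
by case: e => a b; rewrite ltcE /= => /andP[/eqP -> a0]; exists a.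
Qed.

(** The topology on matrices is entrywise, with balls whose radii are complex numbers; this is the
    bridge to limits expressed by the real number [fnorm]. *)
Lemma nbhs_fnormP m n (M : 'M[C]_(m, n)) (A : set 'M[C]_(m, n)) :
  nbhs M A <-> exists2 e : R, 0 < e & forall N, fnorm (N - M) < e -> A N.
Proof.
split.
  move=> /nbhs_ballP[e /= e0 eA].
  have [r r0 er] := pos_complexR e0; exists r => // N hN; apply: eA.
  split=> // i j; rewrite -ball_normE /ball_ /= er normc_lt.
  apply: le_lt_trans hN; rewrite fnormBC.
  by have := normc_le_fnorm (M - N) i j; rewrite !mxE.
move=> [e e0 eA]; apply/nbhs_ballP.
(* The [m n] entries, each below [d], add up to less than [e]; the summand 1 makes this strict and
   covers empty matrices. *)
pose d := e / (1 + (m * n)%:R).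
have d0 : 0 < d by rewrite divr_gt0// ltr_pwDl.
exists d%:C => /=; first by rewrite ltcR.
move=> N [_ hN]; apply: eA; rewrite fnormBC.
apply: le_lt_trans (fnorm_le_sum _) _.
apply: (@le_lt_trans _ _ (\sum_(i < m) \sum_(j < n) d)).
  apply: ler_sum => i _; apply: ler_sum => j _; have := hN i j.
  by rewrite -ball_normE /ball_ /= normc_lt !mxE => /ltW.
rewrite !sumr_const !card_ord -mulrnA mulnC -mulr_natr /d mulrAC.
by rewrite ltr_pdivrMr ?ltr_pwDl// ltr_pM2l// ltrDr.
Qed.

Lemma cvg_fnormP T (F : set_system T) {FF : Filter F} m n (f : T -> 'M[C]_(m, n))
  (M : 'M[C]_(m, n)) : f @ F --> M <-> forall e : R, 0 < e -> \forall x \near F, fnorm (f x - M) < e.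
Proof.
split=> [fM e e0|h A /nbhs_fnormP[e e0 eA]].
  by apply: (fM [set N | fnorm (N - M) < e]); apply/nbhs_fnormP; exists e.
by apply: filterS (h e e0) => x /eA.
Qed.

Lemma cvg_fnorm0P T (F : set_system T) {FF : Filter F} m n (f : T -> 'M[C]_(m, n))
  (M : 'M[C]_(m, n)) : f @ F --> M <-> (fun x => fnorm (f x - M)) @ F --> (0 : R).
Proof.
rewrite cvg_fnormP; split => [h|/cvgrPdist_lt h e e0].
  apply/cvgrPdist_lt => e e0; apply: filterS (h e e0) => x.
  by rewrite sub0r normrN ger0_norm ?fnorm_ge0.
by apply: filterS (h e e0) => x; rewrite sub0r normrN ger0_norm ?fnorm_ge0.
Qed.

Lemma cvg_fnorm_unique T (F : set_system T) {FF : ProperFilter F} m n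
  (f : T -> 'M[C]_(m, n)) (M N : 'M[C]_(m, n)) :
  f @ F --> M -> f @ F --> N -> M = N.
Proof.
move=> /cvg_fnormP fM /cvg_fnormP fN; apply/eqP; rewrite -subr_eq0; apply/negPn/negP => /fnorm_gt0 h.
have h2 : 0 < fnorm (M - N) / 2 by rewrite divr_gt0.
have [x [h1 {}h2]] := filter_ex (filterI (fM _ h2) (fN _ h2)).
have : fnorm (M - N) <= fnorm (f x - N) + fnorm (f x - M).
  by rewrite (_ : M - N = f x - N - (f x - M)) ?fnormB// opprB [in RHS]addrC addrA subrK.
lra.
Qed.

Lemma cvg_entriesP T (F : set_system T) {FF : Filter F} m n (f : T -> 'M[C]_(m, n))
  (a b : 'I_m -> 'I_n -> R) :
  (forall i j, complex.Re (f x i j) @[x --> F] --> a i j) ->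
  (forall i j, complex.Im (f x i j) @[x --> F] --> b i j) ->
  f @ F --> (\matrix_(i, j) (a i j +i* b i j)%C : 'M[C]_(m, n)).
Proof.
move=> ha hb; set M := (X in _ --> X); apply/cvg_fnorm0P.
pose g x := \sum_i \sum_j (`|complex.Re (f x i j) - a i j| + `|complex.Im (f x i j) - b i j|).
apply: (@squeeze_cvgr _ _ _ _ (cst 0) g); last first.
- have -> : 0 = \sum_(i < m) \sum_(j < n) (`|a i j - a i j| + `|b i j - b i j|).
    by rewrite big1// => i _; rewrite big1// => j _; rewrite !subrr normr0 addr0.
  apply: cvg_big => [|i _]; first exact: add_continuous.
  apply: cvg_big => [|j _]; first exact: add_continuous.
  by apply: cvgD; apply: cvg_norm; apply: cvgB => //; exact: cvg_cst.
- exact: cvg_cst.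
apply: nearW => x; rewrite fnorm_ge0 /=; apply: le_trans (fnorm_le_sum _) _.
apply: ler_sum => i _; apply: ler_sum => j _; apply: le_trans (normc_le _) _.
by rewrite !mxE; case: (f x i j).
Qed.

Lemma fnorm_lim_le m n (f : nat -> 'M[C]_(m, n)) (M : 'M[C]_(m, n)) (c : R) N0 :
  f @ \oo --> M -> (forall N, (N0 <= N)%N -> fnorm (f N) <= c) -> fnorm M <= c.
Proof.
move=> /cvg_fnormP fM hc; rewrite leNgt; apply/negP => cM.
have [|N /= [h1 h2]] := filter_ex (filterI (fM (fnorm M - c) _) (nbhs_infty_ge N0)).
  by rewrite subr_gt0.
have := hc N h2; have := fnormB (f N) (f N - M); rewrite opprB addrC subrK; lra.
Qed.

Lemma cvg_mulmxl T (F : set_system T) {FF : Filter F} m n p (A : 'M[C]_(m, n))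
  (f : T -> 'M[C]_(n, p)) (M : 'M[C]_(n, p)) :
  f @ F --> M -> (fun x => A *m f x) @ F --> A *m M.
Proof.
move=> /cvg_fnormP fM; apply/cvg_fnormP => e e0.
have h : 0 < fnorm A + 1 by rewrite ltr_wpDl// fnorm_ge0.
apply: filterS (fM (e / (fnorm A + 1)) _) => [x|]; last exact: divr_gt0.
rewrite ltr_pdivlMr// -mulmxBr; apply: le_lt_trans.
apply: le_trans (fnormM _ _) _; rewrite mulrC ler_wpM2l ?fnorm_ge0//; lra.
Qed.

Lemma cvg_mulmxr T (F : set_system T) {FF : Filter F} m n p (A : 'M[C]_(n, p))
  (f : T -> 'M[C]_(m, n)) (M : 'M[C]_(m, n)) :
  f @ F --> M -> (fun x => f x *m A) @ F --> M *m A.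
Proof.
move=> /cvg_fnormP fM; apply/cvg_fnormP => e e0.
have h : 0 < fnorm A + 1 by rewrite ltr_wpDl// fnorm_ge0.
apply: filterS (fM (e / (fnorm A + 1)) _) => [x|]; last exact: divr_gt0.
rewrite ltr_pdivlMr// -mulmxBl; apply: le_lt_trans.
apply: le_trans (fnormM _ _) _; rewrite ler_wpM2l ?fnorm_ge0//; lra.
Qed.

Lemma cvg_mxB T (F : set_system T) {FF : Filter F} m n
  (f g : T -> 'M[C]_(m, n)) (M N : 'M[C]_(m, n)) :
  f @ F --> M -> g @ F --> N -> (fun x => f x - g x) @ F --> M - N.
Proof.
move=> /cvg_fnormP fM /cvg_fnormP gN; apply/cvg_fnormP => e e0.
have e2 : 0 < e / 2 by rewrite divr_gt0.
apply: filterS (filterI (fM _ e2) (gN _ e2)) => x [h1 h2].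
rewrite (_ : f x - g x - (M - N) = f x - M - (g x - N)); last first.
  by rewrite !opprB addrACA [RHS]addrACA; congr (_ + _); rewrite addrC.
by apply: le_lt_trans (fnormB _ _) _; rewrite [ltRHS]splitr ltrD.
Qed.

Definition expS n (X : 'M[C]_n) N := \sum_(0 <= k < N) (k`!%:R : C)^-1 *: X ^+ k.

Lemma mxexprS n (X : 'M[C]_n) k : X ^+ k.+1 = X *m X ^+ k.
Proof. exact: exprS. Qed.

Lemma mxexpr0 n (X : 'M[C]_n) : X ^+ 0 = 1%:M.
Proof. exact: expr0. Qed.

(** The left factor absorbs the exponent 0, where the Frobenius norm of the identity is [sqrt n]
    instead of 1. *)
Lemma fnorm_mulX m n (A : 'M[C]_(m, n)) (X : 'M[C]_n) k :
  fnorm (A *m X ^+ k) <= fnorm A * fnorm X ^+ k.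
Proof.
elim: k A => [|k IH] A; first by rewrite mxexpr0 mulmx1 mulr1.
rewrite mxexprS mulmxA; apply: le_trans (IH _) _.
by rewrite exprS mulrA ler_wpM2r ?exprn_ge0 ?fnorm_ge0 ?fnormM.
Qed.

Lemma fnormXS n (X : 'M[C]_n) k : fnorm (X ^+ k.+1) <= fnorm X ^+ k.+1.
Proof. by rewrite mxexprS exprS fnorm_mulX. Qed.

Lemma fnormX n (X : 'M[C]_n) k : fnorm (X ^+ k) <= fnorm (1%:M : 'M[C]_n) * fnorm X ^+ k.
Proof. by rewrite -[X ^+ k]mul1mx fnorm_mulX. Qed.

Lemma factRC k : k`!%:R = (k`!%:R : R)%:C.
Proof. by rewrite rmorph_nat. Qed.

Lemma fnorm_fact n (X : 'M[C]_n) k : fnorm ((k`!%:R : C)^-1 *: X) = fnorm X / k`!%:R.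
Proof. by rewrite fnormZ normcV factRC normcR ger0_norm// mulrC. Qed.

Lemma fnorm_exp_term n (X : 'M[C]_n) k :
  fnorm ((k`!%:R : C)^-1 *: X ^+ k) <= fnorm (1%:M : 'M[C]_n) * exp_coeff (fnorm X) k.
Proof.
rewrite fnorm_fact /exp_coeff /= mulrA ler_wpM2r ?invr_ge0//; exact: fnormX.
Qed.

Lemma exp_coeff_sum_le (c : R) N : 0 <= c -> \sum_(0 <= k < N) exp_coeff c k <= expR c.
Proof.
move=> c0; apply: (@nondecreasing_cvgn_le _ (series (exp_coeff c))).
  apply/nondecreasing_seqP => k; rewrite /series /= big_nat_recr//= lerDl.
  exact: exp_coeff_ge0.
exact: is_cvg_series_exp_coeff.
Qed.

Lemma is_cvg_expS n (X : 'M[C]_n) : exists M : 'M[C]_n, expS X @ \oo --> M.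
Proof.
(* Stated for an additive [p] bounded by [normc], so as to treat real and imaginary parts together;
   both series are dominated by that of [exp_coeff]. *)
have cvgE (p : C -> R) : (forall z, `|p z| <= normc z) -> (forall x y, p (x + y) = p x + p y) ->
    forall i j, exists l : R, p (expS X N i j) @[N --> \oo] --> l.
  move=> pn pD i j; pose u k := p (((k`!%:R : C)^-1 *: X ^+ k) i j).
  have p0 : p 0 = 0 by apply: (addrI (p 0)); rewrite -pD !addr0.
  have -> : (fun N => p (expS X N i j)) = series u.
    apply/funext => N; rewrite /expS summxE /series /=.
    by elim/big_ind2: _ => // x1 x2 y1 y2 <- <-; rewrite pD.
  apply/cvg_ex/normed_cvg; apply: (@series_le_cvg _ _ (fun k => fnorm (1%:M : 'M[C]_n) * exp_coeff (fnorm X) k)).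
  - by move=> k /=.
  - by move=> k; rewrite mulr_ge0 ?fnorm_ge0 ?exp_coeff_ge0 ?fnorm_ge0.
  - move=> k /=; apply: le_trans (pn _) _; apply: le_trans (normc_le_fnorm _ _ _) _.
    exact: fnorm_exp_term.
  - by apply: is_cvg_seriesZ; exact: is_cvg_series_exp_coeff.
have hRe := cvgE _ (@Re_le_normc R) (@ReD R).
have hIm := cvgE _ (@Im_le_normc R) (fun x y => let: p +i* q := x in let: u +i* v := y in erefl).
exists (\matrix_(i, j) (projT1 (cid (hRe i j)) +i* projT1 (cid (hIm i j)))%C).
apply: cvg_entriesP => i j; [exact: (projT2 (cid (hRe i j)))|exact: (projT2 (cid (hIm i j)))].
Qed.

End MatrixTopology.

Arguments cvg_mulmxl {R T F FF m n p} A {f M} _ [_] _.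
Arguments cvg_mulmxr {R T F FF m n p} A {f M} _ [_] _.

(** * The matrix exponential *)

HB.lock Definition mexp (R : realType) n (X : 'M[R[i]]_n) : 'M[R[i]]_n := expmx X.

Section Exponential.
Variable R : realType.
Local Notation C := R[i].

Lemma expS_cvg n (X : 'M[C]_n) : expS X @ \oo --> mexp X.
Proof.
by rewrite mexp.unlock; have [M hM] := is_cvg_expS X; apply/cvg_ex; exists M.
Qed.

Arguments expS_cvg {n} X [_] _.

(** Telescoping gives [k c^(k-1)] as Lipschitz constant of the k-th power on the ball of radius [c];
    divided by [k!], these constants sum to the exponential series of [c]. *)
Lemma mexp_lip n (X Y : 'M[C]_n) c : fnorm X <= c -> fnorm Y <= c ->
  fnorm (mexp X - mexp Y) <= expR c * fnorm (X - Y).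
Proof.
move=> hX hY; have c0 : 0 <= c by apply: le_trans hX; exact: fnorm_ge0.
apply: (fnorm_lim_le (N0 := 0%N) (cvg_mxB (expS_cvg X) (expS_cvg Y))) => N _.
have powB k : fnorm (X ^+ k - Y ^+ k) <= k%:R * c ^+ k.-1 * fnorm (X - Y).
  elim: k => [|k IH]; first by rewrite !mxexpr0 subrr fnorm0 !mul0r.
  have -> : X ^+ k.+1 - Y ^+ k.+1 = X *m (X ^+ k - Y ^+ k) + (X - Y) *m Y ^+ k.
    by rewrite !mxexprS mulmxBr mulmxBl addrA subrK.
  apply: le_trans (fnormD _ _) _.
  have h1 : fnorm (X *m (X ^+ k - Y ^+ k)) <= k%:R * c ^+ k * fnorm (X - Y).
    apply: le_trans (fnormM _ _) _; apply: le_trans (ler_wpM2l (fnorm_ge0 _) IH) _.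
    case: k {IH} => [|k] /=; first by rewrite !mul0r mulr0.
    rewrite mulrA ler_wpM2r ?fnorm_ge0// mulrCA ler_wpM2l ?ler0n// exprS.
    by rewrite ler_wpM2r// exprn_ge0.
  have h2 : fnorm ((X - Y) *m Y ^+ k) <= c ^+ k * fnorm (X - Y).
    apply: le_trans (fnorm_mulX _ _ _) _; rewrite mulrC ler_wpM2r ?fnorm_ge0//.
    by rewrite lerXn2r ?nnegrE ?fnorm_ge0.
  by apply: le_trans (lerD h1 h2) _; rewrite -mulrDl ler_wpM2r ?fnorm_ge0//= -[k.+1%:R]natr1 mulrDl mul1r.
rewrite /expS -sumrB; apply: le_trans (fnorm_sum _ _ _) _.
apply: (@le_trans _ _ ((\sum_(0 <= k < N) exp_coeff c k) * fnorm (X - Y))); last first.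
  by rewrite ler_wpM2r ?fnorm_ge0 ?exp_coeff_sum_le.
case: N => [|N]; first by rewrite !big_geq// mul0r.
(* The term of index 0 vanishes on the left; the others are shifted by one, since
   [k / k! = 1 / (k-1)!]. *)
rewrite big_nat_recl//= [X in _ <= X * _]big_nat_recr//= !mxexpr0 subrr fnorm0 add0r.
rewrite mulrDl -[leLHS]addr0; apply: lerD; last first.
  by rewrite mulr_ge0 ?fnorm_ge0 ?exp_coeff_ge0.
rewrite mulr_suml; apply: ler_sum => k _; rewrite -scalerBr fnorm_fact.
apply: le_trans (ler_wpM2r _ (powB _)) _; first by rewrite invr_ge0 ler0n.
rewrite /= /exp_coeff /= factS natrM invfM.
rewrite le_eqVlt; apply/orP; left; apply/eqP; field.
by rewrite pnatr_eq0 -lt0n fact_gt0 /= nat1r pnatr_eq0.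
Qed.

(** The square is factored out of the tail, and [(k+2)!] is replaced by the smaller [k!], which
    leaves an exponential series. *)
Lemma mexp_taylor1 n (X : 'M[C]_n) :
  fnorm (mexp X - 1%:M - X) <= fnorm X ^+ 2 * expR (fnorm X).
Proof.
have h : (fun N => expS X N - (1%:M + X)) @ \oo --> mexp X - (1%:M + X).
  by apply: cvg_mxB; [exact: expS_cvg|exact: cvg_cst].
rewrite -addrA -opprD.
apply: (fnorm_lim_le (N0 := 2%N) h) => -[//|[//|N]] _.
rewrite /expS 2?big_nat_recl//= mxexpr0 mxexprS mxexpr0 mulmx1 !invr1 !scale1r.
rewrite [X in fnorm X](_ : _ = \sum_(0 <= k < N) (k.+2`!%:R : C)^-1 *: X ^+ k.+2); last first.
  by apply/eqP; rewrite subr_eq [eqbRHS]addrC addrA.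
apply: le_trans (fnorm_sum _ _ _) _.
apply: (@le_trans _ _ (fnorm X ^+ 2 * (\sum_(0 <= k < N) exp_coeff (fnorm X) k))); last first.
  by rewrite ler_wpM2l ?sqr_ge0// exp_coeff_sum_le// fnorm_ge0.
rewrite mulr_sumr; apply: ler_sum => k _; rewrite fnorm_fact /exp_coeff /= mulrA -exprD.
apply: (@le_trans _ _ (fnorm X ^+ k.+2 / k.+2`!%:R)).
  by rewrite ler_wpM2r ?invr_ge0// fnormXS.
rewrite ler_wpM2l ?exprn_ge0 ?fnorm_ge0// lef_pV2 ?posrE ?ltr0n ?fact_gt0//.
by rewrite ler_nat !factS mulnA leq_pmull.
Qed.

(** The relation passes to powers and hence to the limit; conjugation by a unit and commutation are
    its two main uses. *)
Lemma mexp_intertwine m n (X : 'M[C]_m) (P : 'M[C]_(m, n)) (Y : 'M[C]_n) :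
  X *m P = P *m Y -> mexp X *m P = P *m mexp Y.
Proof.
move=> h; have hk k : X ^+ k *m P = P *m Y ^+ k.
  elim: k => [|k IH]; first by rewrite !mxexpr0 mulmx1 mul1mx.
  by rewrite !mxexprS -mulmxA IH mulmxA h mulmxA.
have h1 := cvg_mulmxr P (expS_cvg X).
apply: (cvg_fnorm_unique (h1 _)).
have -> : (fun N => expS X N *m P) = (fun N => P *m expS Y N).
  apply/funext => N; rewrite /expS mulmx_suml mulmx_sumr.
  by apply: eq_bigr => k _; rewrite -scalemxAl -scalemxAr hk.
exact: (cvg_mulmxl P (expS_cvg Y)).
Qed.

Lemma mexp_conj n (P : 'M[C]_n) X : P \in unitmx ->
  mexp (P *m X *m invmx P) = P *m mexp X *m invmx P.
Proof.
move=> hP; apply: (can_inj (mulmxK hP)); rewrite mulmxKV//.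
by apply: mexp_intertwine; rewrite mulmxKV.
Qed.

Lemma mexp_adj n (X : 'M[C]_n) : mexp (X^t*) = (mexp X)^t*.
Proof.
apply: (cvg_fnorm_unique (expS_cvg _)); apply/cvg_fnormP => e e0.
have /cvg_fnormP/(_ e e0) := expS_cvg X; apply: filterS => N.
rewrite -fnorm_adj adjmxB; congr (fnorm (_ - _) < e).
rewrite /expS adjmx_sum; apply: eq_bigr => k _; rewrite adjmxZ factRC -fmorphV conjc_real.
congr (_ *: _); elim: k => [|k IH]; first by rewrite !mxexpr0 adjmx1.
by rewrite mxexprS adjmxM IH -[LHS]/((X^t*)^+k * X^t*) -exprSr.
Qed.

(** Built from the real [expR], [cos] and [sin], so that the addition law is inherited from theirs;
    the agreement with the series is [cexp_series]. *)
Definition cexp (z : C) : C :=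
  (expR (complex.Re z))%:C * (cos (complex.Im z) +i* sin (complex.Im z))%C.

Lemma cexpD z w : cexp (z + w) = cexp z * cexp w.
Proof.
case: z => a b; case: w => c d; rewrite /cexp /= expRD cosD sinD.
by congr (_ +i* _)%C; ring.
Qed.

Lemma cexp0 : cexp 0 = 1.
Proof. by rewrite /cexp /= expR0 cos0 sin0 mul1r. Qed.

Lemma cexpR (a : R) : cexp a%:C = (expR a)%:C.
Proof. by rewrite /cexp /= cos0 sin0 mulr1. Qed.

Lemma cexp_neq0 z : cexp z != 0.
Proof.
apply/eqP => z0; have := cexpD z (- z); rewrite subrr cexp0 z0 mul0r => /eqP.
by rewrite oner_eq0.
Qed.

Lemma cexp_nat z m : cexp (m%:R * z) = cexp z ^+ m.
Proof.
elim: m => [|m IH]; first by rewrite mul0r cexp0.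
by rewrite -natr1 mulrDl mul1r cexpD IH exprSr.
Qed.

Lemma cexp_sum I (r : seq I) (F : I -> C) :
  cexp (\sum_(i <- r) F i) = \prod_(i <- r) cexp (F i).
Proof. by elim/big_ind2: _ => [|x1 x2 y1 y2 <- <-|]; rewrite ?cexp0 ?cexpD. Qed.

(* On the axes the exponential series splits into the real series of [expR], [cos] and [sin];
   no other complex argument is ever needed. *)
Definition axial (z : C) := (complex.Im z == 0) || (complex.Re z == 0).

Lemma cexp_series z : axial z ->
  (complex.Re (\sum_(0 <= k < N) (k`!%:R : C)^-1 * z ^+ k) @[N --> \oo] --> complex.Re (cexp z)) /\
  (complex.Im (\sum_(0 <= k < N) (k`!%:R : C)^-1 * z ^+ k) @[N --> \oo] --> complex.Im (cexp z)).
Proof.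
have key (p q : R ^nat) : (forall k, (k`!%:R : C)^-1 * z ^+ k = (p k +i* q k)%C) ->
    ((fun N => complex.Re (\sum_(0 <= k < N) (k`!%:R : C)^-1 * z ^+ k)) = series p) /\
    ((fun N => complex.Im (\sum_(0 <= k < N) (k`!%:R : C)^-1 * z ^+ k)) = series q).
  move=> h; have hN N : \sum_(0 <= k < N) (k`!%:R : C)^-1 * z ^+ k = (series p N +i* series q N)%C.
    rewrite /series /=; elim/big_rec3: _ => // k x y w _ ->; rewrite h //.
  by split; apply/funext => N; rewrite hN.
rewrite /axial; case: z key => a b key /= /orP[]/eqP h0; subst.
  have [|-> ->] := key (exp_coeff a) (fun=> 0).
    move=> k; rewrite factRC -fmorphV -[(a +i* 0)%C]/(a%:C) -rmorphXn -rmorphM /=.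
    by rewrite /exp_coeff /= mulrC.
  rewrite /cexp /= cos0 sin0 !mul0r !mulr0 !mulr1 addr0 subr0; split.
    exact: is_cvg_series_exp_coeff.
  have -> : series (fun=> 0 : R) = (fun=> 0) by apply/funext => N; rewrite /series /= big1.
  exact: cvg_cst.
have [|-> ->] := key (cos_coeff b) (sin_coeff b).
  move=> k; rewrite factRC -fmorphV.
  have -> : ((0 +i* b)%C : C) = 'i%C * b%:C by apply/eqP; rewrite eq_complex /=; apply/andP; split; apply/eqP; ring.
  have i2 j : ('i%C : C) ^+ (j.*2) = ((-1) ^+ j)%:C.
    by rewrite -mul2n exprM sqr_i rmorphXn rmorphN1.
  rewrite exprMn -rmorphXn /cos_coeff /sin_coeff /=.
  rewrite -(odd_double_half k); case: (odd k); move: k./2 => j; rewrite ?add1n ?add0n.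
    rewrite exprS i2 /= odd_double uphalf_double doubleK -exprnP mulrA mulrAC -!rmorphM/=.
    by apply/eqP; rewrite eq_complex /=; apply/andP; split; apply/eqP; ring.
  rewrite i2 -!rmorphM /= odd_double doubleK -exprnP /=.
  by apply/eqP; rewrite eq_complex /=; apply/andP; split; apply/eqP; ring.
rewrite /cexp /= expR0 !mul1r !mul0r subr0 addr0; split.
  by rewrite cos.unlock; exact: is_cvg_series_cos_coeff.
by rewrite sin.unlock; exact: is_cvg_series_sin_coeff.
Qed.

End Exponential.

Arguments expS_cvg {R n} X [_] _.

(** * Spectral calculus of Hermitian matrices *)

Section HermitianCalculus.
Variable R : realType.
Local Notation C := R[i].

Lemma unitaryP n (U : 'M[C]_n) : U \is unitarymx ->
  U *m U^t* = 1%:M /\ U^t* *m U = 1%:M.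
Proof.
move=> hU; split; first exact/unitarymxP.
by rewrite -(invmx_unitary hU) mulVmx ?unitarymx_unit.
Qed.

Lemma unitaryI n (U : 'M[C]_n) : U *m U^t* = 1%:M -> U \is unitarymx.
Proof. by move=> h; apply/unitarymxP. Qed.

Definition dg n (a : 'I_n -> R) : 'M[C]_n := diag_mx (\row_i (a i)%:C).
Definition dgc n (a : 'I_n -> C) : 'M[C]_n := diag_mx (\row_i a i).

Lemma dgE n (a : 'I_n -> R) : dg a = dgc (fun i => (a i)%:C).
Proof. by []. Qed.

Lemma dgcE n (a : 'I_n -> C) i j : dgc a i j = (a i) *+ (i == j).
Proof. by rewrite !mxE. Qed.

Lemma mul_dgcl n m (a : 'I_n -> C) (A : 'M[C]_(n, m)) i j :
  (dgc a *m A) i j = a i * A i j.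
Proof. by rewrite mul_diag_mx !mxE. Qed.

Lemma mul_dgcr n m (a : 'I_n -> C) (A : 'M[C]_(m, n)) i j :
  (A *m dgc a) i j = A i j * a j.
Proof. by rewrite mul_mx_diag !mxE. Qed.

Lemma dgcM n (a b : 'I_n -> C) : dgc a *m dgc b = dgc (fun i => a i * b i).
Proof. by apply/matrixP => i j; rewrite mul_dgcl !dgcE mulrnAr. Qed.

Lemma dgc1 n : dgc (fun _ : 'I_n => 1) = 1%:M.
Proof. by apply/matrixP => i j; rewrite !mxE. Qed.

Lemma dgcZ n z (a : 'I_n -> C) : z *: dgc a = dgc (fun i => z * a i).
Proof. by apply/matrixP => i j; rewrite !mxE mulrnAr. Qed.

Lemma dgc_adj n (a : 'I_n -> C) : (dgc a)^t* = dgc (fun i => (a i)^*%C).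
Proof.
apply/matrixP => i j; rewrite adjmxE !dgcE eq_sym.
by case: eqP => [->|_]; rewrite ?mulr1n ?mulr0n ?conjc0.
Qed.

Lemma dg_adj n (a : 'I_n -> R) : (dg a)^t* = dg a.
Proof. by rewrite dgE dgc_adj; congr dgc; apply/funext => i; rewrite conjc_real. Qed.

Lemma dgc_expr n (a : 'I_n -> C) k : dgc a ^+ k = dgc (fun i => a i ^+ k).
Proof.
elim: k => [|k IH]; first by rewrite mxexpr0 -dgc1.
by rewrite mxexprS IH dgcM; congr dgc; apply/funext => i; rewrite exprS.
Qed.

Lemma mexp_dgc n (z : 'I_n -> C) : (forall i, axial (z i)) ->
  mexp (dgc z) = dgc (fun i => cexp (z i)).
Proof.
move=> hz; apply: (cvg_fnorm_unique (expS_cvg (dgc z))).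
have -> : dgc (fun i => cexp (z i)) = \matrix_(i, j)
    ((complex.Re (cexp (z i)) *+ (i == j)) +i* (complex.Im (cexp (z i)) *+ (i == j)))%C.
  by apply/matrixP => i j; rewrite dgcE mxE; case: eqP => _; rewrite ?mulr1n ?mulr0n; case: (cexp (z i)).
have E N i j : expS (dgc z) N i j = (\sum_(0 <= k < N) (k`!%:R : C)^-1 * z i ^+ k) *+ (i == j).
  rewrite summxE -sumrMnl; apply: eq_bigr => k _.
  by rewrite mxE dgc_expr dgcE mulrnAr.
have := @cvg_entriesP R nat \oo _ n n (expS (dgc z))
  (fun i j => complex.Re (cexp (z i)) *+ (i == j))
  (fun i j => complex.Im (cexp (z i)) *+ (i == j)).
apply => i j.
  have -> : (fun N => complex.Re (expS (dgc z) N i j)) =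
      (fun N => complex.Re (\sum_(0 <= k < N) (k`!%:R : C)^-1 * z i ^+ k) *+ (i == j)).
    by apply/funext => N; rewrite E; case: eqP.
  by case: eqP => _ /=; [exact: (cexp_series (hz i)).1|exact: cvg_cst].
have -> : (fun N => complex.Im (expS (dgc z) N i j)) =
    (fun N => complex.Im (\sum_(0 <= k < N) (k`!%:R : C)^-1 * z i ^+ k) *+ (i == j)).
  by apply/funext => N; rewrite E; case: eqP.
by case: eqP => _ /=; [exact: (cexp_series (hz i)).2|exact: cvg_cst].
Qed.

Lemma axialR (a : R) : axial (a%:C : C).
Proof. by rewrite /axial eqxx. Qed.

Lemma axialI (a : R) : axial ('i%C * a%:C : C).
Proof. by apply/orP; right; apply/eqP => /=; ring. Qed.

Lemma axialZ z (a : R) : axial z -> axial (z * a%:C).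
Proof.
by case: z => b c; rewrite /axial /= !mulr0 subr0 add0r => /orP[]/eqP->;
  rewrite ?mul0r eqxx ?orbT.
Qed.

Lemma herm_spectral n (X : 'M[C]_n) : X^t* = X ->
  exists U : 'M[C]_n, exists a : 'I_n -> R,
    U \is unitarymx /\ X = U *m dg a *m U^t*.
Proof.
move=> hX; have hs : X \is hermsymmx by rewrite is_hermitianmxE expr0 scale1r hX.
have /orthomx_spectralP := hermitian_normalmx hs.
have hP := spectral_unitarymx X.
rewrite (invmx_unitary hP) => hE.
have hr := hermitian_spectral_diag_real hs.
exists ((spectralmx X)^t*), (fun i => complex.Re (spectral_diag X 0 i)); split.
  by rewrite trmxC_unitary.
rewrite trmxCK {1}hE; congr (_ *m _ *m _); congr diag_mx; apply/rowP => i.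
by rewrite [RHS]mxE RRe_real//; apply: (mxOverP hr).
Qed.

Lemma perm_mx_unitary n (s : 'S_n) : (perm_mx s : 'M[C]_n) \is unitarymx.
Proof.
apply/unitaryI; rewrite tr_perm_mx map_perm_mx -perm_mxM.
by rewrite mulgV perm_mx1.
Qed.

(** The ascending order of the eigenvalues is what the Abel summation in [abel_sum_le0] asks for. *)
Lemma herm_spectral_sorted n (X : 'M[C]_n) : X^t* = X ->
  exists U : 'M[C]_n, exists a : 'I_n -> R,
    [/\ U \is unitarymx, X = U *m dg a *m U^t* &
      forall i j : 'I_n, (i <= j)%N -> a i <= a j].
Proof.
move=> /herm_spectral[U [a [hU ->]]].
pose t := sort <=%R (codom a).
have szt : size t = n by rewrite size_sort size_codom card_ord.
have /tuple_permP[s hs] : perm_eq (Tuple (introT eqP szt)) [tuple a i | i < n].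
  by rewrite /= perm_sort /codom /image_mem.
have hnth (i : 'I_n) : nth 0 t i = a (s i).
  by rewrite [t](hs : t = [tuple tnth [tuple a i0 | i0 < n] (s i0) | i0 < n]) -tnth_nth !tnth_mktuple.
exists (U *m (perm_mx s)^t*), (fun i => a (s i)); split.
- by apply: mul_unitarymx; [exact: hU|rewrite trmxC_unitary; exact: perm_mx_unitary].
- rewrite adjmxM trmxCK -!mulmxA; congr (_ *m _); rewrite !mulmxA; congr (_ *m _).
  have [_ h2] := unitaryP (perm_mx_unitary s).
  rewrite -[LHS]mul1mx -h2 -!mulmxA; congr (_ *m _); apply/matrixP => i j.
  rewrite !dgE mul_dgcl mul_dgcr !mxE; case: eqP => [->|_]; first exact: mulrC.
  by rewrite mulr0 mul0r.
- move=> i j ij; rewrite -!hnth; apply: (sorted_leq_nth (leT := <=%R)) => //.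
  - exact: le_trans.
  - exact: sort_sorted le_total _.
  - by rewrite inE szt.
  - by rewrite inE szt.
Qed.

Lemma mexp_conjU n (U : 'M[C]_n) X : U \is unitarymx ->
  mexp (U *m X *m U^t*) = U *m mexp X *m U^t*.
Proof.
by move=> hU; rewrite -(invmx_unitary hU) mexp_conj// unitarymx_unit.
Qed.

Lemma mexp_spectral n (U : 'M[C]_n) (a : 'I_n -> R) z : U \is unitarymx -> axial z ->
  mexp (z *: (U *m dg a *m U^t*)) = U *m dgc (fun i => cexp (z * (a i)%:C)) *m U^t*.
Proof.
move=> hU hz; rewrite scalemxAl scalemxAr mexp_conjU// dgE dgcZ mexp_dgc//.
by move=> i; exact: axialZ.
Qed.

Lemma mexp_spectral1 n (U : 'M[C]_n) (a : 'I_n -> R) : U \is unitarymx ->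
  mexp (U *m dg a *m U^t*) = U *m dg (fun i => expR (a i)) *m U^t*.
Proof.
move=> hU; rewrite -[X in mexp X]scale1r mexp_spectral ?(axialR 1)//.
congr (_ *m _ *m _); rewrite dgE; congr dgc; apply/funext => i.
by rewrite mul1r cexpR.
Qed.

Lemma mexpD_herm n (X : 'M[C]_n) z w : X^t* = X -> axial z -> axial w ->
  axial (z + w) -> mexp ((z + w) *: X) = mexp (z *: X) *m mexp (w *: X).
Proof.
move=> /herm_spectral[U [a [hU ->]]] hz hw hzw; rewrite !mexp_spectral//.
have [_ h] := unitaryP hU.
rewrite !mulmxA -(mulmxA _ (U^t*) U) h mulmx1 -!mulmxA; congr (_ *m _); rewrite mulmxA.
by rewrite dgcM; congr (dgc _ *m _); apply/funext => i; rewrite mulrDl cexpD.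
Qed.

Lemma mexp0 n : mexp (0 : 'M[C]_n) = 1%:M.
Proof.
have -> : (0 : 'M[C]_n) = dgc (fun=> 0) by apply/matrixP => i j; rewrite !mxE mul0rn.
rewrite mexp_dgc => [|i]; last exact: (axialR 0).
by rewrite -dgc1; congr dgc; apply/funext => i; rewrite cexp0.
Qed.

Lemma mexp_hermM n (X : 'M[C]_n) (s t : R) : X^t* = X ->
  mexp ((s + t)%:C *: X) = mexp (s%:C *: X) *m mexp (t%:C *: X).
Proof. by move=> hX; rewrite rmorphD mexpD_herm ?axialR -?rmorphD ?axialR. Qed.

Lemma mexp_hermMi n (X : 'M[C]_n) (s t : R) : X^t* = X ->
  mexp (('i%C * (s + t)%:C) *: X) = mexp (('i%C * s%:C) *: X) *m mexp (('i%C * t%:C) *: X).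
Proof.
move=> hX; rewrite rmorphD mulrDr mexpD_herm ?axialI//.
by rewrite -mulrDr -rmorphD axialI.
Qed.

Lemma mexp_hermN n (X : 'M[C]_n) : X^t* = X -> mexp X *m mexp (- X) = 1%:M.
Proof.
move=> hX; have := mexp_hermM 1 (-1) hX.
by rewrite subrr scale0r mexp0 scale1r rmorphN1 scaleN1r.
Qed.

Lemma mexp_herm_unit n (X : 'M[C]_n) : X^t* = X -> mexp X \in unitmx.
Proof. by move=> /mexp_hermN/mulmx1_unit[]. Qed.

Lemma mexp_herm_inv n (X : 'M[C]_n) : X^t* = X -> invmx (mexp X) = mexp (- X).
Proof.
move=> hX; rewrite -[LHS]mulmx1 -(mexp_hermN hX) mulmxA mulVmx ?mul1mx//.
exact: mexp_herm_unit.
Qed.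

Lemma mexp_herm_adj n (X : 'M[C]_n) : X^t* = X -> (mexp X)^t* = mexp X.
Proof. by move=> hX; rewrite -mexp_adj hX. Qed.

Lemma herm_scale n (X : 'M[C]_n) (a : R) : X^t* = X -> (a%:C *: X)^t* = a%:C *: X.
Proof. by move=> hX; rewrite adjmxZr hX. Qed.

Lemma mexp_hermZ_adj n (X : 'M[C]_n) (a : R) : X^t* = X ->
  (mexp (a%:C *: X))^t* = mexp (a%:C *: X).
Proof. by move=> hX; apply: mexp_herm_adj; exact: herm_scale. Qed.

Lemma mexp_hermZ_unit n (X : 'M[C]_n) (a : R) : X^t* = X -> mexp (a%:C *: X) \in unitmx.
Proof. by move=> hX; apply: mexp_herm_unit; exact: herm_scale. Qed.

Lemma mexp_half n (X : 'M[C]_n) : X^t* = X ->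
  mexp ((2^-1 : R)%:C *: X) *m mexp ((2^-1 : R)%:C *: X) = mexp X.
Proof. by move=> hX; rewrite -mexp_hermM// (_ : 2^-1 + 2^-1 = 1) ?scale1r//; lra. Qed.

Lemma mexp_skew_unitary n (X : 'M[C]_n) (t : R) : X^t* = X ->
  mexp (('i%C * t%:C) *: X) \is unitarymx.
Proof.
move=> hX; apply/unitaryI; rewrite -mexp_adj adjmxZ hX.
have -> : ('i%C * t%:C : C)^*%C = 'i%C * (- t)%:C.
  by apply/eqP; rewrite eq_complex /=; apply/andP; split; apply/eqP; ring.
by rewrite -mexp_hermMi// subrr mulr0 scale0r mexp0.
Qed.

Lemma fnorm_dg n (a : 'I_n -> R) : fnorm (dg a) ^+ 2 = \sum_i a i ^+ 2.
Proof.
rewrite fnorm_sqr fdotXX; apply: eq_bigr => i _; rewrite (bigD1 i)//= big1 ?addr0.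
  by rewrite dgE dgcE eqxx mulr1n normcR real_normK ?num_real.
by move=> j ji; rewrite dgE dgcE eq_sym (negPf ji) mulr0n normc0 expr0n.
Qed.

Lemma fnorm_spectral n (U : 'M[C]_n) (a : 'I_n -> R) : U \is unitarymx ->
  fnorm (U *m dg a *m U^t*) ^+ 2 = \sum_i a i ^+ 2.
Proof.
by move=> hU; rewrite fnorm_unitaryr ?trmxC_unitary// fnorm_unitaryl// fnorm_dg.
Qed.

Lemma quad_spectral n (U : 'M[C]_n) (a : 'I_n -> R) (w : 'cV[C]_n) :
  (w^t* *m (U *m dg a *m U^t*) *m w) 0 0 =
  (\sum_i a i * normc ((U^t* *m w) i 0) ^+ 2)%:C.
Proof.
have -> : w^t* *m (U *m dg a *m U^t*) *m w = (U^t* *m w)^t* *m dg a *m (U^t* *m w).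
  by rewrite adjmxM trmxCK !mulmxA.
rewrite mxE rmorph_sum; apply: eq_bigr => i _.
by rewrite dgE mul_dgcr adjmxE rmorphM /= -mul_conj_normc; ring.
Qed.

Lemma posdef_mexp n (X : 'M[C]_n) : X^t* = X -> posdef (mexp X).
Proof.
move=> hX; split; first exact: mexp_herm_adj.
move=> w w0; move: hX => /herm_spectral[U [a [hU ->]]]; have [h1 h2] := unitaryP hU.
rewrite mexp_spectral1// quad_spectral ltcR.
have w1 : U^t* *m w != 0.
  by apply: contra_neq w0 => h; rewrite -[w]mul1mx -h1 -mulmxA h mulmx0.
rewrite lt_neqAle eq_sym sumr_ge0 ?andbT => [|i _]; last by rewrite mulr_ge0 ?expR_ge0 ?sqr_ge0.
apply: contra_neq w1 => /eqP; rewrite psumr_eq0 => [/allP h|i _]; last by rewrite mulr_ge0 ?expR_ge0 ?sqr_ge0.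
apply/colP => i; rewrite [RHS]mxE; apply: eq0_normc; have := h i (mem_index_enum _).
by rewrite mulf_eq0 sqrf_eq0 gt_eqF ?expR_gt0//= => /eqP.
Qed.

Lemma posdef_log n (P : 'M[C]_n) : posdef P -> exists2 X : 'M[C]_n, X^t* = X & P = mexp X.
Proof.
move=> [/herm_spectral[U [a [hU ->]]] hP]; have [h1 h2] := unitaryP hU.
have a0 i : 0 < a i.
  (* Testing positivity on the i-th eigenvector isolates the eigenvalue [a i]. *)
  have /hP : U *m delta_mx i 0 != 0 :> 'cV[C]_n.
    apply: contraTneq (oner_neq0 C) => h; have : U^t* *m (U *m delta_mx i 0) = 0 :> 'cV[C]_n by rewrite h mulmx0.
    rewrite mulmxA h2 mul1mx => /colP/(_ i); rewrite !mxE !eqxx /= => /eqP.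
    by rewrite oner_eq0.
  rewrite quad_spectral ltcR mulmxA h2 mul1mx (bigD1 i)//= big1 ?addr0 => [|j ji].
    by rewrite mxE !eqxx mulr1n normc1 expr1n mulr1.
  by rewrite mxE (negPf ji) mulr0n normc0 expr0n mulr0.
exists (U *m dg (fun i => ln (a i)) *m U^t*); first by rewrite !adjmxM trmxCK dg_adj mulmxA.
rewrite mexp_spectral1//; congr (_ *m dg _ *m _); apply/funext => i.
by rewrite lnK ?posrE.
Qed.

(* In eigenbases of [A] and [B] the hypothesis reads [D i j * e^(a j) =
   e^(b i) * D i j], which forces [a j = b i] wherever [D i j] is nonzero. *)
Lemma mexp_intertwine_inv m n (A : 'M[C]_n) (B : 'M[C]_m) (P : 'M[C]_(m, n)) :
  A^t* = A -> B^t* = B -> P *m mexp A = mexp B *m P -> P *m A = B *m P.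
Proof.
move=> /herm_spectral[U [a [hU ->]]] /herm_spectral[W [b [hW ->]]].
rewrite !mexp_spectral1//; have [u1 u2] := unitaryP hU; have [w1 w2] := unitaryP hW.
set D := W^t* *m P *m U => h.
have PE : P = W *m D *m U^t* by rewrite /D !mulmxA w1 mul1mx -mulmxA u1 mulmx1.
have hD : D *m dg (fun i => expR (a i)) = dg (fun i => expR (b i)) *m D.
  rewrite /D; transitivity (W^t* *m (P *m (U *m dg (fun i => expR (a i)) *m U^t*)) *m U).
    by rewrite !mulmxA -(mulmxA _ (U^t*)) u2 mulmx1.
  by rewrite h !mulmxA w2 mul1mx.
move: PE hD; clear h; clearbody D => PE hD.
suff E : D *m dg a = dg b *m D.
  rewrite PE !mulmxA -(mulmxA _ (U^t*) U) u2 mulmx1 -(mulmxA _ (W^t*) W) w2 mulmx1.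
  by rewrite -(mulmxA W) E !mulmxA.
apply/matrixP => i j; have /matrixP/(_ i j) := hD.
rewrite !dgE !mul_dgcl !mul_dgcr; have [->|Dij] := eqVneq (D i j) 0; first by rewrite !mulr0 !mul0r.
rewrite mulrC => /(mulIf Dij)[/expR_inj ->]; exact: mulrC.
Qed.

Lemma mexp_herm_inj n (A B : 'M[C]_n) : A^t* = A -> B^t* = B -> mexp A = mexp B -> A = B.
Proof.
move=> hA hB h; have := mexp_intertwine_inv (P := 1%:M) hA hB.
by rewrite !mulmx1 !mul1mx; apply.
Qed.

Lemma mexp_taylor n (X : 'M[C]_n) : exists2 c : R, 0 <= c &
  forall t : R, `|t| <= 1 -> fnorm (mexp (t%:C *: X) - 1%:M - t%:C *: X) <= c * t ^+ 2.
Proof.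
exists (fnorm X ^+ 2 * expR (fnorm X)); first by rewrite mulr_ge0 ?sqr_ge0 ?expR_ge0.
move=> t t1; apply: le_trans (mexp_taylor1 _) _.
rewrite fnormZr exprMn real_normK ?num_real// [leRHS]mulrC -mulrA.
apply: ler_wpM2l; first exact: sqr_ge0.
apply: ler_wpM2l; first exact: sqr_ge0.
by rewrite ler_expR ler_piMl// fnorm_ge0.
Qed.

(** Unitary factors preserve the norm, so each step of the telescoping costs at most one
    [fnorm (U - W)]; [trotter] relies on this linear growth. *)
Lemma unitary_exprB n (U W : 'M[C]_n) k : U \is unitarymx -> W \is unitarymx ->
  fnorm (U ^+ k - W ^+ k) <= k%:R * fnorm (U - W).
Proof.
move=> hU hW; have hWk j : W ^+ j \is unitarymx.
  elim: j => [|j IH]; first by rewrite mxexpr0; apply/unitaryI; rewrite adjmx1 mulmx1.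
  by rewrite mxexprS mul_unitarymx.
elim: k => [|k IH]; first by rewrite !mxexpr0 subrr fnorm0 mul0r.
have -> : U ^+ k.+1 - W ^+ k.+1 = U *m (U ^+ k - W ^+ k) + (U - W) *m W ^+ k.
  by rewrite !mxexprS mulmxBr mulmxBl addrA subrK.
apply: le_trans (fnormD _ _) _; rewrite (fnorm_unitaryl _ hU) (fnorm_unitaryr _ (hWk k)).
by rewrite -natr1 mulrDl mul1r lerD2r.
Qed.

End HermitianCalculus.

(** * Nonpositive curvature of the positive definite cone: triangle inequality, exponential metric
    increase and CAT(0) *)

Section Nonpositive.
Variable R : realType.
Local Notation C := R[i].

Lemma quad_fdot n (X : 'M[C]_n) (w : 'cV[C]_n) :
  complex.Re ((w^t* *m X *m w) 0 0) = fdot (X *m w) w.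
Proof.
rewrite fdot.unlock mxtrace_mulC mulmxA; congr complex.Re.
by rewrite /mxtrace big_ord1.
Qed.

Lemma fdot_spectral n (U : 'M[C]_n) (a : 'I_n -> R) (w : 'cV[C]_n) :
  fdot ((U *m dg a *m U^t*) *m w) w = \sum_i a i * normc ((U^t* *m w) i 0) ^+ 2.
Proof. by rewrite -quad_fdot quad_spectral. Qed.

Lemma fdot_unitaryT n (U : 'M[C]_n) (w : 'cV[C]_n) : U \is unitarymx ->
  \sum_i normc ((U^t* *m w) i 0) ^+ 2 = fdot w w.
Proof.
move=> hU; have [h1 _] := unitaryP hU.
have := fdotXX (U^t* *m w); rewrite fdot_mulmxl trmxCK mulmxA h1 mul1mx => ->.
by apply: eq_bigr => i _; rewrite big_ord1.
Qed.

(* Jensen for the convex function [exp] and the probability measure given by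
   the spectral measure of [Y] at [p], completed by a mass at [0]. *)
Lemma exp_quad_le n (Y : 'M[C]_n) (p : 'cV[C]_n) : Y^t* = Y -> fdot p p <= 1 ->
  expR (fdot (Y *m p) p) <= fdot (mexp Y *m p) p + (1 - fdot p p).
Proof.
move=> /herm_spectral[U [a [hU ->]]]; rewrite mexp_spectral1// !fdot_spectral.
rewrite -(fdot_unitaryT p hU); set q := fun i => normc ((U^t* *m p) i 0) ^+ 2.
rewrite -/q => q1; set m := \sum_i _; set e := expR m.
have e0 : 0 <= e by exact: expR_ge0.
(* The tangent line of [expR] at [m], applied at the eigenvalues [a i] with mass [q i] and at 0 with
   the remaining mass. *)
have hexp x : e * (1 + (x - m)) <= expR x.
  have -> : x = m + (x - m) by ring.
  by rewrite expRD (addrC m) addrK -/e ler_wpM2l// expR_ge1Dx.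
have h1 : \sum_i (e * (1 + (a i - m))) * q i <= \sum_i expR (a i) * q i.
  by apply: ler_sum => i _; rewrite ler_wpM2r// sqr_ge0.
have h2 := hexp 0; rewrite expR0 in h2.
have h3 : (e * (1 + (0 - m))) * (1 - \sum_i q i) <= 1 * (1 - \sum_i q i).
  by rewrite ler_wpM2r// subr_ge0.
have h4 : \sum_i (e * (1 + (a i - m))) * q i = e * ((1 - m) * \sum_i q i + m).
  transitivity (e * (\sum_i (1 - m) * q i + \sum_i a i * q i)); last by rewrite -mulr_sumr.
  by rewrite -big_split mulr_sumr; apply: eq_bigr => i _ /=; ring.
have -> : e = \sum_i (e * (1 + (a i - m))) * q i + (e * (1 + (0 - m))) * (1 - \sum_i q i).
  by rewrite h4; ring.
by rewrite -[1 - \sum_i q i in leRHS]mul1r lerD.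
Qed.

Lemma det_mexp n (Y : 'M[C]_n) : Y^t* = Y -> \det (mexp Y) = (expR (complex.Re (\tr Y)))%:C.
Proof.
move=> /herm_spectral[U [a [hU ->]]]; rewrite mexp_spectral1//; have [h1 h2] := unitaryP hU.
have detU (X : 'M[C]_n) : \det (U *m X *m U^t*) = \det X.
  by rewrite !det_mulmx mulrAC -det_mulmx h1 det1 mul1r.
rewrite detU mxtrace_mulC mulmxA h2 mul1mx det_diag mxtrace_diag Re_sum expR_sum rmorph_prod /=.
by apply: eq_bigr => i _; rewrite !mxE.
Qed.

Definition upper n (A : 'M[C]_n) := forall i j : 'I_n, (j < i)%N -> A i j = 0.

Lemma upper_trig n (A : 'M[C]_n) : upper A -> is_trig_mx A^T.
Proof. by move=> h; apply/is_trig_mxP => i j ij; rewrite mxE h. Qed.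

Lemma det_upper n (A : 'M[C]_n) : upper A -> \det A = \prod_i A i i.
Proof.
move=> /upper_trig h; rewrite -det_tr det_trig//.
by apply: eq_bigr => i _; rewrite mxE.
Qed.

Lemma upper_unit n (A : 'M[C]_n) : upper A -> (forall i, A i i != 0) -> A \in unitmx.
Proof. by move=> h hA; rewrite unitmxE unitfE det_upper//; apply/prodf_neq0 => i _. Qed.

Lemma upper_unit_neq0 n (A : 'M[C]_n) i : upper A -> A \in unitmx -> A i i != 0.
Proof. by move=> h; rewrite unitmxE unitfE det_upper// => /prodf_neq0/(_ i isT). Qed.

Lemma upperM n (A B : 'M[C]_n) : upper A -> upper B -> upper (A *m B).
Proof.
move=> hA hB i j ij; rewrite mxE big1// => k _.
have [ki|ik] := ltnP k i; first by rewrite hA ?mul0r.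
by rewrite hB ?mulr0// (leq_trans ij).
Qed.

Lemma upperM_diag n (A B : 'M[C]_n) i : upper A -> upper B ->
  (A *m B) i i = A i i * B i i.
Proof.
move=> hA hB; rewrite mxE (bigD1 i)//= big1 ?addr0// => k ki.
have [k_i|ik] := ltnP k i; first by rewrite hA ?mul0r.
by rewrite hB ?mulr0// ltn_neqAle ik eq_sym andbT; apply: contra_neq ki => /val_inj.
Qed.

Lemma upper_dgc n (a : 'I_n -> C) : upper (dgc a).
Proof. by move=> i j ij; rewrite dgcE -(inj_eq val_inj) gtn_eqF. Qed.

Lemma upper_inv n (A : 'M[C]_n) : upper A -> A \in unitmx -> upper (invmx A).
Proof.
(* Strong induction on the column: in the equation [A^-1 A = 1] at [(i, j)] the summands left of [j]
   vanish by induction and those right of it by triangularity of [A]. *)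
move=> hA uA i j; have [k] := ubnP j; elim: k j => // k IH j; rewrite ltnS => jk ji.
have /matrixP/(_ i j) := mulVmx uA; rewrite mxE (bigD1 j)//= big1 ?addr0 => [|l lj].
  rewrite mxE -(inj_eq val_inj) gtn_eqF// => /eqP; rewrite mulf_eq0.
  by rewrite (negPf (upper_unit_neq0 j hA uA)) orbF => /eqP.
have [l_j|jl] := ltnP l j; first by rewrite IH ?mul0r//; [exact: leq_trans jk|exact: ltn_trans ji].
by rewrite hA ?mulr0// ltn_neqAle jl eq_sym andbT; apply: contra_neq lj => /val_inj.
Qed.

Lemma upper_inv_diag n (A : 'M[C]_n) i : upper A -> A \in unitmx ->
  invmx A i i = (A i i)^-1.
Proof.
move=> hA uA; have h0 := upper_unit_neq0 i hA uA.
apply: (mulIf h0); rewrite mulVf// -upperM_diag ?mulVmx ?mxE ?eqxx//; exact: upper_inv.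
Qed.

Lemma posdef_gram n (A : 'M[C]_n) : A \in unitmx -> posdef (A^t* *m A).
Proof.
move=> uA; split; first by rewrite adjmxM trmxCK.
move=> w w0; rewrite mulmxA -mulmxA -adjmxM.
have v0 : A *m w != 0 by apply: contra_neq w0 => h; rewrite -[w]mul1mx -(mulVmx uA) -mulmxA h mulmx0.
have -> : ((A *m w)^t* *m (A *m w)) 0 0 = (fdot (A *m w) (A *m w))%:C.
  rewrite fdotXX mxE rmorph_sum; apply: eq_bigr => i _.
  by rewrite big_ord1 adjmxE mulrC mul_conj_normc.
by rewrite ltcR -fnorm_sqr exprn_gt0// fnorm_gt0.
Qed.

Lemma gram_log n (A : 'M[C]_n) : A \in unitmx ->
  exists2 X : 'M[C]_n, X^t* = X & A^t* *m A = mexp X.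
Proof. by move=> uA; apply: posdef_log; exact: posdef_gram. Qed.

Lemma mexp_conjUt n (U : 'M[C]_n) X : U \is unitarymx ->
  mexp (U^t* *m X *m U) = U^t* *m mexp X *m U.
Proof.
move=> hU; have hU' : U^t* \is unitarymx by rewrite trmxC_unitary.
by have := mexp_conjU X hU'; rewrite trmxCK.
Qed.

(* [A' := E A E + (1 - E)], with [E] the projection to the first [k] coordinates, is upper
   triangular and its Gram matrix compresses [e^Y]; Jensen in an eigenbasis of the latter
   bounds the partial trace of [Y] by [ln (\det (A'* A'))]. *)
Lemma upper_partial_sum n (A Y : 'M[C]_n) k : upper A -> A \in unitmx -> Y^t* = Y ->
  A^t* *m A = mexp Y ->
  \sum_(i < n | (i < k)%N) complex.Re (Y i i) <=
  \sum_(i < n | (i < k)%N) ln (normc (A i i) ^+ 2).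
Proof.
move=> hA uA hY AY.
pose E : 'M[C]_n := dgc (fun i => (i < k)%:R).
have EE : E *m E = E by rewrite dgcM; congr dgc; apply/funext => i; case: (_ < _)%N; rewrite ?mulr1 ?mulr0.
have Eh : E^t* = E.
  by rewrite dgc_adj; congr dgc; apply/funext => i; case: (_ < _)%N; rewrite ?conjc0 ?conjc1.
(* Triangularity: [A] preserves the span of the first [k] coordinates. *)
have AE : A *m E = E *m A *m E.
  apply/matrixP => i j; rewrite !mul_dgcr mul_dgcl.
  have [jk|] := ltnP j k; last by rewrite !mulr0.
  have [ik|ki] := ltnP i k; first by rewrite mul1r.
  by rewrite hA ?mul0r// (leq_trans jk).
(* Introduced through an equation rather than a local definition, so that it stays opaque under
   rewriting. *)
have [F FD] : exists F : 'M[C]_n, F = 1%:M - E by exists (1%:M - E).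
have EF : E *m F = 0 by rewrite FD mulmxBr mulmx1 EE subrr.
have FE : F *m E = 0 by rewrite FD mulmxBl mul1mx EE subrr.
have FF : F *m F = F by rewrite {2}FD mulmxBr mulmx1 FE subr0.
have Fh : F^t* = F by rewrite FD adjmxB adjmx1 Eh.
pose A' : 'M[C]_n := E *m A *m E + F.
have A'gram : A'^t* *m A' = E *m mexp Y *m E + F.
  rewrite /A' adjmxD !adjmxM Eh Fh mulmxDl !mulmxDr FF.
  have -> : E *m (A^t* *m E) *m (E *m A *m E) = E *m mexp Y *m E.
    rewrite -AY -!mulmxA; congr (_ *m (_ *m _)); rewrite mulmxA EE.
    by rewrite AE !mulmxA EE.
  by rewrite -!mulmxA EF !mulmx0 !mulmxA FE !mul0mx addr0 add0r.
have A'up : upper A'.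
  move=> i j ij; rewrite /A' FD mxE mul_dgcr mul_dgcl hA// mulr0 mul0r add0r !mxE.
  by rewrite -(inj_eq val_inj) gtn_eqF//= subrr.
have A'd i : A' i i = if (i < k)%N then A i i else 1.
  rewrite /A' FD mxE mul_dgcr mul_dgcl !mxE eqxx !mulr1n; case: ifP => _.
    by rewrite mul1r mulr1 subrr addr0.
  by rewrite mulr0 subr0 add0r.
have A'u : A' \in unitmx.
  apply: upper_unit => // i; rewrite A'd; case: ifP => _; last exact: oner_neq0.
  exact: upper_unit_neq0.
have [Z hZ A'Z] := gram_log A'u.
have trZ : complex.Re (\tr Z) = \sum_(i < n | (i < k)%N) ln (normc (A i i) ^+ 2).
  apply: expR_inj; apply: complexI; rewrite /= -det_mexp// -A'Z det_mulmx.
  rewrite -[A'^t*]map_trmx det_tr det_map_mx det_upper// rmorph_prod -big_split /=.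
  rewrite big_mkcond expR_sum rmorph_prod [RHS]big_mkcond /=; apply: eq_bigr => i _.
  rewrite A'd mulrC mul_conj_normc; case: ifP => _; last by rewrite normc1 expr1n.
  rewrite lnK// posrE exprn_gt0// lt_neqAle normc_ge0 andbT eq_sym.
  by apply: contra_neq (upper_unit_neq0 i hA uA) => /eq0_normc.
rewrite -trZ; move: A'Z; case/herm_spectral: hZ => V [z [hV ->]]; have [v1 v2] := unitaryP hV.
rewrite mexp_spectral1// => A'V.
have [q qE] : exists q : 'I_n -> 'cV[C]_n, forall i, q i = V *m delta_mx i 0.
  by exists (fun i => V *m delta_mx i 0).
have qq i : fdot (q i) (q i) = 1.
  by rewrite qE fdot_mulmxl mulmxA v2 mul1mx -fnorm_sqr -[delta_mx _ _]scale1r fnorm_delta normc1 expr1n.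
have fE i : fdot (E *m q i) (E *m q i) = fdot (E *m q i) (q i).
  by rewrite -[in X in fdot _ X]Eh -fdot_mulmxl mulmxA EE.
have fF i : 1 - fdot (E *m q i) (E *m q i) = fdot (F *m q i) (q i).
  by rewrite fE -(qq i) -fdotBl FD mulmxBl mul1mx.
have Fpos i : 0 <= fdot (F *m q i) (q i).
  by rewrite -FF -mulmxA fdot_mulmxl Fh fdot_ge0.
(* Jensen at [E q_i], a vector of norm at most 1. Its missing mass is the contribution of [F], so
   the right-hand side is the Gram matrix of [A'] at its eigenvector [q_i], that is [expR (z i)]. *)
have hz i : fdot (Y *m (E *m q i)) (E *m q i) <= z i.
  rewrite -ler_expR; apply: le_trans (exp_quad_le hY _) _; first by rewrite -subr_ge0 fF.
  rewrite fF -[in X in fdot _ X + _]Eh -fdot_mulmxl -fdotDl !mulmxA -mulmxDl.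
  rewrite -A'gram A'V fdot_spectral (bigD1 i)//= big1 ?addr0 => [|j ji].
    by rewrite qE mulmxA v2 mul1mx mxE !eqxx mulr1n normc1 expr1n mulr1.
  by rewrite qE mulmxA v2 mul1mx mxE (negPf ji) mulr0n normc0 expr0n mulr0.
have trq (X : 'M[C]_n) : \sum_i fdot (X *m q i) (q i) = complex.Re (\tr X).
  rewrite -[X in \tr X]mulmx1 -v1 mulmxA mxtrace_mulC /mxtrace Re_sum.
  apply: eq_bigr => i _; rewrite qE -quad_fdot adjmxM -!mulmxA.
  have -> : (delta_mx i 0 : 'cV[C]_n)^t* = delta_mx 0 i by rewrite trmx_delta map_delta_mx.
  by rewrite -rowE mxE !mulmxA -colE mxE.
have -> : \sum_(i < n | (i < k)%N) complex.Re (Y i i) = complex.Re (\tr (E *m Y *m E)).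
  rewrite big_mkcond /mxtrace Re_sum /=; apply: eq_bigr => i _.
  by rewrite mul_dgcr mul_dgcl; case: ifP => _; rewrite ?mul1r ?mulr1 ?mul0r.
have -> : complex.Re (\tr (V *m dg z *m V^t*)) = \sum_i z i.
  rewrite mxtrace_mulC mulmxA v2 mul1mx mxtrace_diag Re_sum.
  by apply: eq_bigr => i _; rewrite mxE.
rewrite -trq; apply: ler_sum => i _; rewrite -!mulmxA fdot_mulmxl Eh; exact: hz i.
Qed.

Lemma upper_sum n (A Y : 'M[C]_n) : upper A -> A \in unitmx -> Y^t* = Y ->
  A^t* *m A = mexp Y ->
  \sum_i complex.Re (Y i i) = \sum_i ln (normc (A i i) ^+ 2).
Proof.
move=> hA uA hY AY; rewrite -Re_sum; apply: expR_inj; apply: complexI.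
rewrite /= -det_mexp// -AY det_mulmx -[A^t*]map_trmx det_tr det_map_mx det_upper//.
rewrite rmorph_prod -big_split /= expR_sum rmorph_prod /=; apply: eq_bigr => i _.
rewrite mulrC mul_conj_normc lnK// posrE exprn_gt0// lt_neqAle normc_ge0 andbT eq_sym.
by apply: contra_neq (upper_unit_neq0 i hA uA) => /eq0_normc.
Qed.

(** Abel summation: the nonnegative increments of [eta] multiply nonnegative partial sums of [a] and
    enter with a minus sign, while the boundary term vanishes with the total sum. *)
Lemma abel_sum_le0 n (eta a : nat -> R) :
  (forall i j, (i <= j < n)%N -> eta i <= eta j) ->
  (forall k, (k <= n)%N -> 0 <= \sum_(0 <= i < k) a i) -> \sum_(0 <= i < n) a i = 0 ->
  \sum_(0 <= i < n) eta i * a i <= 0.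
Proof.
case: n => [|n] heta hs s0; first by rewrite big_geq.
have : forall m, (m <= n)%N -> \sum_(0 <= i < m.+1) eta i * a i <= eta m * \sum_(0 <= i < m.+1) a i.
  elim=> [|m IH] mn; first by rewrite !big_nat1.
  rewrite big_nat_recr//= [in leRHS]big_nat_recr//= mulrDr lerD2r.
  apply: le_trans (IH (ltnW mn)) _; apply: ler_wpM2r; first by apply: hs; rewrite ltnS ltnW.
  by apply: heta; rewrite leqnSn ltnS.
by move=> /(_ n (leqnn n)); rewrite s0 mulr0.
Qed.

(** By [upper_partial_sum] and [upper_sum] the numbers [ln |A i i|^2] have larger partial sums than
    the diagonal of [Y] and the same total. Pairing with an ascending [eta] reverses the comparison,
    and Cauchy-Schwarz bounds the pairing of [eta] with the diagonal of [Y]. *)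
Lemma upper_diag_le n (A Y : 'M[C]_n) (eta : 'I_n -> R) : upper A -> A \in unitmx ->
  Y^t* = Y -> A^t* *m A = mexp Y -> (forall i j : 'I_n, (i <= j)%N -> eta i <= eta j) ->
  \sum_i eta i * ln (normc (A i i) ^+ 2) <= fnorm (dg eta) * fnorm Y.
Proof.
case: n A Y eta => [|n] A Y eta hA uA hY AY heta.
  by rewrite big_ord0 mulr_ge0 ?fnorm_ge0.
pose a (i : nat) := ln (normc (A (inord i) (inord i)) ^+ 2) - complex.Re (Y (inord i) (inord i)).
have hsum k : (k <= n.+1)%N -> \sum_(0 <= i < k) a i =
    \sum_(i < n.+1 | (i < k)%N) ln (normc (A i i) ^+ 2) - \sum_(i < n.+1 | (i < k)%N) complex.Re (Y i i).
  move=> kn; rewrite -sumrB big_mkord (big_ord_widen _ _ kn); apply: eq_bigr => i _.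
  by rewrite /a inord_val.
have := @abel_sum_le0 n.+1 (fun i => eta (inord i)) a.
move=> h; have {}h : \sum_(i < n.+1) eta (inord i) * a i <= 0.
  rewrite -(big_mkord xpredT (fun i => eta (inord i) * a i)); apply: h.
  - move=> i j /andP[ij jn]; apply: heta; rewrite !inordK//; exact: leq_ltn_trans jn.
  - by move=> k kn; rewrite hsum// subr_ge0; exact: upper_partial_sum.
  - rewrite hsum// (eq_bigl xpredT) => [|i]; last by rewrite ltn_ord.
    rewrite [X in _ - X](eq_bigl xpredT) => [|i]; last by rewrite ltn_ord.
    by rewrite (upper_sum hA uA hY AY) subrr.
have hd : fdot (dg eta) Y = \sum_i eta i * complex.Re (Y i i).
  rewrite fdotE; apply: eq_bigr => i _; rewrite (bigD1 i)//= big1 ?addr0 => [|j ji].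
    by rewrite dgE dgcE eqxx mulr1n ReZ ReJ.
  by rewrite dgE dgcE eq_sym (negPf ji) mulr0n mul0r.
apply: le_trans (le_trans (ler_norm _) (fdot_le (dg eta) Y)); rewrite hd -subr_le0 -sumrB.
apply: le_trans h; rewrite le_eqVlt; apply/orP; left; apply/eqP; apply: eq_bigr => i _.
by rewrite /a inord_val mulrBr.
Qed.

(** [schmidt] orthonormalizes rows, so it is applied to [W^T]; column [j] of [W] then lies in the
    span of the columns of [Q] up to [j]. *)
Lemma qr_decomposition n (W : 'M[C]_n) : W \in unitmx ->
  exists Q T : 'M[C]_n, [/\ Q \is unitarymx, upper T, T \in unitmx & W = Q *m T].
Proof.
move=> uW; pose S := schmidt (W^T).
have hS : S \is unitarymx by exact: schmidt_unitarymx.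
have [S1 S2] := unitaryP hS.
have hQ : S^T \is unitarymx by rewrite trmx_unitary.
have [Q1 Q2] := unitaryP hQ.
exists S^T, ((S^T)^t* *m W); split => //.
- move=> i j ji; rewrite mxE.
  have := row_schmidt_sub (W^T) j; rewrite -/S => /sub_sumsmxP[u hu].
  transitivity ((row j W^T *m S^t*) 0 i).
    rewrite mxE; apply: eq_bigr => k _; rewrite !mxE mulrC; congr (_ * _).
  rewrite hu mulmx_suml summxE big1// => k kj.
  have /submxP[c ->] : (u k *m <<row k S>> <= row k S)%MS by rewrite (submx_trans (submxMl _ _))// genmxE.
  rewrite -mulmxA -row_mul S1 row1 mxE big1// => l _; rewrite ord1 !mxE !eqxx /=.
  have -> : (i == k) = false by apply/eqP => ik; move: kj; rewrite -ik leqNgt ji.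
  by rewrite mulr0.
- rewrite unitmx_mul uW andbT; apply: unitarymx_unit; rewrite trmxC_unitary; exact: hQ.
- by rewrite mulmxA Q1 mul1mx.
Qed.

Lemma ln_normc_sqr (x : C) : x != 0 -> expR (ln (normc x ^+ 2)) = normc x ^+ 2.
Proof.
move=> x0; rewrite lnK// posrE exprn_gt0// lt_neqAle normc_ge0 andbT eq_sym.
by apply: contra_neq x0 => /eq0_normc.
Qed.

Lemma herm_conj n (X A : 'M[C]_n) : X^t* = X -> (A^t* *m X *m A)^t* = A^t* *m X *m A.
Proof. by move=> hX; rewrite !adjmxM trmxCK hX mulmxA. Qed.

Lemma fnorm_conjU n (U X : 'M[C]_n) : U \is unitarymx -> fnorm (U^t* *m X *m U) = fnorm X.
Proof.
move=> hU; have hU' : U^t* \is unitarymx by rewrite trmxC_unitary.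
by rewrite (fnorm_unitaryr _ hU) (fnorm_unitaryl _ hU').
Qed.

Lemma fnorm_spec n (U : 'M[C]_n) (a : 'I_n -> R) : U \is unitarymx ->
  fnorm (U *m dg a *m U^t*) = fnorm (dg a).
Proof.
move=> hU; have hU' : U^t* \is unitarymx by rewrite trmxC_unitary.
by have := fnorm_conjU (dg a) hU'; rewrite trmxCK.
Qed.

Lemma dg_half n (a : 'I_n -> R) :
  dg (fun i => expR (a i / 2)) *m dg (fun i => expR (a i / 2)) = dg (fun i => expR (a i)).
Proof.
rewrite !dgE dgcM; congr dgc; apply/funext => i.
by rewrite -rmorphM -expRD -splitr.
Qed.

Lemma ge0_le_cancel (a b : R) : 0 <= a -> 0 <= b -> a ^+ 2 <= a * b -> a <= b.
Proof.
move=> a0 b0; have [->//|an0] := eqVneq a 0.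
by rewrite expr2 ler_pM2l// lt_neqAle eq_sym an0.
Qed.

(* The triangle inequality [d(g* e^Y g, I) <= d(g* e^Y g, g* g) + d(g* g, I)]. *)
Lemma log_triangle n (g X Y Z : 'M[C]_n) : g \in unitmx -> X^t* = X -> Y^t* = Y -> Z^t* = Z ->
  mexp X = g^t* *m mexp Y *m g -> mexp Z = g^t* *m g -> fnorm X <= fnorm Y + fnorm Z.
Proof.
move=> ug hX hY hZ; case/herm_spectral_sorted: hX => U [a [hU -> ha]] EX EZ.
rewrite fnorm_spec//; have [u1 u2] := unitaryP hU.
(* With [g U = Q T], the triangular matrices [T] and [S = D T^-1] have Gram matrices unitarily
   conjugate to [e^Z] and [e^Y]; by [sd] the logarithms of their squared diagonals add up to the
   eigenvalues [a] of [X]. *)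
have [Q [T [hQ Tup Tu gUE]]] : exists Q T : 'M[C]_n,
    [/\ Q \is unitarymx, upper T, T \in unitmx & g *m U = Q *m T].
  by apply: qr_decomposition; rewrite unitmx_mul ug unitarymx_unit.
have [q1 q2] := unitaryP hQ.
have TT : T^t* *m T = mexp (U^t* *m Z *m U).
  rewrite mexp_conjUt// EZ -!mulmxA gUE !mulmxA -adjmxM gUE adjmxM -!mulmxA.
  by congr (_ *m _); rewrite mulmxA q2 mul1mx.
have k1 := upper_diag_le Tup Tu (herm_conj U hZ) TT ha.
rewrite fnorm_conjU// in k1.
pose D := dg (fun i => expR (a i / 2)).
pose S := D *m invmx T.
have Sup : upper S by apply: upperM; [exact: upper_dgc|exact: upper_inv].
have Su : S \in unitmx.
  rewrite unitmx_mul unitmx_inv Tu andbT; apply: upper_unit; first exact: upper_dgc.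
  by move=> i; rewrite /D dgE dgcE eqxx mulr1n; apply/eqP => -[] /eqP; rewrite gt_eqF ?expR_gt0.
have DD : D *m D = T^t* *m (Q^t* *m mexp Y *m Q) *m T.
  rewrite dg_half; transitivity (U^t* *m (g^t* *m mexp Y *m g) *m U).
    by rewrite -EX mexp_spectral1// !mulmxA u2 mul1mx -mulmxA u2 mulmx1.
  transitivity ((g *m U)^t* *m mexp Y *m (g *m U)); first by rewrite adjmxM !mulmxA.
  by rewrite gUE adjmxM !mulmxA.
have SS : S^t* *m S = mexp (Q^t* *m Y *m Q).
  rewrite mexp_conjUt// /S adjmxM dg_adj -/D !mulmxA -(mulmxA _ D D) DD.
  by rewrite !mulmxA (mulmxK Tu) -adjmxM (mulmxV Tu) adjmx1 mul1mx.
have k2 := upper_diag_le Sup Su (herm_conj Q hY) SS ha.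
rewrite fnorm_conjU// in k2.
have sd i : ln (normc (S i i) ^+ 2) = a i - ln (normc (T i i) ^+ 2).
  have T0 := upper_unit_neq0 i Tup Tu.
  apply: expR_inj; rewrite expRD expRN !ln_normc_sqr//; last exact: upper_unit_neq0.
  rewrite upperM_diag; [|exact: upper_dgc|exact: upper_inv].
  rewrite upper_inv_diag// normcM normcV exprMn exprVn; congr (_ / _).
  rewrite /D dgE dgcE eqxx mulr1n normcR ger0_norm ?expR_ge0//.
  by rewrite expr2 -expRD -splitr.
apply: ge0_le_cancel; rewrite ?addr_ge0 ?fnorm_ge0// mulrDr fnorm_dg.
apply: le_trans (lerD k2 k1); rewrite -big_split /= le_eqVlt; apply/orP; left; apply/eqP.
by apply: eq_bigr => i _; rewrite sd; ring.
Qed.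

(** Weyl's inequality between eigenvalues and singular values: in the orthonormal basis that QR
    extracts from the eigenvectors [K], the matrix [M] becomes triangular with diagonal [e^(a i)],
    and its Gram matrix is conjugate to [e^N]. *)
Lemma weyl_log n (M K N : 'M[C]_n) (a : 'I_n -> R) : K \in unitmx -> N^t* = N ->
  (forall i j : 'I_n, (i <= j)%N -> a i <= a j) ->
  M *m K = K *m dg (fun i => expR (a i)) -> M^t* *m M = mexp N ->
  2 * fnorm (dg a) <= fnorm N.
Proof.
move=> uK hN ha MK MM.
have [Q [T [hQ Tup Tu KE]]] := qr_decomposition uK.
have [q1 q2] := unitaryP hQ.
pose S := T *m dg (fun i => expR (a i)) *m invmx T.
have Sup : upper S by apply: upperM; [apply: upperM => //; exact: upper_dgc|exact: upper_inv].
have Du : dg (fun i => expR (a i)) \in unitmx.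
  apply: upper_unit; first exact: upper_dgc.
  by move=> i; rewrite dgE dgcE eqxx mulr1n; apply/eqP => -[] /eqP; rewrite gt_eqF ?expR_gt0.
have Su : S \in unitmx by rewrite !unitmx_mul unitmx_inv Tu Du.
have MQ : M *m Q = Q *m S.
  rewrite /S !mulmxA -KE -MK KE -!mulmxA mulmxV// mulmx1 //.
have SS : S^t* *m S = mexp (Q^t* *m N *m Q).
  rewrite mexp_conjUt// -MM; transitivity ((Q *m S)^t* *m (Q *m S)).
    by rewrite adjmxM -!mulmxA; congr (_ *m _); rewrite mulmxA q2 mul1mx.
  by rewrite -MQ adjmxM !mulmxA.
have := upper_diag_le Sup Su (herm_conj Q hN) SS ha; rewrite fnorm_conjU// => k.
have sd i : ln (normc (S i i) ^+ 2) = 2 * a i.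
  have T0 := upper_unit_neq0 i Tup Tu.
  rewrite upperM_diag; [|by apply: upperM => //; exact: upper_dgc|exact: upper_inv].
  rewrite upperM_diag//; last exact: upper_dgc.
  rewrite upper_inv_diag// mulrAC mulfV// mul1r dgE dgcE eqxx mulr1n normcR.
  by rewrite ger0_norm ?expR_ge0// expr2 -expRD expRK; ring.
apply: ge0_le_cancel; rewrite ?mulr_ge0 ?fnorm_ge0// -mulrA exprMn fnorm_dg.
rewrite (_ : 2 ^+ 2 = 2 * 2)// -mulrA ler_pM2l//; apply: le_trans k.
rewrite mulr_sumr le_eqVlt; apply/orP; left; apply/eqP; apply: eq_bigr => i _.
by rewrite sd; ring.
Qed.

(** The squared norm of a Hermitian matrix is the trace of its square, a similarity invariant. *)
Lemma fnorm_similar n (A B P : 'M[C]_n) : P \in unitmx -> A^t* = A -> B^t* = B ->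
  P *m A = B *m P -> fnorm A = fnorm B.
Proof.
move=> uP hA hB h; rewrite !fnorm.unlock !fdot.unlock hA hB; congr (Num.sqrt (complex.Re _)).
have -> : A = invmx P *m (B *m P) by rewrite -h mulKmx.
by rewrite -!mulmxA (mulKVmx uP) mxtrace_mulC -!mulmxA (mulmxV uP) mulmx1.
Qed.

Lemma mexp_similar n (A B P : 'M[C]_n) : P \in unitmx -> A^t* = A -> B^t* = B ->
  P *m mexp A = mexp B *m P -> fnorm A = fnorm B.
Proof. by move=> uP hA hB h; apply: (fnorm_similar uP hA hB); exact: mexp_intertwine_inv. Qed.

(** The matrix [M = e^(Y/2) e^(-X/2)] has Gram matrix [e^N1] and is similar, through [e^(X/4)], to
    [e^N2]; [weyl_log] compares the two. Geometrically, halving two vectors at least halves the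
    distance of their exponentials. *)
Lemma log_halving n (X Y N1 N2 : 'M[C]_n) :
  X^t* = X -> Y^t* = Y -> N1^t* = N1 -> N2^t* = N2 ->
  mexp N1 = mexp ((- 2^-1 : R)%:C *: X) *m mexp Y *m mexp ((- 2^-1 : R)%:C *: X) ->
  mexp N2 = mexp ((- 4^-1 : R)%:C *: X) *m mexp ((2^-1 : R)%:C *: Y) *m mexp ((- 4^-1 : R)%:C *: X) ->
  2 * fnorm N2 <= fnorm N1.
Proof.
move=> hX hY hN1 hN2 E1 E2.
pose M := mexp ((2^-1 : R)%:C *: Y) *m mexp ((- 2^-1 : R)%:C *: X).
have MM : M^t* *m M = mexp N1.
  by rewrite /M adjmxM !(mexp_hermZ_adj _ hX) (mexp_hermZ_adj _ hY) E1 -(mexp_half hY) !mulmxA.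
pose B := mexp ((4^-1 : R)%:C *: X).
have uB : B \in unitmx by exact: mexp_hermZ_unit hX.
case/herm_spectral_sorted: hN2 E2 => U [a [hU -> ha]] E2; have [u1 u2] := unitaryP hU.
have uBU : B *m U \in unitmx by rewrite unitmx_mul uB; exact: unitarymx_unit.
rewrite (fnorm_spec _ hU); apply: (weyl_log uBU hN1 ha _ MM).
have MB : M *m B = B *m mexp (U *m dg a *m U^t*).
  rewrite E2 /B !mulmxA -(mexp_hermM _ _ hX) subrr scale0r mexp0 mul1mx /M -mulmxA -(mexp_hermM _ _ hX).
  by congr (_ *m mexp (_%:C *: _)); lra.
rewrite mulmxA MB (mexp_spectral1 _ hU) -!mulmxA; congr (_ *m (_ *m _)).
by rewrite u2 mulmx1.
Qed.

(** Passage to the limit along the scales [2^-j] in purely arithmetic form; many first-order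
    arguments below end with it. *)
Lemma le_limit_pow2 (a b c : R) : (forall j : nat, a <= b + c / 2 ^+ j) -> a <= b.
Proof.
move=> h; rewrite leNgt; apply/negP => ba.
have d0 : 0 < a - b by rewrite subr_gt0.
pose m := Num.truncn (`|c| / (a - b)).
have hm : `|c| / (a - b) < m.+1%:R by rewrite truncnS_gt.
have hp : m.+1%:R <= (2 ^+ m.+1 : R) by rewrite -natrX ler_nat ltnW// ltn_expl.
have := h m.+1; rewrite -lerBlDl ler_pdivlMr ?exprn_gt0// leNgt => /negP; apply.
apply: le_lt_trans (ler_norm c) _.
by move: (lt_le_trans hm hp); rewrite ltr_pdivrMr// mulrC.
Qed.

(** A first-order expansion at 0 with quadratic remainder on [[-1, 1]]: products keep this form with
    explicit constants ([o2M]), and it gives both derivatives and the product formula [trotter]. *)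
Definition o2 m n (f : R -> 'M[C]_(m, n)) (f0 A : 'M[C]_(m, n)) := exists2 c : R, 0 <= c &
  forall t : R, `|t| <= 1 -> fnorm (f t - f0 - t%:C *: A) <= c * t ^+ 2.

Definition tay2 n (f : R -> 'M[C]_n) (A : 'M[C]_n) := o2 f 1%:M A.

Lemma tay2_mexp n (X : 'M[C]_n) : tay2 (fun t => mexp (t%:C *: X)) X.
Proof. exact: mexp_taylor. Qed.

Lemma tay2_mexpZ n (X : 'M[C]_n) (a : R) : `|a| <= 1 ->
  tay2 (fun t => mexp ((a * t)%:C *: X)) (a%:C *: X).
Proof.
move=> a1; have [c c0 hc] := mexp_taylor X; exists c => // t t1.
rewrite scalerA -rmorphM mulrC; apply: le_trans (hc _ _) _.
  by rewrite normrM mulr_ile1.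
rewrite ler_wpM2l// exprMn ler_piMr ?sqr_ge0//.
by rewrite -real_normK ?num_real// expr_le1.
Qed.

Lemma o2M m n p (f : R -> 'M[C]_(m, n)) (g : R -> 'M[C]_(n, p)) f0 g0 A B :
  o2 f f0 A -> o2 g g0 B -> o2 (fun t => f t *m g t) (f0 *m g0) (A *m g0 + f0 *m B).
Proof.
move=> [c c0 hf] [d d0 hg].
(* One summand for each term of the decomposition below: remainder of [f] times [g], affine part of
   [f] times remainder of [g], and the quadratic term [A B]. *)
pose e := c * (fnorm g0 + fnorm B + d) + (fnorm f0 + fnorm A) * d + fnorm A * fnorm B.
exists e; first by rewrite !(addr_ge0, mulr_ge0, fnorm_ge0).
move=> t t1.
have t2 : t ^+ 2 <= 1 by rewrite -real_normK ?num_real// expr_le1.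
have fnt k l X : fnorm (t%:C *: X : 'M[C]_(k, l)) <= fnorm X by rewrite fnormZr ler_piMl ?fnorm_ge0.
have -> : f t *m g t - f0 *m g0 - t%:C *: (A *m g0 + f0 *m B) =
  (f t - f0 - t%:C *: A) *m g t + (f0 + t%:C *: A) *m (g t - g0 - t%:C *: B)
  + (t ^+ 2)%:C *: (A *m B).
  rewrite !mulmxBl !mulmxBr !mulmxDl -!scalemxAl -!scalemxAr scalerA.
  rewrite -rmorphM -expr2 scalerDr.
  move: (f t *m g t) (A *m g t) (f0 *m g t) (A *m B) (f0 *m g0) (A *m g0) (f0 *m B).
  by move=> u v w x y a b; apply/matrixP => i j; rewrite !mxE; ring.
have gb : fnorm (g t) <= fnorm g0 + fnorm B + d.
  have -> : g t = g0 + t%:C *: B + (g t - g0 - t%:C *: B).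
    by apply/matrixP => i j; rewrite !mxE; ring.
  apply: le_trans (fnormD _ _) _; apply: lerD; last first.
    by apply: le_trans (hg t t1) _; rewrite ler_piMr.
  by apply: le_trans (fnormD _ _) _; rewrite lerD2l.
apply: le_trans (fnormD _ _) _; rewrite /e [leRHS]mulrDl; apply: lerD; last first.
  rewrite fnormZr ger0_norm ?sqr_ge0// mulrC; apply: ler_wpM2r; first exact: sqr_ge0.
  exact: fnormM.
apply: le_trans (fnormD _ _) _; rewrite [leRHS]mulrDl; apply: lerD.
  apply: le_trans (fnormM _ _) _; rewrite [leRHS]mulrAC.
  by apply: ler_pM; rewrite ?fnorm_ge0// hf.
apply: le_trans (fnormM _ _) _; rewrite -mulrA.
apply: ler_pM; rewrite ?fnorm_ge0 ?hg//.
by apply: le_trans (fnormD _ _) _; rewrite lerD2l.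
Qed.

Lemma o2_cst m n (A : 'M[C]_(m, n)) : o2 (fun=> A) A 0.
Proof. by exists 0 => // t _; rewrite scaler0 subr0 subrr fnorm0 mul0r. Qed.

Lemma tay2M n (f g : R -> 'M[C]_n) A B : tay2 f A -> tay2 g B ->
  tay2 (fun t => f t *m g t) (A + B).
Proof. by move=> hf hg; have := o2M hf hg; rewrite !mulmx1 mul1mx. Qed.

Lemma expR_le_1Dx (x : R) : 0 <= x -> expR x <= 1 + x * expR x.
Proof.
move=> x0; have := expR_ge1Dx (- x); rewrite expRN -(ler_pM2l (expR_gt0 x)).
by rewrite mulfV ?gt_eqF ?expR_gt0// mulrDr mulr1 mulrN; lra.
Qed.

(* Exponential metric increasing property: iterate [log_halving] and use
   [e^{-sX/2} e^{sY} e^{-sX/2} = 1 + s (Y - X) + O(s^2)]. *)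
Lemma log_increasing0 n (X Y N : 'M[C]_n) : X^t* = X -> Y^t* = Y -> N^t* = N ->
  mexp N = mexp ((- 2^-1 : R)%:C *: X) *m mexp Y *m mexp ((- 2^-1 : R)%:C *: X) ->
  fnorm (Y - X) <= fnorm N.
Proof.
move=> hX hY hN EN.
pose f (s : R) := mexp ((- 2^-1 * s)%:C *: X) *m mexp (s%:C *: Y) *m mexp ((- 2^-1 * s)%:C *: X).
have half1 : `|- 2^-1 : R| <= 1 by rewrite normrN ger0_norm; lra.
have [c c0 hc] : tay2 f (Y - X).
  have -> : Y - X = (- 2^-1 : R)%:C *: X + Y + (- 2^-1 : R)%:C *: X.
    rewrite [RHS]addrAC -scalerDl -rmorphD (_ : - 2^-1 + - 2^-1 = -1); last by lra.
    by rewrite rmorphN1 scaleN1r addrC.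
  apply: tay2M; [apply: tay2M|]; [exact: tay2_mexpZ|exact: tay2_mexp|exact: tay2_mexpZ].
have hf s : exists2 Z : 'M[C]_n, Z^t* = Z & f s = mexp Z.
  have uf : (mexp ((2^-1 * s)%:C *: Y) *m mexp ((- 2^-1 * s)%:C *: X)) \in unitmx.
    by rewrite unitmx_mul (mexp_hermZ_unit _ hX) (mexp_hermZ_unit _ hY).
  have [Z hZ EZ] := gram_log uf; exists Z; first exact: hZ.
  rewrite -EZ adjmxM (mexp_hermZ_adj _ hX) (mexp_hermZ_adj _ hY).
  have e : mexp (s%:C *: Y) = mexp ((2^-1 * s)%:C *: Y) *m mexp ((2^-1 * s)%:C *: Y).
    by rewrite -(mexp_hermM _ _ hY); congr (mexp (_%:C *: _)); lra.
  by rewrite /f e !mulmxA.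
(* At scale [2^-j] the logarithm of [f] has norm at most [2^-j] times that of [N], while to first
   order it is [2^-j (Y - X)]. *)
have hj j : exists Z : 'M[C]_n, [/\ Z^t* = Z, f (2 ^- j) = mexp Z & 2 ^+ j * fnorm Z <= fnorm N].
  elim: j => [|j [Z [hZ EZ IH]]].
    exists N; split => //; last by rewrite mul1r.
    by rewrite EN /f expr0 invr1 mulr1 scale1r.
  have [Z' hZ' EZ'] := hf (2 ^- j.+1); exists Z'; split => //.
  apply: le_trans IH; rewrite exprSr -mulrA; apply: ler_wpM2l; first exact: exprn_ge0.
  apply: (log_halving (herm_scale (2 ^- j) hX) (herm_scale (2 ^- j) hY) hZ hZ').
  - by rewrite -EZ /f !scalerA -!rmorphM.
  - rewrite -EZ' /f !scalerA -!rmorphM exprS invfM.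
    by rewrite (_ : - 2^-1 * (2^-1 / 2 ^+ j) = - 4^-1 / 2 ^+ j)// mulrA; congr (_ / _); lra.
apply: (@le_limit_pow2 _ _ (fnorm N * (fnorm N * expR (fnorm N)) + c)) => j.
have [Z [hZ EZ hZN]] := hj j.
have s0 : 0 < (2 ^- j : R) by rewrite invr_gt0 exprn_gt0.
have s1 : (2 ^- j : R) <= 1 by rewrite invf_le1 ?exprn_gt0// exprn_ege1// ler1n.
set s := (2 ^- j : R) in s0 s1 EZ *.
have Zs : fnorm Z <= s * fnorm N by rewrite /s mulrC ler_pdivlMr ?exprn_gt0// mulrC.
have h1 : fnorm (s%:C *: (Y - X)) <= fnorm (f s - 1%:M) + c * s ^+ 2.
  have -> : s%:C *: (Y - X) = (f s - 1%:M) - (f s - 1%:M - s%:C *: (Y - X)).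
    by rewrite opprB [RHS]addrC subrK.
  by apply: le_trans (fnormB _ _) _; rewrite lerD2l hc// ger0_norm// ltW.
have h2 : fnorm (f s - 1%:M) <= fnorm Z * expR (fnorm Z).
  have := @mexp_lip R n Z 0 (fnorm Z) (lexx _); rewrite fnorm0 mexp0 subr0 -EZ mulrC; apply.
  exact: fnorm_ge0.
have h3 : fnorm Z * expR (fnorm Z) <= s * fnorm N * (1 + s * (fnorm N * expR (fnorm N))).
  apply: ler_pM; rewrite ?fnorm_ge0 ?expR_ge0//; apply: le_trans (expR_le_1Dx (fnorm_ge0 _)) _.
  rewrite lerD2l mulrA; apply: ler_pM; rewrite ?fnorm_ge0 ?expR_ge0//.
  rewrite ler_expR; apply: le_trans Zs _; by rewrite ler_piMl ?fnorm_ge0.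
rewrite fnormZr ger0_norm ?(ltW s0)// in h1.
rewrite -(ler_pM2l s0) -/s; have := le_trans h1 (lerD (le_trans h2 h3) (lexx _)).
move/le_trans; apply; rewrite le_eqVlt; apply/orP; left; apply/eqP; ring.
Qed.

(** The distance of [e^X] and [e^Y] is at least the flat one. Since [h = e^(-X/2)] satisfies
    [h h = g g^*], the quotient [h^-1 g] conjugates [e^P] into the [e^N] of [log_increasing0], and
    similar Hermitian matrices have equal norm. *)
Lemma log_increasing n (g X Y P : 'M[C]_n) : g \in unitmx -> X^t* = X -> Y^t* = Y -> P^t* = P ->
  mexp (- X) = g *m g^t* -> mexp P = g^t* *m mexp Y *m g -> fnorm (Y - X) <= fnorm P.
Proof.
move=> ug hX hY hP EX EP.
pose h := mexp ((- 2^-1 : R)%:C *: X).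
have hh : h^t* = h by exact: mexp_hermZ_adj hX.
have uh : h \in unitmx by exact: mexp_hermZ_unit hX.
have h2 : h *m h = g *m g^t*.
  rewrite -EX /h -(mexp_hermM _ _ hX) (_ : - 2^-1 + - 2^-1 = -1); last by lra.
  by rewrite rmorphN1 scaleN1r.
pose k := mexp ((2^-1 : R)%:C *: Y) *m h.
have uk : k \in unitmx by rewrite unitmx_mul uh (mexp_hermZ_unit _ hY).
have [N hN EN] := gram_log uk.
have {}EN : mexp N = h *m mexp Y *m h.
  by rewrite -EN /k adjmxM hh (mexp_hermZ_adj _ hY) -[in RHS](mexp_half hY) !mulmxA.
apply: le_trans (log_increasing0 hX hY hN EN) _.
have ug' : g^t* \in unitmx.
  by apply: (mulmx1_unit (A := g^t*) (B := (invmx g)^t*) _).1; rewrite -adjmxM (mulVmx ug) adjmx1.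
have E : invmx h *m g = h *m invmx (g^t*).
  by apply: (can_inj (mulKmx uh)); rewrite (mulKVmx uh) mulmxA h2 (mulmxK ug').
suff -> : fnorm P = fnorm N by [].
have uhg : invmx h *m g \in unitmx by rewrite unitmx_mul unitmx_inv uh ug.
apply: (mexp_similar uhg hP hN).
by rewrite EN EP {1}E !mulmxA (mulmxKV ug') (mulmxK uh).
Qed.

(* The CAT(0) inequality for the midpoint [e^W] of [e^A] and [e^B] : move [e^W] to the
   identity, apply the parallelogram law there, and compare by [log_increasing]. *)
Lemma log_midpoint n (A B Z W : 'M[C]_n) : A^t* = A -> B^t* = B -> Z^t* = Z -> W^t* = W ->
  mexp B = mexp ((2^-1 : R)%:C *: A) *m mexp ((2 : R)%:C *: Z) *m mexp ((2^-1 : R)%:C *: A) ->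
  mexp W = mexp ((2^-1 : R)%:C *: A) *m mexp Z *m mexp ((2^-1 : R)%:C *: A) ->
  fnorm W ^+ 2 <= (fnorm A ^+ 2 + fnorm B ^+ 2) / 2 - fnorm (A - B) ^+ 2 / 4.
Proof.
move=> hA hB hZ hW EB EW.
have neg1 : (- 2^-1 + - 2^-1 : R) = -1 by lra.
have [s sE] : exists s, s = mexp ((2^-1 : R)%:C *: A) by eexists.
have hs : s^t* = s by rewrite sE; exact: mexp_hermZ_adj hA.
have us : s \in unitmx by rewrite sE; exact: mexp_hermZ_unit hA.
have ss : s *m s = mexp A by rewrite sE; exact: mexp_half.
have sN : invmx s = mexp ((- 2^-1 : R)%:C *: A).
  by rewrite sE (mexp_herm_inv (herm_scale _ hA)) rmorphN scaleNr.
rewrite -sE in EB EW.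
have h1 : fnorm (A - B) <= 2 * fnorm Z.
  rewrite fnormBC -[2]ger0_norm// -fnormZr.
  have us' : invmx s \in unitmx by rewrite unitmx_inv.
  have hs' : (invmx s)^t* = invmx s by rewrite sN; exact: mexp_hermZ_adj hA.
  apply: (log_increasing us' hA hB (herm_scale 2 hZ)).
    by rewrite hs' sN -(mexp_hermM _ _ hA) neg1 rmorphN1 scaleN1r.
  by rewrite hs' EB !mulmxA (mulVmx us) mul1mx (mulmxK us).
have [z zE] : exists z, z = mexp ((2^-1 : R)%:C *: Z) by eexists.
have hz : z^t* = z by rewrite zE; exact: mexp_hermZ_adj hZ.
have uz : z \in unitmx by rewrite zE; exact: mexp_hermZ_unit hZ.
have zz : z *m z = mexp Z by rewrite zE; exact: mexp_half.
have [g gE] : exists g, g = z *m s by eexists.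
have ug : g \in unitmx by rewrite gE unitmx_mul uz us.
have gh : g^t* = s *m z by rewrite gE adjmxM hs hz.
have ggW : g^t* *m g = mexp W by rewrite gh EW -zz gE !mulmxA.
have ug' : g^t* \in unitmx by rewrite gh unitmx_mul uz us.
have [V hV] := gram_log ug'; rewrite trmxCK => EV.
have WV : fnorm W = fnorm V.
  by apply: (mexp_similar ug hW hV); rewrite -EV -ggW mulmxA.
have hNV : (- V)^t* = - V by rewrite adjmxN hV.
have hNZ : (- Z)^t* = - Z by rewrite adjmxN hZ.
(* The isometry [y |-> g^* y g] maps [1], [e^(-Z)], [e^Z] and [e^(-V)] to [e^W], [e^A], [e^B] and
   [1]. So the distances of [e^A] and [e^B] from 1 dominate the flat distances of [-Z] and [Z] from
   [-V]. *)
have k1 : fnorm (- Z - (- V)) <= fnorm A.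
  apply: (log_increasing ug hNV hNZ hA); first by rewrite opprK -EV.
  rewrite gh -ss; apply: (can_inj (mulmxK us)); rewrite gE -!mulmxA; congr (_ *m _).
  have zZ : z *m mexp (- Z) *m z = 1%:M.
    have c : z *m mexp (- Z) = mexp (- Z) *m z.
      rewrite zE; apply/esym/mexp_intertwine; rewrite mulNmx mulmxN; congr (- _).
      by apply/esym/mexp_intertwine; rewrite -scalemxAl -scalemxAr.
    by rewrite c -mulmxA zz -[X in _ *m mexp X]opprK mexp_hermN.
  by rewrite !mulmxA zZ mul1mx.
have k2 : fnorm (Z - (- V)) <= fnorm B.
  apply: (log_increasing ug hNV hZ hB); first by rewrite opprK -EV.
  rewrite EB gh gE !mulmxA; congr (_ *m _); rewrite -!mulmxA; congr (_ *m _).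
  rewrite zE -[in mexp Z](scale1r Z) -(rmorph1 (real_complex R)) -!(mexp_hermM _ _ hZ).
  by congr (mexp (_%:C *: _)); lra.
have p : fnorm (- Z - - V) ^+ 2 + fnorm (Z - - V) ^+ 2 = 2 * fnorm V ^+ 2 + 2 * fnorm Z ^+ 2.
  by rewrite !fnorm_sqr !opprK !fdotDl !fdotDr !fdotNl !fdotNr (fdotC V Z); ring.
have s1 : fnorm (- Z - - V) ^+ 2 <= fnorm A ^+ 2 by rewrite lerXn2r ?nnegrE ?fnorm_ge0.
have s2 : fnorm (Z - - V) ^+ 2 <= fnorm B ^+ 2 by rewrite lerXn2r ?nnegrE ?fnorm_ge0.
have s3 : fnorm (A - B) ^+ 2 <= (2 * fnorm Z) ^+ 2 by rewrite lerXn2r ?nnegrE ?mulr_ge0 ?fnorm_ge0.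
rewrite WV; rewrite exprMn in s3; lra.
Qed.

End Nonpositive.

(** * Exponential sums, and Zariski closed sets along complex one-parameter groups *)

Section ExponentialSums.
Variable R : realType.
Local Notation C := R[i].

(** The frequencies are real and the coefficients complex. Polynomials in the entries of [e^(zX)],
    [X] Hermitian, have this form, and such a sum is determined by its values at the naturals or on
    the imaginary axis. *)
Definition expsum (phi : C -> C) :=
  exists s : seq (C * R), forall z, phi z = \sum_(p <- s) p.1 * cexp (z * (p.2)%:C).

Lemma expsum_ext f g : f =1 g -> expsum f -> expsum g.
Proof. by move=> fg [s hs]; exists s => z; rewrite -fg hs. Qed.

Lemma expsum_exp (a : R) : expsum (fun z => cexp (z * a%:C)).
Proof. by exists [:: (1, a)] => z; rewrite big_seq1 mul1r. Qed.

Lemma expsum_cst c : expsum (fun=> c).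
Proof. by exists [:: (c, 0)] => z; rewrite big_seq1 /= mulr0 cexp0 mulr1. Qed.

Lemma expsumD f g : expsum f -> expsum g -> expsum (fun z => f z + g z).
Proof. by move=> [s hs] [t ht]; exists (s ++ t) => z; rewrite big_cat /= hs ht. Qed.

Lemma expsumM f g : expsum f -> expsum g -> expsum (fun z => f z * g z).
Proof.
move=> [s hs] [t ht]; exists [seq (p.1 * q.1, p.2 + q.2) | p <- s, q <- t] => z.
rewrite hs ht big_allpairs_dep mulr_suml; apply: eq_bigr => p _.
rewrite mulr_sumr; apply: eq_bigr => q _ /=.
by rewrite rmorphD mulrDr cexpD; ring.
Qed.

Lemma expsum_sum I (r : seq I) (P : pred I) (f : I -> C -> C) :
  (forall i, expsum (f i)) -> expsum (fun z => \sum_(i <- r | P i) f i z).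
Proof.
move=> h; elim: r => [|i r IH].
  by apply: expsum_ext (expsum_cst 0) => z; rewrite big_nil.
have [Pi|nPi] := boolP (P i).
  have [s hs] := expsumD (h i) IH; exists s => z; by rewrite big_cons Pi hs.
by have [s hs] := IH; exists s => z; rewrite big_cons (negPf nPi) hs.
Qed.

Lemma expsum_prod I (r : seq I) (P : pred I) (f : I -> C -> C) :
  (forall i, expsum (f i)) -> expsum (fun z => \prod_(i <- r | P i) f i z).
Proof.
move=> h; elim: r => [|i r IH].
  by apply: expsum_ext (expsum_cst 1) => z; rewrite big_nil.
have [Pi|nPi] := boolP (P i).
  have [s hs] := expsumM (h i) IH; exists s => z; by rewrite big_cons Pi hs.
by have [s hs] := IH; exists s => z; rewrite big_cons (negPf nPi) hs.
Qed.

Lemma expsumX f k : expsum f -> expsum (fun z => f z ^+ k).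
Proof.
move=> hf; elim: k => [|k IH]; first by apply: expsum_ext (expsum_cst 1) => z; rewrite expr0.
by have [s hs] := expsumM hf IH; exists s => z; rewrite exprS hs.
Qed.

Lemma expsumB f g : expsum f -> expsum g -> expsum (fun z => f z - g z).
Proof.
move=> hf hg; have := expsumD hf (expsumM (expsum_cst (-1)) hg).
by apply: expsum_ext => z; rewrite mulN1r.
Qed.

Lemma interpolation (T : eqType) (s : seq T) (q h : T -> C) :
  {in s &, injective q} -> exists p : {poly C}, forall x, x \in s -> p.[q x] = h x.
Proof.
elim: s => [|x s IH] qi; first by exists 0.
have [|p hp] := IH; first by move=> y z ys zs; apply: qi; rewrite inE ?ys ?zs orbT.
have [xs|xs] := boolP (x \in s).
  by exists p => y; rewrite inE => /orP[/eqP->|]; apply: hp.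
pose w := \prod_(y <- s) ('X - (q y)%:P).
have wx : w.[q x] != 0.
  rewrite /w horner_prod prodf_seq_neq0; apply/allP => y ys /=.
  rewrite hornerXsubC subr_eq0; apply: contraNneq xs => /qi -> //.
    by rewrite mem_head.
  by rewrite inE ys orbT.
exists (p + ((h x - p.[q x]) / w.[q x]) *: w) => y; rewrite inE hornerD hornerZ.
have [-> _|_ /= ys] := eqVneq y x; first by rewrite divfK// addrC subrK.
suff -> : w.[q y] = 0 by rewrite mulr0 addr0 hp.
rewrite /w horner_prod; apply/eqP; rewrite prodf_seq_eq0; apply/hasP; exists y => //=.
by rewrite hornerXsubC subrr eqxx.
Qed.

(* Interpolate [nu |-> e^(z nu)] by a polynomial in [e^(z0 nu)]. *)
Lemma expsum_eq0 (s : seq (C * R)) (z0 : C) :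
  {in [seq p.2 | p <- s] &, injective (fun nu => cexp (z0 * nu%:C))} ->
  (forall m : nat, \sum_(p <- s) p.1 * cexp (m%:R * z0 * (p.2)%:C) = 0) ->
  forall z, \sum_(p <- s) p.1 * cexp (z * (p.2)%:C) = 0.
Proof.
move=> inj h z.
have [P hP] := interpolation (fun nu : R => cexp (z * nu%:C)) inj.
transitivity (\sum_(p <- s) p.1 * P.[cexp (z0 * (p.2)%:C)]).
  rewrite !big_seq; apply: eq_bigr => p ps; rewrite hP//; exact: map_f.
transitivity (\sum_(i < size P) P`_i * \sum_(p <- s) p.1 * cexp (i%:R * z0 * (p.2)%:C)).
  rewrite (eq_bigr (fun p => \sum_(i < size P) P`_i * (p.1 * cexp (i%:R * z0 * (p.2)%:C)))).
    by rewrite exchange_big; apply: eq_bigr => i _; rewrite mulr_sumr.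
  move=> p _; rewrite horner_coef mulr_sumr; apply: eq_bigr => i _.
  by rewrite -mulrA cexp_nat; ring.
by rewrite big1// => i _; rewrite h mulr0.
Qed.

Lemma expsum_real_eq0 f : expsum f -> (forall m : nat, f m%:R = 0) -> forall z, f z = 0.
Proof.
move=> [s hs] h z; rewrite hs; apply: (@expsum_eq0 s 1) => [x y _ _|m].
  by rewrite !mul1r !cexpR => /complexI/expR_inj.
by rewrite mulr1 -hs h.
Qed.

Lemma cexp_imag (r : R) : cexp ('i%C * r%:C) = (cos r +i* sin r)%C.
Proof.
have -> : 'i%C * r%:C = (0 +i* r)%C.
  by apply/eqP; rewrite eq_complex /=; apply/andP; split; apply/eqP; ring.
by rewrite /cexp /= expR0 mul1r.
Qed.

Lemma expsum_imag_eq0 f : expsum f -> (forall t : R, f ('i%C * t%:C) = 0) -> forall z, f z = 0.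
Proof.
move=> [s hs] h z; rewrite hs.
(* All quotients of frequencies by [B] lie in [[-1, 1]], where [sin] is injective; so the nodes
   [e^(i nu / B)] are distinct. *)
pose B := 1 + \sum_(p <- s) `|p.2|.
have B0 : 0 < B by rewrite ltr_wpDr// sumr_ge0.
have hB x : x \in [seq p.2 | p <- s] -> `|B^-1 * x| <= 1.
  move=> /mapP[p ps ->]; rewrite normrM gtr0_norm ?invr_gt0// mulrC ler_pdivrMr// mul1r.
  rewrite /B (big_rem p)//= addrCA lerDl addr_ge0// sumr_ge0//.
have hpi x : `|x| <= 1 -> x \in `[(- (pi / 2) : R), pi / 2].
  have := @pihalf_ge1 R; rewrite ler_norml in_itv /= => h1 /andP[h2 h3].
  by rewrite (le_trans h3 h1) andbT; apply: le_trans h2; rewrite lerN2.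
apply: (@expsum_eq0 s ('i%C * (B^-1)%:C)) => [x y xs ys|m].
  rewrite -!mulrA -!rmorphM !cexp_imag => -[_].
  move=> /sin_inj hsin; have := hsin (hpi _ (hB _ xs)) (hpi _ (hB _ ys)).
  by apply: mulfI; rewrite invr_eq0 gt_eqF.
by rewrite -hs mulrCA (_ : m%:R = m%:R%:C) -?rmorphM ?h// rmorph_nat.
Qed.

Definition expsum_mx m n (f : C -> 'M[C]_(m, n)) := forall i j, expsum (fun z => f z i j).

Lemma expsum_mulmx m n p (f : C -> 'M[C]_(m, n)) (g : C -> 'M[C]_(n, p)) :
  expsum_mx f -> expsum_mx g -> expsum_mx (fun z => f z *m g z).
Proof.
move=> hf hg i j; apply: (@expsum_ext (fun z => \sum_k f z i k * g z k j)) => [z|]; first by rewrite mxE.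
by apply: expsum_sum => k; apply: expsumM.
Qed.

Lemma expsum_mx_cst m n (A : 'M[C]_(m, n)) : expsum_mx (fun=> A).
Proof. by move=> i j; exact: expsum_cst. Qed.

Lemma expsum_dgc n (a : 'I_n -> R) : expsum_mx (fun z => dgc (fun i => cexp (z * (a i)%:C))).
Proof.
move=> i j; case: (eqVneq i j) => [->|ij].
  apply: (@expsum_ext (fun z => cexp (z * (a j)%:C))) => [z|]; last exact: expsum_exp.
  by rewrite dgcE eqxx mulr1n.
apply: (@expsum_ext (fun=> 0)) => [z|]; last exact: expsum_cst.
by rewrite dgcE (negPf ij).
Qed.

(* [e^(zX)] for [X = U (dg a) U*], without the restriction to [axial z]. *)
Definition specz n (U : 'M[C]_n) (a : 'I_n -> R) (z : C) :=
  U *m dgc (fun i => cexp (z * (a i)%:C)) *m U^t*.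

Lemma expsum_specz n (U : 'M[C]_n) a : expsum_mx (specz U a).
Proof.
apply: expsum_mulmx; last exact: expsum_mx_cst.
by apply: expsum_mulmx; [exact: expsum_mx_cst|exact: expsum_dgc].
Qed.

Lemma expsum_eval n (p : mpoly.mpoly (n * n) C) (f : C -> 'M[C]_n) :
  expsum_mx f -> expsum (fun z => eval_entries p (f z)).
Proof.
move=> hf; have -> : (fun z => eval_entries p (f z)) = (fun z =>
    \sum_(m <- mpoly.msupp p) mpoly.mcoeff m p * \prod_(i < n * n) mxvec (f z) 0 i ^+ mpoly.fun_of_multinom m i).
  by apply/funext => z; rewrite /eval_entries mpoly.mevalE.
apply: expsum_sum => m; apply: expsumM; first exact: expsum_cst.
apply: expsum_prod => i; apply: expsumX.
case/mxvec_indexP: i => i j; apply: (@expsum_ext (fun z => f z i j)) => [z|]; last exact: hf.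
by rewrite mxvecE.
Qed.

Lemma det_specz n (U : 'M[C]_n) a z : U \is unitarymx ->
  \det (specz U a z) = cexp (z * (\sum_i a i)%:C).
Proof.
move=> /unitaryP[h1 h2]; rewrite /specz !det_mulmx mulrAC -det_mulmx h1 det1 mul1r.
rewrite det_diag rmorph_sum mulr_sumr cexp_sum; apply: eq_bigr => i _; by rewrite mxE.
Qed.

Lemma specz_unit n (U : 'M[C]_n) a z : U \is unitarymx -> specz U a z \in unitmx.
Proof. by move=> hU; rewrite unitmxE unitfE det_specz// cexp_neq0. Qed.

(** Each defining polynomial of [Z] becomes an exponential sum in [z], so vanishing at the naturals
    spreads to all complex times. *)
Lemma zariski_specz_real n (Z : set 'M[C]_n) (U : 'M[C]_n) a : zariski_closed Z ->
  U \is unitarymx -> (forall m : nat, Z (specz U a m%:R)) -> forall z, Z (specz U a z).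
Proof.
move=> [P ->] hU h z; split; first exact: specz_unit.
move=> p Pp; apply: (expsum_real_eq0 (expsum_eval p (expsum_specz U a))) => m.
by have [_] := h m; apply.
Qed.

Lemma zariski_specz_imag n (Z : set 'M[C]_n) (U : 'M[C]_n) a : zariski_closed Z ->
  U \is unitarymx -> (forall t : R, Z (specz U a ('i%C * t%:C))) -> forall z, Z (specz U a z).
Proof.
move=> [P ->] hU h z; split; first exact: specz_unit.
move=> p Pp; apply: (expsum_imag_eq0 (expsum_eval p (expsum_specz U a))) => t.
by have [_] := h t; apply.
Qed.

Lemma mexp_specz n (U : 'M[C]_n) a z : U \is unitarymx -> axial z ->
  mexp (z *: (U *m dg a *m U^t*)) = specz U a z.
Proof. exact: mexp_spectral. Qed.

End ExponentialSums.

(** * Real subspaces of complex matrix spaces *)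

Section RealSubspaces.
Variables (R : realType) (n : nat).
Local Notation C := R[i].
Implicit Types (S : set 'M[C]_n).

Definition real_subspace S := [/\ S 0, forall X Y, S X -> S Y -> S (X + Y) &
  forall (a : R) X, S X -> S (a%:C *: X)].

Definition orthonormal_in S k (e : 'I_k -> 'M[C]_n) :=
  (forall i, S (e i)) /\ forall i j, fdot (e i) (e j) = (i == j)%:R.

(** Splitting entries into real and imaginary parts turns the family into [k] orthonormal real rows
    of length [2 n^2], which have rank [k]. *)
Lemma orthonormal_size S k (e : 'I_k -> 'M[C]_n) : orthonormal_in S e ->
  (k <= n * n + n * n)%N.
Proof.
move=> [_ he].
pose A : 'M[R]_(k, n * n + n * n) := \matrix_i
  row_mx (map_mx (@complex.Re R) (mxvec (e i))) (map_mx (@complex.Im R) (mxvec (e i))).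
have A1 i p q : A i (lshift _ (mxvec_index p q)) = complex.Re (e i p q).
  by rewrite mxE row_mxEl mxE mxvecE.
have A2 i p q : A i (rshift _ (mxvec_index p q)) = complex.Im (e i p q).
  by rewrite mxE row_mxEr mxE mxvecE.
have AA : A *m A^T = 1%:M.
  apply/matrixP => i j; rewrite mxE [RHS]mxE -he fdotE.
  rewrite big_split_ord /= (reindex _ (curry_mxvec_bij _ _)) /=.
  rewrite [X in _ + X](reindex _ (curry_mxvec_bij _ _)) /= -big_split /= pair_bigA /=.
  apply: eq_bigr => -[p q] _ /=; rewrite ![A^T _ j]mxE !A1 !A2.
  by case: (e i p q) => a b; case: (e j p q) => c d /=; ring.
have : \rank (A *m A^T) = k by rewrite AA mxrank1.
move=> <-; apply: leq_trans (mxrankM_maxl _ _) _; exact: rank_leq_col.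
Qed.

Lemma real_subspace_sum S : real_subspace S -> forall I (r : seq I) (F : I -> 'M[C]_n),
  (forall i, S (F i)) -> S (\sum_(i <- r) F i).
Proof. by move=> [S0 SD SZ] I r F hF; elim/big_ind: _ => // X Y; exact: SD. Qed.

Lemma real_subspaceB S X Y : real_subspace S -> S X -> S Y -> S (X - Y).
Proof.
move=> [S0 SD SZ] hX hY; rewrite -scaleN1r -(rmorphN1 (real_complex R)).
by apply: SD => //; exact: SZ.
Qed.

(** A maximal orthonormal family spans: otherwise the normalized residual of a vector would extend
    it. *)
Lemma orthonormal_basis S : real_subspace S -> exists k (e : 'I_k -> 'M[C]_n),
  orthonormal_in S e /\ forall X, S X -> X = \sum_i (fdot X (e i))%:C *: e i.
Proof.
move=> hS; have [S0 SD SZ] := hS.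
pose P k := `[< exists e : 'I_k -> 'M[C]_n, orthonormal_in S e >].
have P0 : exists k, P k.
  exists 0%N; apply/asboolP; exists (fun=> 0); split; by case.
have Pb k : P k -> (k <= n * n + n * n)%N by move=> /asboolP[e]; exact: orthonormal_size.
case: (ex_maxnP P0 Pb) => k /asboolP[e [eS eo]] kmax; exists k, e; split=> // X SX.
apply/eqP; rewrite -subr_eq0; apply/negPn/negP => Y0.
set Y := X - _ in Y0.
have SY : S Y.
  by apply: real_subspaceB => //; apply: real_subspace_sum => // i; exact: SZ.
have Yo i : fdot Y (e i) = 0.
  rewrite fdotBl fdot_suml (bigD1 i)//= big1 ?addr0 => [|j ji].
    by rewrite fdotZl eo eqxx mulr1 subrr.
  by rewrite fdotZl eo (negPf ji) mulr0.
have y0 := fnorm_gt0 Y0.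
pose e' (i : 'I_k.+1) := if unlift ord_max i is Some j then e j else ((fnorm Y)^-1)%:C *: Y.
suff : P k.+1 by move=> /kmax; rewrite ltnn.
apply/asboolP; exists e'; split => [i|i j]; rewrite /e'.
  by case: unliftP => [j _|_]; [exact: eS|exact: SZ].
case: (unliftP ord_max i) => [i' ->|->]; case: (unliftP ord_max j) => [j' ->|->].
- by rewrite eo (inj_eq lift_inj).
- by rewrite fdotZr fdotC Yo mulr0 eq_sym (negPf (neq_lift _ _)).
- by rewrite fdotZl Yo mulr0 (negPf (neq_lift _ _)).
- rewrite fdotZl fdotZr eqxx -fnorm_sqr mulrA -invfM -expr2 mulVf//.
  by rewrite expf_eq0 /= gt_eqF.
Qed.

(** Subtracting the projection on an orthonormal basis is Lipschitz with constant [1 + k] and kills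
    the approximants [Y], hence also their limit. *)
Lemma real_subspace_closed S (X : 'M[C]_n) : real_subspace S ->
  (forall e : R, 0 < e -> exists2 Y, S Y & fnorm (Y - X) < e) -> S X.
Proof.
move=> hS hX; have [k [e [[eS eo] he]]] := orthonormal_basis hS.
suff -> : X = \sum_i (fdot X (e i))%:C *: e i.
  by apply: real_subspace_sum => // i; have [_ _] := hS; apply.
apply/eqP; rewrite -subr_eq0; apply/negPn/negP => /fnorm_gt0; set d := fnorm _ => d0.
have d1 : 0 < d / (1 + k%:R) by rewrite divr_gt0// ltr_wpDr.
have [Y SY hY] := hX _ d1.
have : d <= (1 + k%:R) * fnorm (Y - X).
  have -> : d = fnorm ((Y - X) - \sum_i (fdot (Y - X) (e i))%:C *: e i).
    have -> : \sum_i (fdot (Y - X) (e i))%:C *: e i = Y - \sum_i (fdot X (e i))%:C *: e i.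
      rewrite [in RHS](he Y SY) -sumrB; apply: eq_bigr => i _.
      by rewrite fdotBl rmorphB scalerBl.
    by rewrite /d opprB [X in _ = fnorm X]addrC addrA subrK fnormBC.
  apply: le_trans (fnormB _ _) _; rewrite mulrDl mul1r lerD2l.
  apply: le_trans (fnorm_sum _ _ _) _.
  apply: (@le_trans _ _ (\sum_(i < k) fnorm (Y - X))); last by rewrite sumr_const card_ord mulr_natl.
  apply: ler_sum => i _; have e1 : fnorm (e i) = 1.
    by apply/eqP; rewrite -(@eqrXn2 _ 2)// ?fnorm_ge0// fnorm_sqr eo eqxx expr1n.
  by rewrite fnormZr e1 mulr1; apply: le_trans (fdot_le _ _) _; rewrite e1 mulr1.
rewrite leNgt => /negP; apply; move: hY; rewrite ltr_pdivlMr ?ltr_wpDr// mulrC//.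
Qed.

Lemma riesz S (l : 'M[C]_n -> R) : real_subspace S ->
  (forall X Y, S X -> S Y -> l (X + Y) = l X + l Y) ->
  (forall (a : R) X, S X -> l (a%:C *: X) = a * l X) ->
  exists2 mu, S mu & forall X, S X -> l X = fdot mu X.
Proof.
move=> hS lD lZ; have [k [e [[eS eo] he]]] := orthonormal_basis hS.
have [S0 SD SZ] := hS.
have l0 : l 0 = 0 by rewrite -[0](scale0r (0 : 'M[C]_n)) (_ : 0 = 0%:C)// lZ ?mul0r.
exists (\sum_i (l (e i))%:C *: e i); first by apply: real_subspace_sum => // i; exact: SZ.
move=> X SX; rewrite {1}(he X SX) fdot_suml.
have : S (\sum_i (fdot X (e i))%:C *: e i) /\ l (\sum_i (fdot X (e i))%:C *: e i) = \sum_i fdot X (e i) * l (e i).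
  elim/big_ind2: _ => [//|A a B b [h1 h2] [h3 h4]|i _].
    by split; [exact: SD|rewrite lD// h2 h4].
  by split; [exact: SZ|rewrite lZ].
move=> [_ ->]; apply: eq_bigr => i _; by rewrite fdotZl fdotC mulrC.
Qed.

End RealSubspaces.

(** * Closed unitary groups, their Lie algebras, and differentiability of polynomials *)

Section UnitaryGroups.
Variable (R : realType).
Local Notation C := R[i].

Lemma mexpE n (X : 'M[C]_n) : expmx X = mexp X.
Proof. by rewrite mexp.unlock. Qed.

Lemma o2_unique m n (f : R -> 'M[C]_(m, n)) f0 A B : o2 f f0 A -> o2 f f0 B -> A = B.
Proof.
move=> [c c0 hc] [d d0 hd]; apply/eqP; rewrite -subr_eq0; apply/eqP/fnorm_eq0.
apply/le_anti; rewrite fnorm_ge0 andbT; apply: (@le_limit_pow2 _ _ _ (c + d)) => j.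
have s0 : 0 < (2 ^- j : R) by rewrite invr_gt0 exprn_gt0.
have s1 : `|2 ^- j : R| <= 1 by rewrite gtr0_norm// invf_le1 ?exprn_gt0// exprn_ege1// ler1n.
set s := (2 ^- j : R) in s0 s1 *; rewrite add0r.
have h : fnorm (s%:C *: (A - B)) <= (c + d) * s ^+ 2.
  have -> : s%:C *: (A - B) = (f s - f0 - s%:C *: B) - (f s - f0 - s%:C *: A).
    by apply/matrixP => p q; rewrite !mxE; ring.
  apply: le_trans (fnormB _ _) _; rewrite mulrDl addrC; apply: lerD; [exact: hc|exact: hd].
move: h; rewrite fnormZr gtr0_norm// expr2 mulrA mulrC ler_pM2r//.
Qed.

Lemma o2_adj m n (f : R -> 'M[C]_(m, n)) f0 A : o2 f f0 A ->
  o2 (fun t => (f t)^t*) (f0^t*) (A^t*).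
Proof.
move=> [c c0 hc]; exists c => // t t1.
by rewrite -adjmxZr -!adjmxB fnorm_adj hc.
Qed.

Lemma o2_ext m n (f g : R -> 'M[C]_(m, n)) f0 A : f =1 g -> o2 f f0 A -> o2 g f0 A.
Proof. by move=> fg [c c0 hc]; exists c => // t t1; rewrite -fg hc. Qed.

Lemma skew_of_unitary n (X : 'M[C]_n) :
  (forall t : R, mexp (t%:C *: X) \is unitarymx) -> X^t* = - X.
Proof.
move=> hX; have ha : tay2 (fun t => (mexp (t%:C *: X))^t*) (X^t*).
  by have := o2_adj (tay2_mexp X); rewrite adjmx1.
have h : tay2 (fun=> 1%:M) (X + X^t*).
  by apply: o2_ext (tay2M (tay2_mexp X) ha) => t; have [-> _] := unitaryP (hX t).
by apply/eqP; rewrite -addr_eq0 addrC (o2_unique h (o2_cst _)).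
Qed.

Lemma scaler_iC n (t : R) (X : 'M[C]_n) : ('i%C * t%:C) *: X = t%:C *: ('i%C *: X).
Proof. by rewrite scalerA mulrC. Qed.

Lemma tay2_mexpi n (X : 'M[C]_n) : tay2 (fun t => mexp (('i%C * t%:C) *: X)) ('i%C *: X).
Proof. by apply: o2_ext (tay2_mexp _) => t; rewrite scaler_iC. Qed.

Lemma mexp_hermXi n (X : 'M[C]_n) (t : R) k : X^t* = X ->
  mexp (('i%C * t%:C) *: X) ^+ k = mexp (('i%C * (k%:R * t)%:C) *: X).
Proof.
move=> hX; elim: k => [|k IH]; first by rewrite mxexpr0 mul0r mulr0 scale0r mexp0.
by rewrite mxexprS IH -mexp_hermMi//; congr (mexp ((_ * _%:C) *: _)); rewrite -natr1; ring.
Qed.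

(** At time [t / m] the two curves agree up to order [1 / m^2], and by unitarity the m-fold powers
    differ by at most [m] times as much. *)
Lemma trotter n (f : R -> 'M[C]_n) Z : (forall t, f t \is unitarymx) -> Z^t* = Z ->
  tay2 f ('i%C *: Z) -> forall t e, 0 < e -> exists m : nat,
  fnorm (f (t / m.+1%:R) ^+ m.+1 - mexp (('i%C * t%:C) *: Z)) < e.
Proof.
move=> hf hZ [c c0 hc] t e e0; have [d d0 hd] := tay2_mexpi Z.
pose B := (c + d) * t ^+ 2 / e.
(* Exceeding [|t|] brings [t / m.+1] into the range of the expansions; exceeding [B] makes the total
   error less than [e]. *)
pose m := Num.truncn (`|t| + B).
have hm : `|t| + B < m.+1%:R by rewrite truncnS_gt.
have B0 : 0 <= B by apply: divr_ge0 (ltW e0); rewrite mulr_ge0 ?addr_ge0 ?sqr_ge0.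
exists m; set s := t / m.+1%:R.
have m0 : 0 < (m.+1%:R : R) by rewrite ltr0n.
have s1 : `|s| <= 1.
  rewrite normrM normfV (ger0_norm (ltW m0)) ler_pdivrMr// mul1r.
  apply: le_trans (ltW hm); lra.
have -> : mexp (('i%C * t%:C) *: Z) = mexp (('i%C * s%:C) *: Z) ^+ m.+1.
  by rewrite mexp_hermXi// (_ : m.+1%:R * s = t)// /s mulrC divfK// gt_eqF.
apply: le_lt_trans (unitary_exprB _ (hf s) (mexp_skew_unitary s hZ)) _.
have h : fnorm (f s - mexp (('i%C * s%:C) *: Z)) <= (c + d) * s ^+ 2.
  have -> : f s - mexp (('i%C * s%:C) *: Z) =
    (f s - 1%:M - s%:C *: ('i%C *: Z)) - (mexp (('i%C * s%:C) *: Z) - 1%:M - s%:C *: ('i%C *: Z)).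
    by apply/matrixP => p q; rewrite !mxE; ring.
  apply: le_trans (fnormB _ _) _; rewrite mulrDl; apply: lerD; [exact: hc|exact: hd].
apply: le_lt_trans (ler_wpM2l (ltW m0) h) _.
have -> : m.+1%:R * ((c + d) * s ^+ 2) = (c + d) * t ^+ 2 / m.+1%:R.
  by rewrite /s; field; rewrite gt_eqF.
rewrite ltr_pdivrMr// [ltRHS]mulrC -ltr_pdivrMr//; apply: le_lt_trans hm.
by rewrite -/B lerDr.
Qed.

(** For a homomorphism the powers in [trotter] are equal to [f t], so the approximation is an
    equality. *)
Lemma one_param_unitary n (f : R -> 'M[C]_n) Z : (forall t, f t \is unitarymx) ->
  (forall s t, f (s + t) = f s *m f t) -> Z^t* = Z -> tay2 f ('i%C *: Z) ->
  forall t, f t = mexp (('i%C * t%:C) *: Z).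
Proof.
move=> hf fD hZ hT t; apply/eqP; rewrite -subr_eq0; apply/negPn/negP => /fnorm_gt0 d0.
have [m] := trotter hf hZ hT t d0.
have f0 : f 0 = 1%:M.
  have := fD 0 0; rewrite addr0 => h; have [h1 h2] := unitaryP (hf 0).
  by rewrite -[LHS]mulmx1 -h1 mulmxA -h.
have fX s k : f s ^+ k = f (k%:R * s).
  elim: k => [|k IH]; first by rewrite mxexpr0 mul0r f0.
  by rewrite mxexprS IH -fD; congr f; rewrite -natr1; ring.
by rewrite fX mulrC divfK ?pnatr_eq0// ltxx.
Qed.

Lemma ilieP n (S : set 'M[C]_n) (X : 'M[C]_n) : S `<=` [set g | g \is unitarymx] ->
  ilie S X <-> X^t* = X /\ forall t : R, S (mexp (('i%C * t%:C) *: X)).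
Proof.
move=> hS; split=> [[Y hY <-]|[hX hXS]].
  have hYS t : S (mexp (t%:C *: Y)) by rewrite -mexpE; exact: hY.
  have hYa : Y^t* = - Y by apply: skew_of_unitary => t; exact: hS.
  split=> [|t].
    rewrite adjmxZ hYa scalerN -scaleNr; congr (_ *: _).
    by apply/eqP; rewrite eq_complex /= opprK !eqxx oppr0 eqxx.
  have := hYS (- t); rewrite scalerA; congr (S (mexp (_ *: _))).
  by apply/eqP; rewrite eq_complex /=; apply/andP; split; apply/eqP; ring.
exists (- 'i%C *: X); last first.
  by rewrite scalerA mulrN -expr2 sqr_i opprK scale1r.
move=> t; rewrite mexpE scalerA; have := hXS (- t); congr (S (mexp (_ *: _))).
by apply/eqP; rewrite eq_complex /=; apply/andP; split; apply/eqP; ring.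
Qed.

Definition fclosed n (S : set 'M[C]_n) := forall g,
  (forall e : R, 0 < e -> exists2 h, S h & fnorm (h - g) < e) -> S g.

Lemma matrix_groupX n (S : set 'M[C]_n) g k : matrix_group S -> S g -> S (g ^+ k).
Proof.
move=> [_ S1 SM _] Sg; elim: k => [|k IH]; first by rewrite mxexpr0.
by rewrite mxexprS; exact: SM.
Qed.

(** The substance is the sum: [e^(it(X+Y))] is a limit of powers of [e^(isX) e^(isY)] by [trotter],
    and [S] is closed. *)
Lemma ilie_subspace n (S : set 'M[C]_n) : matrix_group S ->
  S `<=` [set g | g \is unitarymx] -> fclosed S -> real_subspace (ilie S).
Proof.
move=> gS uS cS; have [_ S1 SM _] := gS; split.
- apply/ilieP => //; split; first exact: adjmx0.
  by move=> t; rewrite scaler0 mexp0.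
- move=> X Y /ilieP[]// hX XS /ilieP[]// hY YS; apply/ilieP => //.
  have hXY : (X + Y)^t* = X + Y by rewrite adjmxD hX hY.
  split=> // t; apply: cS => e e0.
  pose f s := mexp (('i%C * s%:C) *: X) *m mexp (('i%C * s%:C) *: Y).
  have hf s : S (f s) by apply: SM.
  have fu s : f s \is unitarymx by exact: uS.
  have fT : tay2 f ('i%C *: (X + Y)) by rewrite scalerDr; apply: tay2M; exact: tay2_mexpi.
  have [m hm] := trotter fu hXY fT t e0.
  by exists (f (t / m.+1%:R) ^+ m.+1) => //; exact: matrix_groupX.
- move=> a X /ilieP[]// hX XS; apply/ilieP => //; split; first exact: herm_scale.
  by move=> t; rewrite scalerA -mulrA -rmorphM; exact: XS.
Qed.

(** The derivative is complex linear and bounded, with a quadratic remainder on the unit ball around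
    [g]; stability under sums and products then covers polynomials and the determinant. *)
Definition diffq n (g : 'M[C]_n) (phi : 'M[C]_n -> C) (D : 'M[C]_n -> C) := exists2 c : R,
  [/\ 0 <= c, forall X Y, D (X + Y) = D X + D Y, forall a X, D (a *: X) = a * D X &
    forall X, normc (D X) <= c * fnorm X] &
  forall h, fnorm (h - g) <= 1 -> normc (phi h - phi g - D (h - g)) <= c * fnorm (h - g) ^+ 2.

Definition diffable n g phi := exists D, @diffq n g phi D.

Lemma normc_opp (a : C) : normc (- a) = normc a.
Proof. by case: a => x y /=; rewrite !sqrrN. Qed.

Lemma normcB_le (a b : C) : normc (a - b) <= normc a + normc b.
Proof. by apply: le_trans (le_normcD _ _) _; rewrite lerD2l normc_opp. Qed.

Lemma diffq_lip n g phi D : @diffq n g phi D -> exists2 c : R, 0 <= c &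
  forall h, fnorm (h - g) <= 1 -> normc (phi h - phi g) <= c * fnorm (h - g).
Proof.
move=> [c [c0 _ _ hD] hc]; exists (c + c) => [|h h1]; first by rewrite addr_ge0.
have := le_normcD (phi h - phi g - D (h - g)) (D (h - g)); rewrite subrK => /le_trans; apply.
rewrite mulrDl; apply: lerD => //; apply: le_trans (hc h h1) _.
by rewrite ler_wpM2l// expr2 ler_piMr ?fnorm_ge0.
Qed.

Lemma diffable_cst n (g : 'M[C]_n) a : diffable g (fun=> a).
Proof.
exists (fun=> 0); exists 0 => [|h _]; last by rewrite subrr subr0 normc0 mul0r.
by split=> // *; rewrite ?addr0 ?mulr0 ?normc0 ?mul0r.
Qed.

Lemma diffable_entry n (g : 'M[C]_n) i j : diffable g (fun h => h i j).
Proof.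
exists (fun h => h i j); exists 1 => [|h _]; last by rewrite !mxE subrr normc0 mul1r sqr_ge0.
by split=> // *; rewrite ?mxE ?mul1r ?normc_le_fnorm.
Qed.

Lemma diffableD n (g : 'M[C]_n) f1 f2 : diffable g f1 -> diffable g f2 ->
  diffable g (fun h => f1 h + f2 h).
Proof.
move=> [D1 [c1 [c10 D1D D1Z D1b] h1]] [D2 [c2 [c20 D2D D2Z D2b] h2]].
exists (fun X => D1 X + D2 X); exists (c1 + c2).
  split=> [|X Y|a X|X]; first exact: addr_ge0.
  - by rewrite D1D D2D addrACA.
  - by rewrite D1Z D2Z mulrDr.
  - by apply: le_trans (le_normcD _ _) _; rewrite mulrDl lerD.
move=> h hh; rewrite (_ : _ - _ - _ = (f1 h - f1 g - D1 (h - g)) + (f2 h - f2 g - D2 (h - g))); last by ring.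
by apply: le_trans (le_normcD _ _) _; rewrite mulrDl lerD ?h1 ?h2.
Qed.

Lemma diffableM n (g : 'M[C]_n) f1 f2 : diffable g f1 -> diffable g f2 ->
  diffable g (fun h => f1 h * f2 h).
Proof.
move=> [D1 H1] [D2 H2]; have [l1 l10 hl1] := diffq_lip H1; have [l2 l20 hl2] := diffq_lip H2.
have [c1 [c10 D1D D1Z D1b] h1] := H1; have [c2 [c20 D2D D2Z D2b] h2] := H2.
exists (fun X => D1 X * f2 g + f1 g * D2 X).
have n1 := normc_ge0 (f1 g); have n2 := normc_ge0 (f2 g).
exists (c1 * normc (f2 g) + normc (f1 g) * c2 + l1 * l2).
  split=> [|X Y|a X|X]; first by rewrite !addr_ge0 ?mulr_ge0.
  - by rewrite D1D D2D; ring.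
  - by rewrite D1Z D2Z; ring.
  - apply: le_trans (le_normcD _ _) _; rewrite !normcM.
    apply: (@le_trans _ _ ((c1 * normc (f2 g) + normc (f1 g) * c2) * fnorm X)); last first.
      by rewrite ler_wpM2r ?fnorm_ge0// lerDl mulr_ge0.
    rewrite mulrDl; apply: lerD; first by rewrite mulrAC ler_wpM2r.
    by rewrite -mulrA ler_wpM2l.
move=> h hh; rewrite (_ : _ - _ - _ = (f1 h - f1 g - D1 (h - g)) * f2 g +
  f1 g * (f2 h - f2 g - D2 (h - g)) + (f1 h - f1 g) * (f2 h - f2 g)); last by ring.
apply: le_trans (le_normcD _ _) _; rewrite [leRHS]mulrDl; apply: lerD; last first.
  rewrite normcM expr2 mulrACA; apply: ler_pM; rewrite ?normc_ge0 ?hl1 ?hl2//.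
apply: le_trans (le_normcD _ _) _; rewrite !normcM [leRHS]mulrDl; apply: lerD.
  by rewrite mulrAC ler_wpM2r ?h1.
by rewrite -mulrA ler_wpM2l ?h2.
Qed.

Lemma diffable_sum n (g : 'M[C]_n) I (r : seq I) (P : pred I) f :
  (forall i, diffable g (f i)) -> diffable g (fun h => \sum_(i <- r | P i) f i h).
Proof.
move=> hf; elim: r => [|i r IH].
  by under eq_fun do rewrite big_nil; exact: diffable_cst.
under eq_fun do rewrite big_cons.
by case: (P i) => //; apply: diffableD.
Qed.

Lemma diffable_prod n (g : 'M[C]_n) I (r : seq I) (P : pred I) f :
  (forall i, diffable g (f i)) -> diffable g (fun h => \prod_(i <- r | P i) f i h).
Proof.
move=> hf; elim: r => [|i r IH].
  by under eq_fun do rewrite big_nil; exact: diffable_cst.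
under eq_fun do rewrite big_cons.
by case: (P i) => //; apply: diffableM.
Qed.

Lemma diffableX n (g : 'M[C]_n) f k : diffable g f -> diffable g (fun h => f h ^+ k).
Proof.
move=> hf; elim: k => [|k IH]; first by under eq_fun do rewrite expr0; exact: diffable_cst.
by under eq_fun do rewrite exprS; exact: diffableM.
Qed.

Lemma diffable_eval n (g : 'M[C]_n) (p : mpoly.mpoly (n * n) C) : diffable g (eval_entries p).
Proof.
have -> : eval_entries p = (fun h =>
    \sum_(m <- mpoly.msupp p) mpoly.mcoeff m p * \prod_(i < n * n) mxvec h 0 i ^+ mpoly.fun_of_multinom m i).
  by apply/funext => h; rewrite /eval_entries mpoly.mevalE.
apply: diffable_sum => m; apply: diffableM; first exact: diffable_cst.
apply: diffable_prod => i; apply: diffableX.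
case/mxvec_indexP: i => i j.
by under eq_fun do rewrite mxvecE; exact: diffable_entry.
Qed.

Lemma diffable_det n (g : 'M[C]_n) : diffable g (fun h => \det h).
Proof.
apply: diffable_sum => s; apply: diffableM; first exact: diffable_cst.
by apply: diffable_prod => i; exact: diffable_entry.
Qed.

Lemma diffable_zero_limit n (g : 'M[C]_n) phi : diffable g phi ->
  (forall e : R, 0 < e -> exists2 h, phi h = 0 & fnorm (h - g) < e) -> phi g = 0.
Proof.
move=> [D /diffq_lip[c c0 hc]] h; apply: eq0_normc; apply/le_anti; rewrite normc_ge0 andbT leNgt.
apply/negP => p0.
have e0 : 0 < Num.min 1 (normc (phi g) / (c + 1)) by rewrite lt_min ltr01 divr_gt0// ltr_wpDl.
have [k pk] := h _ e0; rewrite lt_min => /andP[/ltW k1 k2].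
have := hc k k1; rewrite pk sub0r (_ : normc (- phi g) = normc (phi g)); last first.
  exact: normc_opp.
move: k2; rewrite ltr_pdivlMr ?ltr_wpDl// => k2; apply/negP; rewrite -ltNge.
by apply: le_lt_trans k2; rewrite mulrC ler_wpM2l ?fnorm_ge0// lerDl ler01.
Qed.

End UnitaryGroups.

(** * Algebraic groups: the Hermitian part of the Lie algebra and the polar decomposition *)

Section AlgebraicGroups.
Variables (R : realType) (n : nat) (G : set 'M[R[i]]_n).
Local Notation C := R[i].

Lemma maxcompact_unitary : maxcompact G `<=` [set g | g \is unitarymx].
Proof. by move=> g []. Qed.

Lemma maxcompact_group : matrix_group G -> matrix_group (maxcompact G).
Proof.
move=> [GU G1 GM GV]; split.
- by move=> g [/GU].
- by split=> //; apply: unitaryI; rewrite adjmx1 mulmx1.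
- move=> g h [Gg ug] [Gh uh]; split; [exact: GM|exact: mul_unitarymx].
- move=> g [Gg ug]; split; first exact: GV.
  by rewrite /= (invmx_unitary ug) trmxC_unitary.
Qed.

Lemma zariski_fclosed (g : 'M[C]_n) : zariski_closed G -> g \in unitmx ->
  (forall e : R, 0 < e -> exists2 h, G h & fnorm (h - g) < e) -> G g.
Proof.
move=> [P ->] ug hg; split=> // p Pp; apply: (diffable_zero_limit (diffable_eval g p)).
by move=> e /hg[h [_ hP] he]; exists h => //; exact: hP.
Qed.

Lemma unitary_fclosed (g : 'M[C]_n) :
  (forall e : R, 0 < e -> exists2 h : 'M[C]_n, h \is unitarymx & fnorm (h - g) < e) ->
  g \is unitarymx.
Proof.
move=> hg; apply: unitaryI; apply/eqP; rewrite -subr_eq0; apply/negPn/negP => /fnorm_gt0.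
set d := fnorm _ => d0; have c0 : 0 < fnorm g + 1 by rewrite ltr_wpDl// fnorm_ge0.
have [h uh] := hg _ (divr_gt0 d0 c0); rewrite ltr_pdivlMr//; apply/negP; rewrite -leNgt.
have [h1 _] := unitaryP uh.
have -> : d = fnorm ((h - g) *m g^t* + h *m (h - g)^t*).
  rewrite /d fnormBC; congr fnorm.
  by rewrite adjmxB mulmxBl mulmxBr h1 [RHS]addrC addrA subrK.
apply: le_trans (fnormD _ _) _; rewrite (fnorm_unitaryl _ uh) fnorm_adj mulrDr mulr1 lerD2r.
by apply: le_trans (fnormM _ _) _; rewrite fnorm_adj.
Qed.

Lemma maxcompact_fclosed : zariski_closed G -> fclosed (maxcompact G).
Proof.
move=> zG g hg; have ug : g \is unitarymx.
  by apply: unitary_fclosed => e /hg[h [_ uh] he]; exists h.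
split=> //; apply: zariski_fclosed => //; first exact: unitarymx_unit.
by move=> e /hg[h [Gh _] he]; exists h.
Qed.

(* The tangent space of [pospart G] at the identity, see [ilie_ik]; including the real axis
   spares appealing to Zariski density at each use. *)
Definition ik (X : 'M[C]_n) := X^t* = X /\ forall z, axial z -> G (mexp (z *: X)).

Hypothesis aG : algebraic_group G.

(** The Lie algebra of the compact group gives membership in [G] on the imaginary axis;
    [zariski_specz_imag] extends it to the real one. *)
Lemma ilie_ik : ilie (maxcompact G) = ik.
Proof.
have [_ zG] := aG.
apply/seteqP; split=> X.
  move=> /(ilieP _ maxcompact_unitary)[hX hS]; split=> // z hz.
  have [U [a [hU XE]]] := herm_spectral hX.
  rewrite XE mexp_specz//; apply: zariski_specz_imag => // t.
  rewrite -mexp_specz//; last exact: axialI.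
  by rewrite -XE; have [] := hS t.
move=> [hX hG]; apply/(ilieP _ maxcompact_unitary); split=> // t; split.
  by apply: hG; exact: axialI.
exact: mexp_skew_unitary.
Qed.

Lemma ik_subspace : real_subspace ik.
Proof.
rewrite -ilie_ik; have [gG zG] := aG; apply: ilie_subspace.
- exact: maxcompact_group.
- exact: maxcompact_unitary.
- exact: maxcompact_fclosed.
Qed.

Lemma ik_herm X : ik X -> X^t* = X. Proof. by case. Qed.

Lemma ik_mexp X : ik X -> G (mexp X).
Proof. by move=> [_ /(_ 1)]; rewrite scale1r; apply; exact: (axialR 1). Qed.

Lemma ikZ (a : R) X : ik X -> ik (a%:C *: X).
Proof. by have [_ _ h] := ik_subspace; apply: h. Qed.

Lemma ikN X : ik X -> ik (- X).
Proof. by move=> /(ikZ (-1)); rewrite rmorphN1 scaleN1r. Qed.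

Lemma ikD X Y : ik X -> ik Y -> ik (X + Y).
Proof. by have [_ h _] := ik_subspace; apply: h. Qed.

Lemma pospart_exp X : ik X -> pospart G (mexp X).
Proof. by move=> kX; split; [apply: posdef_mexp; exact: ik_herm|exact: ik_mexp]. Qed.

(** The natural powers of [x] lie in [G], so by [zariski_specz_real] the whole complex one-parameter
    group of its logarithm does. *)
Lemma pospart_log x : pospart G x -> exists2 X, ik X & x = mexp X.
Proof.
move=> [px Gx]; have [X hX xE] := posdef_log px; exists X => //.
split=> // z hz; have [U [a [hU XE]]] := herm_spectral hX.
have [gG zG] := aG.
rewrite XE mexp_specz//; apply: zariski_specz_real => // m.
have -> : (m%:R : C) = (m%:R : R)%:C by rewrite rmorph_nat.
rewrite -mexp_specz//; last exact: axialR.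
rewrite -XE; suff -> : mexp ((m%:R : R)%:C *: X) = x ^+ m by exact: matrix_groupX.
elim: m => [|m IH]; first by rewrite scale0r mexp0 mxexpr0.
by rewrite mxexprS -IH xE -{2}[X]scale1r -(rmorph1 (real_complex R)) -mexp_hermM// nat1r.
Qed.

(** [e^X] is the positive square root of [g^* g]; it lies in [G] because the logarithm of [g^* g] is
    in [ik] and may be halved there. The quotient [k] is then unitary. *)
Lemma polar (g : 'M[C]_n) : (forall h, G h -> G (h^t*)) -> G g ->
  exists k X, [/\ maxcompact G k, ik X & g = k *m mexp X].
Proof.
move=> hadj Gg; have [[GU G1 GM GV] zG] := aG.
have pg : pospart G (g^t* *m g).
  by split; [apply: posdef_gram; exact: GU|apply: GM => //; exact: hadj].
have [Y kY YE] := pospart_log pg.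
have kX := ikZ (2^-1) kY; set X := _ *: Y in kX; have hX := ik_herm kX.
have XX : mexp X *m mexp X = mexp Y by apply: mexp_half; exact: ik_herm.
have hE : (mexp (- X))^t* = mexp (- X).
  by apply: mexp_herm_adj; rewrite adjmxN hX.
have NX : mexp (- X) *m mexp X = 1%:M.
  by have := @mexp_hermN _ _ (- X); rewrite opprK; apply; rewrite adjmxN hX.
exists (g *m mexp (- X)), X; split=> //; last by rewrite -mulmxA NX mulmx1.
split; first by apply: GM => //; apply: ik_mexp; exact: ikN.
rewrite /= -trmxC_unitary; apply: unitaryI; rewrite trmxCK adjmxM hE.
rewrite -mulmxA (mulmxA (g^t*)) YE -XX -mulmxA mexp_hermN// mulmx1 NX//.
Qed.

Lemma ik_conj k X : maxcompact G k -> ik X -> ik (k *m X *m k^t*).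
Proof.
move=> [Gk uk] [hX hG]; have [[GU G1 GM GV] zG] := aG.
split=> [|z hz]; first by rewrite !adjmxM trmxCK hX mulmxA.
rewrite scalemxAl scalemxAr mexp_conjU//; apply: (GM); first by apply: (GM) => //; exact: hG.
by rewrite -(invmx_unitary uk); exact: GV.
Qed.

End AlgebraicGroups.

(** * Compactness in matrix spaces *)

Section MatrixCompactness.
Variable R : realType.
Local Notation C := R[i].

(** Image of a product of real segments under the continuous map that assembles real and imaginary
    parts. *)
Lemma compact_box m n (c : R) : compact [set M : 'M[C]_(m, n) |
  forall i j, (`|complex.Re (M i j)| <= c) && (`|complex.Im (M i j)| <= c)].
Proof.
pose A := [set v : 'rV[R]_(m * n + m * n) | forall i, `[- c, c]%classic (v ord0 i)].
have cA : compact A.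
  exact: (@rV_compact _ _ (fun=> `[- c, c]%classic) (fun=> @segment_compact _ _ _)).
pose F (v : 'rV[R]_(m * n + m * n)) : 'M[C]_(m, n) := \matrix_(i, j)
  (v ord0 (lshift _ (mxvec_index i j)) +i* v ord0 (rshift _ (mxvec_index i j)))%C.
have cF : continuous F.
  move=> v; apply: (cvg_entriesP (F := nbhs v) (f := F)
    (a := fun i j => v ord0 (lshift _ (mxvec_index i j)))
    (b := fun i j => v ord0 (rshift _ (mxvec_index i j)))) => i j.
    have -> : (fun x => complex.Re (F x i j)) = (fun x : 'rV[R]_(m * n + m * n) => x ord0 (lshift _ (mxvec_index i j))).
      by apply/funext => x; rewrite mxE.
    exact: coord_continuous.
  have -> : (fun x => complex.Im (F x i j)) = (fun x : 'rV[R]_(m * n + m * n) => x ord0 (rshift _ (mxvec_index i j))).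
    by apply/funext => x; rewrite mxE.
  exact: coord_continuous.
suff -> : [set M : 'M[C]_(m, n) |
  forall i j, (`|complex.Re (M i j)| <= c) && (`|complex.Im (M i j)| <= c)] = F @` A.
  by apply: continuous_compact cA; exact: continuous_subspaceT.
apply/seteqP; split=> [M hM|_ [v vA <-] i j]; last first.
  have := vA (lshift _ (mxvec_index i j)); have := vA (rshift _ (mxvec_index i j)).
  by rewrite /= !in_itv /= mxE /= !ler_norml => -> ->.
exists (row_mx (map_mx (@complex.Re R) (mxvec M)) (map_mx (@complex.Im R) (mxvec M))).
  move=> k; rewrite /= in_itv /= -ler_norml -(splitK k); case: (fintype.split k) => l /=.
    by rewrite row_mxEl mxE; case/mxvec_indexP: l => i j; rewrite mxvecE; have /andP[] := hM i j.
  by rewrite row_mxEr mxE; case/mxvec_indexP: l => i j; rewrite mxvecE; have /andP[] := hM i j.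
apply/matrixP => i j; rewrite mxE row_mxEl row_mxEr !mxE !mxvecE; by case: (M i j).
Qed.

Lemma fnorm_box m n (M : 'M[C]_(m, n)) c : fnorm M <= c ->
  forall i j, (`|complex.Re (M i j)| <= c) && (`|complex.Im (M i j)| <= c).
Proof.
move=> hM i j; rewrite (le_trans (Re_le_normc _)) ?(le_trans (Im_le_normc _))//;
  exact: le_trans (normc_le_fnorm _ _ _) hM.
Qed.

Lemma cluster_seq m n (f : nat -> 'M[C]_(m, n)) c : (forall k, fnorm (f k) <= c) ->
  exists g, forall (e : R) N, 0 < e -> exists2 k, (N <= k)%N & fnorm (f k - g) < e.
Proof.
move=> hf; have [|g [_ hg]] := @compact_box m n c (f @ \oo) _.
  by exists 0%N => // k _; exact: fnorm_box.
exists g => e N e0.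
have hA : nbhs (f @ \oo) (f @` [set k | (N <= k)%N]).
  by exists N => // k Nk; exists k.
have hB : nbhs g [set M | fnorm (M - g) < e] by apply/nbhs_fnormP; exists e.
by have [_ [[k Nk <-] hk]] := hg _ _ hA hB; exists k.
Qed.

Lemma fclosed_compact n (S : set 'M[C]_n) c : fclosed S -> (forall M, S M -> fnorm M <= c) ->
  compact S.
Proof.
move=> cS bS; apply: (subclosed_compact _ (@compact_box n n c)); last first.
  by move=> M /bS; exact: fnorm_box.
move=> M cM; apply: cS => e e0.
have hB : nbhs M [set N | fnorm (N - M) < e] by apply/nbhs_fnormP; exists e.
by have [N [SN hN]] := cM _ hB; exists N.
Qed.

Lemma compact_fclosed n (S : set 'M[C]_n) : compact S -> fclosed S.
Proof.
move=> cS g hg.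
have /choice[f hf] : forall k : nat, exists h, S h /\ fnorm (h - g) < 2 ^- k.
  by move=> k; have [|h Sh hh] := hg (2 ^- k); [rewrite invr_gt0 exprn_gt0|exists h].
have [|p [Sp hp]] := cS (f @ \oo) _; first by exists 0%N => // k _; have [] := hf k.
suff -> : g = p by [].
apply/eqP; rewrite -subr_eq0; apply/negPn/negP => /fnorm_gt0 d0; set d := fnorm _ in d0.
have d2 : 0 < d / 2 by rewrite divr_gt0.
have hA : nbhs (f @ \oo) [set M | fnorm (M - g) < d / 2].
  have fg : f @ \oo --> g.
    apply/cvg_fnorm0P; apply: (@squeeze_cvgr _ _ _ _ (cst 0) (fun k => 2 ^- k)).
    - by apply: nearW => k; rewrite fnorm_ge0 ltW//; have [] := hf k.
    - exact: cvg_cst.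
    - have -> : (fun k : nat => 2 ^- k : R) = (fun k => (2^-1) ^+ k) by apply/funext => k; rewrite exprVn.
      by apply: cvg_expr; rewrite ger0_norm// invf_lt1// ltr1n.
  by apply: fg; apply/nbhs_fnormP; exists (d / 2).
have hB : nbhs p [set M | fnorm (M - p) < d / 2] by apply/nbhs_fnormP; exists (d / 2).
have [M [h1 h2]] := hp _ _ hA hB.
have : d <= fnorm (M - p) + fnorm (M - g).
  have -> : d = fnorm (M - p - (M - g)) by congr fnorm; apply/matrixP => i j; rewrite !mxE; ring.
  exact: fnormB.
move: h1 h2 => /=; lra.
Qed.

Lemma fnorm_unitary_le n (g : 'M[C]_n) : g \is unitarymx -> fnorm g <= fnorm (1%:M : 'M[C]_n).
Proof. by move=> ug; rewrite -[g]mulmx1 (fnorm_unitaryl _ ug). Qed.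

End MatrixCompactness.

(** * Conjugating a Lie algebra element into a commutant *)

Section ConjugateIntoCommutant.
Variables (R : realType) (n : nat).
Local Notation C := R[i].
Implicit Types (S T : set 'M[C]_n).

Lemma o2_mexpi (X : 'M[C]_n) : o2 (fun t => mexp (('i%C * t%:C) *: X)) 1%:M ('i%C *: X).
Proof. exact: tay2_mexpi. Qed.

Lemma o2_conj (X Y : 'M[C]_n) : X^t* = X ->
  o2 (fun t => mexp (('i%C * t%:C) *: X) *m Y *m (mexp (('i%C * t%:C) *: X))^t*) Y
    ('i%C *: (X *m Y - Y *m X)).
Proof.
move=> hX; have := o2M (o2M (o2_mexpi X) (o2_cst Y)) (o2_adj (o2_mexpi X)).
rewrite adjmx1 mulmx1 mul1mx mulmx0 addr0 mulmx1 adjmxZ hX.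
have -> : ('i%C : C)^*%C = - 'i%C by apply/eqP; rewrite eq_complex /= oppr0 !eqxx.
by rewrite -scalemxAl -scalemxAr scaleNr scalerBr.
Qed.

Lemma ilie_sub_herm S X : S `<=` [set g | g \is unitarymx] -> ilie S X -> X^t* = X.
Proof. by move=> uS /(ilieP _ uS)[]. Qed.

Lemma ilie_mexp S X (t : R) : S `<=` [set g | g \is unitarymx] -> ilie S X ->
  S (mexp (('i%C * t%:C) *: X)).
Proof. by move=> uS /(ilieP _ uS)[]. Qed.

Lemma ilie_conj S k X : matrix_group S -> S `<=` [set g | g \is unitarymx] -> S k ->
  ilie S X -> ilie S (k *m X *m k^t*).
Proof.
move=> [_ S1 SM SV] uS Sk /(ilieP _ uS)[hX hS]; have uk := uS _ Sk.
apply/(ilieP _ uS); split=> [|t]; first by rewrite !adjmxM trmxCK hX mulmxA.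
rewrite scalemxAl scalemxAr mexp_conjU//; apply: (SM); first by apply: (SM) => //; exact: hS.
by rewrite -(invmx_unitary uk); exact: SV.
Qed.

(** The bracket is the derivative at 0 of the conjugates [e^(itX) Y e^(-itX)], which stay in the
    closed subspace [ilie S]. *)
Lemma ilie_bracket S X Y : matrix_group S -> S `<=` [set g | g \is unitarymx] -> fclosed S ->
  ilie S X -> ilie S Y -> ilie S ('i%C *: (X *m Y - Y *m X)).
Proof.
move=> gS uS cS SX SY; have hX := ilie_sub_herm uS SX.
have hS := ilie_subspace gS uS cS.
have [c c0 hc] := o2_conj Y hX.
apply: (real_subspace_closed hS) => e e0.
pose t := Num.min 1 (e / (c + 1)).
have t0 : 0 < t by rewrite lt_min ltr01 divr_gt0// ltr_wpDl.
have t1 : `|t| <= 1 by rewrite gtr0_norm// ge_min lexx.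
pose Q := mexp (('i%C * t%:C) *: X) *m Y *m (mexp (('i%C * t%:C) *: X))^t*.
exists ((t^-1)%:C *: (Q - Y)).
  have [_ _ SZ] := hS; apply: SZ; apply: real_subspaceB => //.
  by apply: ilie_conj => //; exact: ilie_mexp.
have -> : (t^-1)%:C *: (Q - Y) - 'i%C *: (X *m Y - Y *m X) =
    (t^-1)%:C *: (Q - Y - t%:C *: ('i%C *: (X *m Y - Y *m X))).
  rewrite [RHS]scalerBr; congr (_ - _); rewrite [RHS]scalerA -(rmorphM (real_complex R)).
  by rewrite mulVf ?gt_eqF// rmorph1 scale1r.
rewrite fnormZr gtr0_norm ?invr_gt0//.
apply: (@le_lt_trans _ _ (c * t)).
  by rewrite mulrC ler_pdivrMr// -mulrA -expr2 hc.
apply: (@le_lt_trans _ _ (c * (e / (c + 1)))).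
  by rewrite ler_wpM2l// ge_min lexx orbT.
by rewrite mulrA ltr_pdivrMr ?ltr_wpDl// mulrC ltr_pM2l// ltrDl.
Qed.

(** A cluster point of a maximizing sequence is a maximizer, since the functional is Lipschitz on
    unitary matrices. *)
Lemma maximize_on_group S (X H : 'M[C]_n) : matrix_group S ->
  S `<=` [set g | g \is unitarymx] -> fclosed S ->
  exists2 k, S k & forall h, S h -> fdot (h *m X *m h^t*) H <= fdot (k *m X *m k^t*) H.
Proof.
move=> [_ S1 SM SV] uS cS.
pose phi k := fdot (k *m X *m k^t*) H.
pose A := [set phi h | h in S].
have ubA : has_ubound A.
  exists (fnorm X * fnorm H) => _ [h Sh <-].
  apply: le_trans (ler_norm _) _; apply: le_trans (fdot_le _ _) _.
  have uh := uS _ Sh; have uh' : h^t* \is unitarymx by rewrite trmxC_unitary.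
  by rewrite (fnorm_unitaryr _ uh') (fnorm_unitaryl _ uh).
have supA : has_sup A by split=> //; exists (phi 1%:M), 1%:M.
have /choice[f hf] : forall j : nat, exists h, S h /\ sup A - 2 ^- j < phi h.
  move=> j; have [|_ [h Sh <-] hh] := @sup_adherent _ A (2 ^- j) _ supA.
    by rewrite invr_gt0 exprn_gt0.
  by exists h.
have [|k hk] := @cluster_seq R n n f (fnorm (1%:M : 'M[C]_n)).
  by move=> j; apply: fnorm_unitary_le; apply: uS; have [] := hf j.
have Sk : S k.
  apply: cS => e e0; have [j _ hj] := hk e 0%N e0; exists (f j) => //; by have [] := hf j.
exists k => // h Sh.
have hsup : phi h <= sup A by apply: ub_le_sup => //; exists h.
apply: le_trans hsup _; rewrite -/(phi k).
have philip g : S g -> `|phi g - phi k| <= 2 * fnorm X * fnorm H * fnorm (g - k).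
  move=> Sg; have ug := uS _ Sg; have uk := uS _ Sk.
  have uk' : k^t* \is unitarymx by rewrite trmxC_unitary.
  rewrite /phi -fdotBl; apply: le_trans (fdot_le _ _) _.
  have -> : g *m X *m g^t* - k *m X *m k^t* = g *m (X *m (g - k)^t*) + (g - k) *m X *m k^t*.
    by rewrite adjmxB !mulmxBr !mulmxBl !mulmxA addrA subrK.
  rewrite mulrAC ler_wpM2r ?fnorm_ge0//; apply: le_trans (fnormD _ _) _.
  rewrite (fnorm_unitaryl _ ug) (fnorm_unitaryr _ uk').
  have h1 := fnormM X ((g - k)^t*); have h2 := fnormM (g - k) X; rewrite fnorm_adj in h1.
  move: h1 h2; rewrite (mulrC (fnorm (g - k))); lra.
set B := 2 * fnorm X * fnorm H in philip.
have B0 : 0 <= B by rewrite !mulr_ge0 ?fnorm_ge0.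
apply: (@le_limit_pow2 _ _ _ (B + 1)) => j.
have p0 : 0 < (2 ^- j : R) by rewrite invr_gt0 exprn_gt0.
have [l jl hl] := hk _ j p0; have [Sl hfl] := hf l.
have hl2 : (2 ^- l : R) <= 2 ^- j by rewrite lef_pV2 ?posrE ?exprn_gt0// ler_eXn2l// ltr1n.
have h3 : phi (f l) - phi k <= B * 2 ^- j.
  apply: le_trans (ler_norm _) _; apply: le_trans (philip _ Sl) _.
  by rewrite ler_wpM2l// ltW.
rewrite mulrDl mul1r; move: h3 hl2 hfl; lra.
Qed.

Lemma trace_bracket (a : C) (Y Z H : 'M[C]_n) :
  \tr (a *: (Z *m Y - Y *m Z) *m H) = \tr (Z *m (a *: (Y *m H - H *m Y))).
Proof.
have trB (A B : 'M[C]_n) : \tr (A - B) = \tr A - \tr B by exact: raddfB.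
rewrite -scalemxAl -scalemxAr !mxtraceZ mulmxBl mulmxBr !trB; congr (_ * (_ - _)).
  by rewrite mulmxA.
by rewrite -mulmxA mxtrace_mulC mulmxA.
Qed.

(* At a maximizer [k] of [fdot (k X k^-1) H] the derivative in the direction
   [Z = i [Y, H]], where [Y = k X k^-1], is [fnorm Z ^+ 2]. *)
Lemma conj_commute S (X H : 'M[C]_n) : matrix_group S ->
  S `<=` [set g | g \is unitarymx] -> fclosed S -> ilie S X -> ilie S H ->
  exists2 k, S k & k *m X *m k^t* *m H = H *m (k *m X *m k^t*).
Proof.
move=> gS uS cS SX SH; have [_ S1 SM SV] := gS.
have [k Sk kmax] := maximize_on_group X H gS uS cS; exists k => //.
set Y := k *m X *m k^t*.
have SY : ilie S Y by exact: ilie_conj.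
have hY := ilie_sub_herm uS SY; have hH := ilie_sub_herm uS SH.
pose Z := 'i%C *: (Y *m H - H *m Y).
have SZ : ilie S Z by exact: ilie_bracket.
have hZ := ilie_sub_herm uS SZ.
have [c c0 hc] := o2_conj Y hZ.
have ZZ : fdot ('i%C *: (Z *m Y - Y *m Z)) H = fnorm Z ^+ 2.
  by rewrite fnorm_sqr fdot.unlock hH hZ trace_bracket.
have key : fnorm Z ^+ 2 <= 0.
  apply: (@le_limit_pow2 _ _ _ (c * fnorm H)) => j.
  have s0 : 0 < (2 ^- j : R) by rewrite invr_gt0 exprn_gt0.
  have s1 : `|2 ^- j : R| <= 1 by rewrite gtr0_norm// invf_le1 ?exprn_gt0// exprn_ege1// ler1n.
  set s := (2 ^- j : R) in s0 s1 *.
  pose E := mexp (('i%C * s%:C) *: Z).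
  have := kmax (E *m k) (SM _ _ (ilie_mexp _ uS SZ) Sk).
  rewrite adjmxM -/Y.
  have -> : E *m k *m X *m (k^t* *m E^t*) = E *m Y *m E^t* by rewrite /Y !mulmxA.
  have := hc s s1; rewrite -/E; set W := E *m Y *m E^t* => h1 h2.
  have h3 : fdot (s%:C *: ('i%C *: (Z *m Y - Y *m Z))) H <= fnorm (W - Y - s%:C *: ('i%C *: (Z *m Y - Y *m Z))) * fnorm H.
    have := le_trans (ler_norm _) (fdot_le (- (W - Y - s%:C *: ('i%C *: (Z *m Y - Y *m Z)))) H).
    by rewrite fnormN fdotNl !fdotBl; move: h2; lra.
  rewrite fdotZl ZZ in h3.
  rewrite add0r -(ler_pM2l s0); apply: le_trans h3 _.
  apply: le_trans (ler_wpM2r (fnorm_ge0 _) h1) _.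
  by rewrite le_eqVlt; apply/orP; left; apply/eqP; rewrite -/s expr2; ring.
have Z0 : Z = 0.
  apply: fnorm_eq0; apply/eqP; rewrite -sqrf_eq0; apply/eqP/le_anti.
  by rewrite key sqr_ge0.
move/eqP: Z0; rewrite /Z scaler_eq0 => /orP[|]; last by rewrite subr_eq0 => /eqP.
by rewrite eq_complex /= oner_eq0 andbF.
Qed.

(** Once [X] commutes with [e], the later conjugations are taken in the centralizer [S'] of [e] and
    so preserve this; the members of [s] commute with each other and hence belong to [ilie S']. *)
Lemma conj_commute_seq S (X : 'M[C]_n) (s : seq 'M[C]_n) : matrix_group S ->
  S `<=` [set g | g \is unitarymx] -> fclosed S -> ilie S X ->
  (forall e, e \in s -> ilie S e) ->
  (forall e f, e \in s -> f \in s -> e *m f = f *m e) ->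
  exists2 k, S k & forall e, e \in s -> k *m X *m k^t* *m e = e *m (k *m X *m k^t*).
Proof.
elim: s S X => [|e s IH] S X gS uS cS SX Ss comm.
  by exists 1%:M; [case: gS|].
have [_ S1 SM SV] := gS.
have Se : ilie S e by apply: Ss; rewrite mem_head.
have [k Sk kX] := conj_commute gS uS cS SX Se.
pose S' := S `&` [set g | g *m e = e *m g].
have uS' : S' `<=` [set g | g \is unitarymx] by move=> g [/uS].
have gS' : matrix_group S'.
  split=> [g [Sg _]||g h [Sg ge] [Sh he]|g [Sg ge]].
  - by apply: unitarymx_unit; exact: uS.
  - by split; [exact: S1|rewrite /= mul1mx mulmx1].
  - by split; [exact: SM|rewrite /= -mulmxA he mulmxA ge mulmxA].
  - split; first exact: SV.
    have ug : g \in unitmx by apply: unitarymx_unit; exact: uS.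
    by rewrite /=; apply: (can_inj (mulKmx ug)); rewrite mulKVmx// !mulmxA ge mulmxK.
have cS' : fclosed S'.
  move=> g hg; split; first by apply: cS => d /hg[h [Sh _] hh]; exists h.
  apply/eqP; rewrite -subr_eq0; apply/negPn/negP => /fnorm_gt0; set d := fnorm _ => d0.
  have e0 : 0 < 2 * fnorm e + 1 by rewrite ltr_wpDl// mulr_ge0 ?fnorm_ge0.
  have [h [Sh he]] := hg _ (divr_gt0 d0 e0); rewrite ltr_pdivlMr//; apply/negP; rewrite -leNgt.
  have -> : d = fnorm ((h - g) *m e - e *m (h - g)).
    by rewrite /d fnormBC; congr fnorm; rewrite mulmxBl mulmxBr he [RHS]addrC opprB addrA subrK.
  apply: le_trans (fnormB _ _) _.
  have h1 := fnormM (h - g) e; have h2 := fnormM e (h - g).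
  have := fnorm_ge0 (h - g); move: h1 h2; rewrite (mulrC (fnorm e)); lra.
have mem' Y : ilie S Y -> Y *m e = e *m Y -> ilie S' Y.
  move=> /(ilieP _ uS)[hY YS] Ye; apply/(ilieP _ uS'); split=> // t; split; first exact: YS.
  by apply: mexp_intertwine; rewrite -scalemxAl -scalemxAr Ye.
have [|||k' [Sk' k'e] hk'] := IH S' (k *m X *m k^t*) gS' uS' cS' _ _ _.
- by apply: mem' => //; exact: ilie_conj.
- move=> f fs; apply: mem'; first by apply: Ss; rewrite inE fs orbT.
  by apply: comm; rewrite inE ?fs ?eqxx ?orbT.
- by move=> f g fs gs; apply: comm; rewrite inE ?fs ?gs orbT.
exists (k' *m k) => [|f]; first exact: SM.
have -> : k' *m k *m X *m (k' *m k)^t* = k' *m (k *m X *m k^t*) *m k'^t* by rewrite adjmxM !mulmxA.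
rewrite inE => /orP[/eqP->|]; last exact: hk'.
have k'e' : k'^t* *m e = e *m k'^t*.
  have uk := uS _ Sk'; rewrite -(invmx_unitary uk); have u := unitarymx_unit uk.
  by apply: (can_inj (mulKmx u)); rewrite mulKVmx// !mulmxA k'e mulmxK.
by rewrite -mulmxA k'e' mulmxA -(mulmxA k') kX mulmxA k'e -!mulmxA.
Qed.

End ConjugateIntoCommutant.

(** * Logarithms of unitary matrices and maximal tori *)

Section UnitaryLog.
Variables (R : realType) (n : nat).
Local Notation C := R[i].

Lemma unitary_spectral (g : 'M[C]_n) : g \is unitarymx ->
  exists U : 'M[C]_n, exists q : 'I_n -> C, U \is unitarymx /\ g = U *m dgc q *m U^t*.
Proof.
move=> ug; have [g1 g2] := unitaryP ug.
have /orthomx_spectralP : g \is normalmx by apply/normalmxP; rewrite g1 g2.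
have hP := spectral_unitarymx g; rewrite (invmx_unitary hP) => hE.
exists ((spectralmx g)^t*), (fun i => spectral_diag g 0 i); split.
  by rewrite trmxC_unitary.
rewrite trmxCK {1}hE; congr (_ *m _ *m _); congr diag_mx; apply/rowP => i.
by rewrite [RHS]mxE.
Qed.

(** The argument of a complex number of modulus 1 in the right half plane, see [arg_near1K]. *)
Definition arg_near1 (q : C) : R := asin (complex.Im q).

Lemma arg_near1K (q : C) : normc q = 1 -> 0 <= complex.Re q ->
  cexp ('i%C * (arg_near1 q)%:C) = q.
Proof.
case: q => a b /= ab a0; have {}ab : a ^+ 2 + b ^+ 2 = 1.
  by rewrite -[LHS]sqr_sqrtr ?addr_ge0 ?sqr_ge0// ab expr1n.
have hb : -1 <= b <= 1.
  by rewrite -ler_norml -(@expr_le1 _ 2)// real_normK ?num_real// -ab lerDr sqr_ge0.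
rewrite cexp_imag /arg_near1 /= asinK ?in_itv// cos_asin//; congr (_ +i* _)%C.
by rewrite -ab addrK sqrtr_sqr ger0_norm.
Qed.

Lemma arg_near1_small (e : R) : 0 < e -> exists2 d : R, 0 < d <= 1 &
  forall q : C, normc (q - 1) < d -> 0 <= complex.Re q /\ `|arg_near1 q| < e.
Proof.
move=> e0; have h0 : -1 < (0 : R) < 1 by rewrite ltr01 ltrN10.
have /cvgrPdist_lt/(_ e e0) := continuous_asin h0.
have -> : asin 0 = 0 :> R.
  by rewrite -{1}(@sin0 R) sinK// in_itv/= oppr_le0 andbb divr_ge0// pi_ge0.
move=> /nbhs_ballP[d /= d0 hd]; exists (Num.min d 1) => [|q].
  by rewrite lt_min d0 ltr01 ge_min lexx orbT.
rewrite lt_min => /andP[qd q1]; split.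
  have := le_lt_trans (Re_le_normc _) q1.
  by case: q {qd q1} => a b /=; rewrite ltr_norml => /andP[]; lra.
have := hd (complex.Im q); rewrite sub0r normrN; apply; rewrite /ball /= sub0r normrN.
apply: le_lt_trans qd; have := Im_le_normc (q - 1).
by case: q {q1} => a b /=; rewrite oppr0 addr0.
Qed.

Lemma conjU_commute (U A B : 'M[C]_n) : U \is unitarymx -> A *m B = B *m A ->
  (U *m A *m U^t*) *m (U *m B *m U^t*) = (U *m B *m U^t*) *m (U *m A *m U^t*).
Proof.
move=> hU AB; have [_ u2] := unitaryP hU.
have aux M N : (U *m M *m U^t*) *m (U *m N *m U^t*) = U *m (M *m N) *m U^t*.
  by rewrite -!mulmxA (mulmxA (U^t*)) u2 mul1mx.
by rewrite !aux AB.
Qed.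

(** The logarithm is taken eigenvalue by eigenvalue, with equal values at equal eigenvalues; hence
    it commutes with everything that commutes with [g]. *)
Lemma unitary_log (e : R) : 0 < e -> exists2 d : R, 0 < d & forall g : 'M[C]_n,
  g \is unitarymx -> fnorm (g - 1%:M) < d -> exists A : 'M[C]_n,
    [/\ A^t* = A, g = mexp ('i%C *: A), fnorm A < e &
      forall B, g *m B = B *m g -> A *m B = B *m A].
Proof.
move=> e0; have e1 : 0 < e / (n.+1)%:R by rewrite divr_gt0.
have [d /andP[d0 d1] hd] := arg_near1_small e1; exists d => // g ug gd.
have [U [q [hU gE]]] := unitary_spectral ug; have [u1 u2] := unitaryP hU.
have hU' : U^t* \is unitarymx by rewrite trmxC_unitary.
have qE : dgc q = U^t* *m g *m U.
  by rewrite gE !mulmxA u2 mul1mx -mulmxA u2 mulmx1.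
have qd i : normc (q i - 1) < d.
  apply: le_lt_trans gd; rewrite -(fnorm_conjU _ hU).
  have -> : U^t* *m (g - 1%:M) *m U = dgc q - 1%:M.
    by rewrite qE mulmxBr mulmx1 mulmxBl u2.
  by apply: le_trans (normc_le_fnorm _ i i); rewrite !mxE eqxx !mulr1n.
have qn i : normc (q i) = 1.
  have uq : dgc q \is unitarymx by rewrite qE; exact: mul_unitarymx (mul_unitarymx hU' ug) hU.
  have [+ _] := unitaryP uq.
  rewrite dgc_adj dgcM => /matrixP/(_ i i); rewrite dgcE mxE eqxx !mulr1n mul_conj_normc => h.
  have /eqP := congr1 (@complex.Re R) h; rewrite /= sqrf_eq1 => /orP[/eqP//|/eqP h'].
  by have := normc_ge0 (q i); rewrite h' ler0N1.
pose A := U *m dg (fun i => arg_near1 (q i)) *m U^t*.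
exists A; split.
- by rewrite /A !adjmxM trmxCK dg_adj mulmxA.
- have ai : axial ('i%C : C) by rewrite -[X in axial X]mulr1; exact: (axialI 1).
  rewrite mexp_spectral//.
  rewrite gE; congr (_ *m dgc _ *m _); apply/funext => i.
  by rewrite arg_near1K//; have [] := hd _ (qd i).
- have -> : fnorm A = fnorm (dg (fun i => arg_near1 (q i))) by exact: fnorm_spec.
  apply: le_lt_trans (_ : n%:R * (e / n.+1%:R) < e).
    apply: le_trans (fnorm_le_sum _) _; rewrite mulr_natl -[X in _ *+ X](card_ord n) -sumr_const.
    apply: ler_sum => i _; rewrite (bigD1 i)//= big1 ?addr0 => [|j ji].
      by rewrite dgE dgcE eqxx normcR; have [_ /ltW] := hd _ (qd i).
    by rewrite dgE dgcE eq_sym (negPf ji) mulr0n normc0.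
  by rewrite mulrCA gtr_pMr// ltr_pdivrMr// mul1r ltr_nat.
- move=> B gB; rewrite /A.
  pose D := U^t* *m B *m U.
  have BE : B = U *m D *m U^t* by rewrite /D !mulmxA u1 mul1mx -mulmxA u1 mulmx1.
  have qD : dgc q *m D = D *m dgc q.
    rewrite qE /D -!mulmxA !(mulmxA U) u1 !mul1mx (mulmxA g) gB.
    by rewrite -!mulmxA.
  have tD : dg (fun i => arg_near1 (q i)) *m D = D *m dg (fun i => arg_near1 (q i)).
    rewrite dgE; apply/matrixP => i j; rewrite mul_dgcl mul_dgcr.
    have := congr1 (fun M : 'M[C]_n => M i j) qD; rewrite mul_dgcl mul_dgcr.
    have [->|D0] := eqVneq (D i j) 0; first by move=> _; rewrite !mulr0 !mul0r.
    by rewrite ![_ * D i j]mulrC => /(mulfI D0) ->.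
  by rewrite BE; exact: conjU_commute.
Qed.

(** The product of the two commuting groups is a one-parameter unitary group with derivative
    [i (X + Y)], so [one_param_unitary] identifies it. *)
Lemma mexpiD (X Y : 'M[C]_n) (t : R) : X^t* = X -> Y^t* = Y -> X *m Y = Y *m X ->
  mexp (('i%C * t%:C) *: (X + Y)) = mexp (('i%C * t%:C) *: X) *m mexp (('i%C * t%:C) *: Y).
Proof.
move=> hX hY XY; pose f s := mexp (('i%C * s%:C) *: X) *m mexp (('i%C * s%:C) *: Y).
have := @one_param_unitary R n f (X + Y); rewrite /f => <- //.
- by move=> s; apply: mul_unitarymx; exact: mexp_skew_unitary.
- move=> s u; rewrite !mexp_hermMi// !mulmxA; congr (_ *m _); rewrite -!mulmxA; congr (_ *m _).
  apply: mexp_intertwine; rewrite -scalemxAl; apply/esym.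
  rewrite -scalemxAr; congr (_ *: _); apply: mexp_intertwine.
  by rewrite -scalemxAl -scalemxAr XY.
- by rewrite adjmxD hX hY.
- by rewrite scalerDr; apply: tay2M; exact: tay2_mexpi.
Qed.

Lemma mexpi_commute (X B : 'M[C]_n) :
  (forall t : R, mexp (('i%C * t%:C) *: X) *m B = B *m mexp (('i%C * t%:C) *: X)) ->
  X *m B = B *m X.
Proof.
move=> h; have h1 := o2M (tay2_mexpi X) (o2_cst B); have h2 := o2M (o2_cst B) (tay2_mexpi X).
rewrite mul1mx in h1; rewrite mulmx1 in h2; have := o2_unique (o2_ext h h1) h2.
rewrite !mulmx0 !mul0mx addr0 add0r -scalemxAl -scalemxAr => /(scalerI _); apply.
by rewrite eq_complex /= oner_eq0 andbF.
Qed.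

Lemma mexpi_nat (X : 'M[C]_n) k : X^t* = X -> mexp ('i%C *: X) ^+ k = mexp (('i%C * k%:R%:C) *: X).
Proof.
by move=> hX; have := mexp_hermXi 1 k hX; rewrite mulr1 mulr1.
Qed.

Lemma mexpiN (X : 'M[C]_n) : X^t* = X -> mexp ('i%C *: (- X)) = invmx (mexp ('i%C *: X)).
Proof.
move=> hX; have u := mexp_skew_unitary 1 hX; rewrite mulr1 in u.
apply: (can_inj (mulKmx (unitarymx_unit u))); rewrite mulmxV ?unitarymx_unit//.
have := mexp_hermMi 1 (-1) hX; rewrite subrr mulr0 scale0r mexp0 mulr1 => ->.
by rewrite rmorphN1 mulrN1 scaleNr scalerN.
Qed.

Lemma mexp_continuous_line (z : C) (X : 'M[C]_n) : continuous (fun t : R => mexp ((z * t%:C) *: X)).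
Proof.
move=> t; apply/cvg_fnormP => e e0.
pose c := normc z * fnorm X; have c0 : 0 <= c by rewrite mulr_ge0 ?normc_ge0 ?fnorm_ge0.
have zX (s : R) : fnorm ((z * s%:C) *: X) = `|s| * c.
  by rewrite fnormZ (Normc.normcM) normcR /c; ring.
pose b := expR ((`|t| + 1) * c) * c.
have b0 : 0 < b + 1 by rewrite ltr_wpDl// mulr_ge0// expR_ge0.
have : \forall s \near t, `|t - s| < Num.min 1 (e / (b + 1)).
  by apply/nbhs_ballP; exists (Num.min 1 (e / (b + 1))) => //=; rewrite lt_min ltr01 divr_gt0.
apply: filterS => s; rewrite lt_min distrC => /andP[s1 se].
have sb : `|s| <= `|t| + 1.
  by rewrite -(subrK t s) addrC; apply: le_trans (ler_normD _ _) _; rewrite lerD2l ltW.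
apply: le_lt_trans (mexp_lip (c := (`|t| + 1) * c) _ _) _.
- by rewrite zX ler_wpM2r.
- by rewrite zX ler_wpM2r// lerDl.
rewrite -scalerBl -mulrBr -rmorphB zX.
have -> : expR ((`|t| + 1) * c) * (`|s - t| * c) = `|s - t| * b by rewrite /b mulrCA.
rewrite ltr_pdivlMr// in se; apply: le_lt_trans se.
by rewrite ler_wpM2l// lerDl.
Qed.

Definition commutative_in (T : set 'M[C]_n) := forall g h, T g -> T h -> g *m h = h *m g.

Lemma ilie_commute T X Y : T `<=` [set g | g \is unitarymx] -> commutative_in T ->
  ilie T X -> ilie T Y -> X *m Y = Y *m X.
Proof.
move=> uT cT TX TY; apply: mexpi_commute => t; apply/esym; apply: mexpi_commute => s.
by apply: cT; exact: ilie_mexp.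
Qed.

Lemma pow2_small (e : R) : 0 < e -> exists N, forall j, (N <= j)%N -> 2 ^- j < e.
Proof.
move=> e0; apply: contrapT => h; have : e <= 0; last by rewrite leNgt e0.
apply: (@le_limit_pow2 _ _ _ 1) => N; rewrite add0r mul1r leNgt; apply/negP => hN.
apply: h; exists N => j Nj; apply: le_lt_trans hN.
by rewrite lef_pV2 ?posrE ?exprn_gt0// ler_eXn2l// ltr1n.
Qed.

(* Otherwise [T] has elements [e^(iY)], [Y != 0], with [Y] arbitrarily small and orthogonal to
   [ilie T]; a limit direction of the [Y] would lie in [ilie T]. *)
Lemma torus_near1 T : matrix_group T -> T `<=` [set g | g \is unitarymx] -> fclosed T ->
  commutative_in T -> exists2 d : R, 0 < d & forall g, T g -> fnorm (g - 1%:M) < d ->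
  exists2 X, ilie T X & g = mexp ('i%C *: X).
Proof.
move=> gT uT clT cT; have [_ T1 TM TV] := gT; have hT := ilie_subspace gT uT clT.
apply: contrapT => hno.
have [k [e [[eT eo] eX]]] := orthonormal_basis hT.
have /choice[Y hY] : forall j : nat, exists Y, [/\ Y^t* = Y, Y != 0, fnorm Y < 2 ^- j,
    T (mexp ('i%C *: Y)) & forall e, ilie T e -> fdot Y e = 0].
  move=> j; have p0 : 0 < (2 ^- j : R) by rewrite invr_gt0 exprn_gt0.
  have p0' : 0 < (2 ^- j : R) / 2 by rewrite divr_gt0.
  have [d d0 hd] := unitary_log p0'.
  apply: contrapT => hY; apply: hno; exists d => // g Tg gd.
  have [A [hA gE Aj cA]] := hd g (uT _ Tg) gd.
  (* The projection of the logarithm [A] on [ilie T]. The rest [A - X] commutes with it, is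
     orthogonal to [ilie T], and is again the logarithm of an element of [T]; its norm is at most
     twice that of [A], hence below [2^-j]. *)
  pose X := \sum_i (fdot A (e i))%:C *: e i.
  have TX : ilie T X by apply: real_subspace_sum => // i; have [_ _] := hT; apply.
  have hX := ilie_sub_herm uT TX.
  have hAX Z : ilie T Z -> fdot (A - X) Z = 0.
    move=> TZ; rewrite (eX Z TZ) fdot_sumr big1// => i _.
    rewrite fdotZr fdotBl /X fdot_suml (bigD1 i)//= big1 ?addr0 => [|l li].
      by rewrite fdotZl eo eqxx mulr1 subrr mulr0.
    by rewrite fdotZl eo (negPf li) mulr0.
  have AX : A *m X = X *m A.
    apply/esym/mexpi_commute => t; apply/esym/cA; apply: cT => //; exact: ilie_mexp.
  exists X => //; apply: contrapT => gX; apply: hY; exists (A - X); split.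
  - by rewrite adjmxB hA hX.
  - by apply/eqP => h; apply: gX; rewrite gE -[A](subrK X) h add0r.
  - have X2 : fnorm X <= fnorm A.
      apply: ge0_le_cancel; rewrite ?fnorm_ge0// fnorm_sqr.
      have -> : fdot X X = fdot A X by apply/eqP; rewrite -subr_eq0 -opprB oppr_eq0 -fdotBl hAX.
      by apply: le_trans (ler_norm _) _; rewrite mulrC; exact: fdot_le.
    by apply: le_lt_trans (fnormB _ _) _; move: X2 Aj; lra.
  - have hNX : (- X)^t* = - X by rewrite adjmxN hX.
    have := mexpiD 1 hA hNX; rewrite mulr1 => ->; last by rewrite mulmxN mulNmx AX.
    rewrite -gE mexpiN//; apply: (TM) => //; apply: (TV).
    by have := ilie_mexp 1 uT TX; rewrite mulr1.
  - exact: hAX.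
pose W j := (fnorm (Y j))^-1%:C *: Y j.
have Y0 j : 0 < fnorm (Y j) by have [_ /fnorm_gt0] := hY j.
have W1 j : fnorm (W j) = 1 by rewrite fnormZr gtr0_norm ?invr_gt0// mulVf ?gt_eqF.
have YW j : Y j = (fnorm (Y j))%:C *: W j.
  by rewrite scalerA -(rmorphM (real_complex R)) mulfV ?gt_eqF// rmorph1 scale1r.
have [|Z hZ] := @cluster_seq R n n W 1; first by move=> j; rewrite W1.
have Z1 : fnorm Z = 1.
  apply/eqP; rewrite -subr_eq0 -normr_eq0; apply/negPn/negP => h.
  have d0 : 0 < `|fnorm Z - 1| by rewrite lt_neqAle eq_sym h normr_ge0.
  have [j _ hj] := hZ _ 0%N d0.
  have h1 := fnormD (W j - Z) Z; rewrite subrK W1 in h1.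
  have h2 := fnormB (W j) (W j - Z); rewrite opprB addrC subrK W1 in h2.
  by move: hj; rewrite ltr_normr => /orP[]; move: h1 h2; lra.
have herZ : Z^t* = Z.
  apply/eqP; rewrite -subr_eq0; apply/negPn/negP => /fnorm_gt0; set d := fnorm _ => d0.
  have [j _ hj] := hZ (d / 2) 0%N (divr_gt0 d0 (ltr0Sn _ 1)).
  have [hYj _ _ _ _] := hY j.
  have hWj : (W j)^t* = W j by rewrite /W adjmxZr hYj.
  have : d <= fnorm (W j - Z) + fnorm (W j - Z).
    have -> : d = fnorm ((W j - Z) - (W j - Z)^t*).
      by rewrite /d adjmxB hWj; congr fnorm; apply/matrixP => a b; rewrite !mxE; ring.
    by apply: le_trans (fnormB _ _) _; rewrite fnorm_adj.
  by move: hj; lra.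
(* [e^(itZ)] is approximated by the power of [e^(i Y_j)] whose exponent is the integer part of
   [t / fnorm (Y j)]. *)
have Tpos (t : R) : 0 <= t -> T (mexp (('i%C * t%:C) *: Z)).
  move=> t0; apply: clT => d d0.
  pose q := d / 2 / expR t / (t + 1).
  have t1 : 0 < t + 1 by rewrite ltr_wpDl.
  have q0 : 0 < q by rewrite !divr_gt0// expR_gt0.
  have [N hN] := pow2_small q0; have [j jN hj] := hZ q N q0.
  have [hYj _ Yj TYj _] := hY j; have yq := lt_trans Yj (hN j jN).
  set y := fnorm (Y j) in yq; have y0 : 0 < y := Y0 j.
  pose m := Num.truncn (t / y).
  have /andP[m1 m2] : m%:R * y <= t < m.+1%:R * y.
    rewrite -ler_pdivlMr// -ltr_pdivrMr// truncn_itv// divr_ge0//; exact: ltW.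
  exists (mexp ('i%C *: Y j) ^+ m); first exact: matrix_groupX.
  have inorm (a : R) (X : 'M[C]_n) : fnorm (('i%C * a%:C) *: X) = fnorm (a%:C *: X).
    by rewrite -scalerA fnormZ /= expr0n add0r expr1n sqrtr1 mul1r.
  rewrite mexpi_nat//; apply: le_lt_trans (mexp_lip (c := t) _ _) _.
  - by rewrite inorm fnormZr ger0_norm.
  - by rewrite inorm fnormZr ger0_norm// Z1 mulr1.
  have -> : ('i%C * m%:R%:C) *: Y j - ('i%C * t%:C) *: Z =
      ('i%C * 1%:C) *: ((m%:R * y - t)%:C *: W j + t%:C *: (W j - Z)).
    rewrite mulr1 -!scalerA -scalerBr; congr (_ *: _).
    rewrite {1}YW -/y scalerA -rmorphM rmorphB scalerBl scalerBr.
    by rewrite addrA subrK.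
  rewrite inorm scale1r; apply: le_lt_trans (_ : expR t * (q * (t + 1)) < d); last first.
    have -> : expR t * (q * (t + 1)) = d / 2.
      by rewrite /q; field; rewrite !gt_eqF// expR_gt0.
    by rewrite ltr_pdivrMr// mulr_natr mulr2n ltrDl.
  rewrite ler_wpM2l ?expR_ge0//; apply: le_trans (fnormD _ _) _.
  rewrite (fnormZr _ (W j)) (fnormZr _ (_ - Z)) W1 mulr1 (ger0_norm t0) mulrDr mulr1 addrC mulrC; apply: lerD.
    by rewrite ler_wpM2r// ltW.
  by rewrite ler0_norm ?subr_le0//; move: m1 m2 yq; rewrite -natr1 mulrDl mul1r; lra.
have TZ : ilie T Z.
  apply/(ilieP _ uT); split=> // t; have [t0|t0] := leP 0 t; first exact: Tpos.
  have hZt : ((- t)%:C *: Z)^t* = (- t)%:C *: Z by rewrite adjmxZr herZ.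
  have := mexpiN hZt; rewrite scalerA -scaleNr -rmorphN opprK scalerA => ->.
  by apply: (TV); apply: Tpos; rewrite oppr_ge0 ltW.
(* The unit vector [Z] of [ilie T] is a limit of vectors orthogonal to [ilie T]; one of them at
   distance less than 1 gives the contradiction. *)
have [j _ hj] := hZ 1 0%N ltr01; have [_ _ _ _ hYZ] := hY j.
have : fnorm Z ^+ 2 < 1.
  apply: le_lt_trans hj; have -> : fnorm Z ^+ 2 = - fdot (W j - Z) Z.
    by rewrite fdotBl fdotZl hYZ// mulr0 sub0r opprK fnorm_sqr.
  by rewrite -[leRHS]mulr1 -Z1 -fdotNl; apply: le_trans (ler_norm _) _; rewrite -[fnorm (_ - _)]fnormN; exact: fdot_le.
by rewrite Z1 expr1n ltxx.
Qed.

Lemma ball_open (g : 'M[C]_n) (e : R) : open [set h | fnorm (h - g) < e].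
Proof.
rewrite openE => h /= he; apply/nbhs_fnormP; exists (e - fnorm (h - g)); first by rewrite subr_gt0.
move=> k hk /=; rewrite -(subrK h k) -addrA; apply: le_lt_trans (fnormD _ _) _.
by rewrite -ltrBrDr.
Qed.

(** The image of the exponential is closed under products by [mexpiD] and contains a neighbourhood
    of 1 in [T] by [torus_near1]; so it is open and closed in the connected [T]. *)
Lemma torus_exp T : matrix_group T -> T `<=` [set g | g \is unitarymx] -> fclosed T ->
  commutative_in T -> connected T -> forall g, T g -> exists2 X, ilie T X & g = mexp ('i%C *: X).
Proof.
move=> gT uT clT cT conT; have [_ T1 TM TV] := gT; have hT := ilie_subspace gT uT clT.
have [d d0 hd] := torus_near1 gT uT clT cT.
pose B := [set g | exists2 X, ilie T X & g = mexp ('i%C *: X)].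
have BT : B `<=` T.
  by move=> _ [X TX ->]; have := ilie_mexp 1 uT TX; rewrite mulr1.
have BM g h : B g -> B h -> B (g *m h).
  move=> [X TX ->] [Y TY ->]; exists (X + Y); first by have [_ + _] := hT; apply.
  have := mexpiD 1 (ilie_sub_herm uT TX) (ilie_sub_herm uT TY) (ilie_commute uT cT TX TY).
  by rewrite mulr1 => ->.
have near g h : T g -> T h -> B g -> fnorm (h - g) < d -> B h.
  move=> Tg Th Bg hg; have ug := uT _ Tg; have [g1 g2] := unitaryP ug.
  have -> : h = h *m g^t* *m g by rewrite -mulmxA g2 mulmx1.
  apply: BM => //; apply: hd; first by apply: (TM) => //; rewrite -(invmx_unitary ug); exact: TV.
  have ug' : g^t* \is unitarymx by rewrite trmxC_unitary.
  by rewrite -g1 -mulmxBl (fnorm_unitaryr _ ug').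
suff BTE : B = T by move=> g; rewrite -{1}BTE.
apply: conT.
- by exists 1%:M; exists 0; [case: hT|rewrite scaler0 mexp0].
- exists (\bigcup_(g in B) [set h | fnorm (h - g) < d]).
    by apply: bigcup_open => g _; exact: ball_open.
  apply/seteqP; split=> [g Bg|h [Th [g Bg hg]]].
    by split; [exact: BT|exists g => //=; rewrite subrr fnorm0].
  by apply: (near g h) => //; exact: BT.
exists (~` \bigcup_(g in T `\` B) [set h | fnorm (h - g) < d]).
  by apply: open_closedC; apply: bigcup_open => g _; exact: ball_open.
apply/seteqP; split=> [h Bh|h [Th hC]].
  split; first exact: BT.
  move=> [g [Tg nBg] /= hg]; apply: nBg; apply: (near h g) => //; first exact: BT.
  by rewrite fnormBC.
by apply: contrapT => nBh; apply: hC; exists h => //=; rewrite subrr fnorm0.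
Qed.

Lemma closureP_fnorm (A : set 'M[C]_n) g :
  closure A g <-> forall e : R, 0 < e -> exists2 h, A h & fnorm (h - g) < e.
Proof.
split=> [cA e e0|hA B /nbhs_fnormP[e e0 eB]].
  have hB : nbhs g [set h | fnorm (h - g) < e] by apply/nbhs_fnormP; exists e.
  by have [h [Ah he]] := cA _ hB; exists h.
by have [h Ah he] := hA e e0; exists h; split=> //; exact: eB.
Qed.

Lemma closure_fclosed (A : set 'M[C]_n) : fclosed (closure A).
Proof.
move=> g hg; apply/closureP_fnorm => e e0; have e2 : 0 < e / 2 by rewrite divr_gt0.
have [h /closureP_fnorm/(_ _ e2)[k Ak kh] hh] := hg _ e2; exists k => //.
by rewrite -(subrK h k) -addrA (splitr e); apply: le_lt_trans (fnormD _ _) _; exact: ltrD.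
Qed.

Section Maximality.
Variables (K : set 'M[C]_n) (gK : matrix_group K) (uK : K `<=` [set g | g \is unitarymx])
  (clK : fclosed K).

(** The closure provides compactness, as the exponentials of a subspace may wind densely in a larger
    torus; connectedness comes from the lines through 1. *)
Lemma exp_torus (S : set 'M[C]_n) : real_subspace S -> S `<=` ilie K ->
  (forall X Y, S X -> S Y -> X *m Y = Y *m X) ->
  torus_in (closure [set mexp ('i%C *: X) | X in S]) K.
Proof.
move=> [S0 SD SZ] SK Scomm; set A := [set _ | _ in S].
have [_ K1 KM KV] := gK.
have hS X : S X -> X^t* = X by move=> /SK; exact: ilie_sub_herm.
have AK : A `<=` K by move=> _ [X /SK KX <-]; have := ilie_mexp 1 uK KX; rewrite mulr1.
have cAK : closure A `<=` K.
  by move=> g /closureP_fnorm hg; apply: clK => e /hg[h /AK]; exists h.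
have uA g : closure A g -> g \is unitarymx by move=> /cAK /uK.
have A1 : A 1%:M by exists 0 => //; rewrite scaler0 mexp0.
have Ainv g : A g -> A (invmx g).
  move=> [X SX <-]; exists (- X); last by rewrite mexpiN// hS.
  by rewrite -scaleN1r -(rmorphN1 (real_complex R)); exact: SZ.
have close2 g h g' h' : closure A g -> A h -> A h' ->
    fnorm (h *m h' - g *m g') <= fnorm (h - g) + fnorm (h' - g').
  move=> cg Ah Ah'; have uh' := uK (AK _ Ah').
  have -> : h *m h' - g *m g' = (h - g) *m h' + g *m (h' - g').
    by rewrite mulmxBl mulmxBr addrA subrK.
  apply: le_trans (fnormD _ _) _.
  by rewrite (fnorm_unitaryr _ uh') (fnorm_unitaryl _ (uA _ cg)).
split.
- split.
  + by move=> g /cAK; have [+ _ _ _] := gK; apply.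
  + by apply: subset_closure.
  + move=> g g' cg cg'; apply/closureP_fnorm => e e0; have e2 : 0 < e / 2 by rewrite divr_gt0.
    have /closureP_fnorm/(_ _ e2)[h Ah hg] := cg; have /closureP_fnorm/(_ _ e2)[h' Ah' hg'] := cg'.
    exists (h *m h'); last by apply: le_lt_trans (close2 _ _ _ _ cg Ah Ah') _; rewrite (splitr e) ltrD.
    have [[X SX <-] [Y SY <-]] := (Ah, Ah'); exists (X + Y); first exact: SD.
    by have := mexpiD 1 (hS _ SX) (hS _ SY) (Scomm _ _ SX SY); rewrite mulr1.
  + move=> g cg; have ug := uA _ cg; apply/closureP_fnorm => e e0.
    have /closureP_fnorm/(_ _ e0)[h Ah hg] := cg; exists (invmx h); first exact: Ainv.
    by rewrite (invmx_unitary ug) (invmx_unitary (uK (AK _ Ah))) -adjmxB fnorm_adj.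
- exact: cAK.
- apply: (fclosed_compact (c := fnorm (1%:M : 'M[C]_n))); first exact: closure_fclosed.
  by move=> g /uA; exact: fnorm_unitary_le.
- apply: connected_closure.
  have -> : A = \bigcup_(X in S) [set mexp (('i%C * t%:C) *: X) | t in [set: R]].
    apply/seteqP; split=> [_ [X SX <-]|_ [X SX [t _ <-]]].
      by exists X => //; exists 1 => //; rewrite mulr1.
    by exists (t%:C *: X); [exact: SZ|rewrite scalerA].
  apply: bigcup_connected.
    by exists 1%:M => X SX; exists 0 => //; rewrite mulr0 scale0r mexp0.
  move=> X SX; apply: connected_continuous_connected.
    by apply/connected_intervalP.
  by apply: continuous_subspaceT => t; exact: mexp_continuous_line.
- move=> g g' cg cg'; apply/eqP; rewrite -subr_eq0; apply/negPn/negP => /fnorm_gt0.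
  set d := fnorm _ => d0; have d4 : 0 < d / 4 by rewrite divr_gt0.
  have /closureP_fnorm/(_ _ d4)[h Ah hg] := cg; have /closureP_fnorm/(_ _ d4)[h' Ah' hg'] := cg'.
  have hh : h *m h' = h' *m h.
    have [[X SX <-] [Y SY <-]] := (Ah, Ah').
    apply: mexp_intertwine; rewrite -scalemxAl; apply/esym.
    rewrite -scalemxAr; congr (_ *: _); apply: mexp_intertwine.
    by rewrite -scalemxAl -scalemxAr Scomm.
  have h1 := close2 _ _ g' _ cg Ah Ah'; have h2 := close2 _ _ g _ cg' Ah' Ah.
  have : d <= fnorm (h' *m h - g' *m g) + fnorm (h *m h' - g *m g').
    apply: le_trans (fnormB _ _); rewrite hh /d le_eqVlt; apply/orP; left; apply/eqP.
    by congr fnorm; rewrite opprB [RHS]addrC addrA subrK.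
  by move: h1 h2 hg hg'; rewrite -/d; lra.
Qed.

Variables (T : set 'M[C]_n) (mT : maximal_torus T K).

Let uT : T `<=` [set g | g \is unitarymx].
Proof. by have [[_ TK _ _ _] _] := mT; move=> g /TK /uK. Qed.

Lemma torus_fclosed : fclosed T.
Proof. by have [[_ _ cT _ _] _] := mT; exact: compact_fclosed. Qed.

Lemma torus_ilie_subspace : real_subspace (ilie T).
Proof. by have [[gT _ _ _ _] _] := mT; apply: ilie_subspace => //; exact: torus_fclosed. Qed.

Lemma torus_comm X Y : ilie T X -> ilie T Y -> X *m Y = Y *m X.
Proof. by have [[_ _ _ _ cT] _] := mT; exact: ilie_commute. Qed.

Lemma ilie_torus_sub : ilie T `<=` ilie K.
Proof.
have [[_ TK _ _ _] _] := mT => X /(ilieP _ uT)[hX XT]; apply/(ilieP _ uK); split=> // t.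
exact: TK.
Qed.

Lemma pencil_commute (X Y Z : 'M[C]_n) (a b : C) : Y *m Z = Z *m Y -> X *m Y = Y *m X ->
  X *m Z = Z *m X -> (Y + a *: X) *m (Z + b *: X) = (Z + b *: X) *m (Y + a *: X).
Proof.
move=> YZ XY XZ; rewrite mulmxDl !mulmxDr -!scalemxAl -!scalemxAr.
by rewrite !(mulmxDl Z) -!scalemxAl (scalerDr a) YZ XY XZ.
Qed.

(** Adjoining [X] to [ilie T] gives a commutative subspace of [ilie K]; the torus it generates
    contains [T] by [torus_exp], hence equals [T] by maximality. *)
Lemma torus_maximal X : ilie K X -> (forall Y, ilie T Y -> X *m Y = Y *m X) -> ilie T X.
Proof.
move=> KX comX; have [[gT TK _ conT cT] maxT] := mT.
have [T0 TD TZ] := torus_ilie_subspace.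
have [K0 KD KZ] := ilie_subspace gK uK clK.
pose S := [set Y + a%:C *: X | Y in ilie T & a in [set: R]].
have hS : real_subspace S.
  split.
  - by exists 0 => //; exists 0 => //; rewrite scale0r addr0.
  - move=> _ _ [Y TY [a _ <-]] [Z TZ' [b _ <-]]; exists (Y + Z); first exact: TD.
    by exists (a + b) => //; rewrite rmorphD scalerDl addrACA.
  - move=> c _ [Y TY [a _ <-]]; exists (c%:C *: Y); first exact: TZ.
    by exists (c * a) => //; rewrite rmorphM scalerDr scalerA.
have tor : torus_in (closure [set mexp ('i%C *: Y) | Y in S]) K.
  apply: exp_torus => // [_ [Y TY [a _ <-]]|_ _ [Y TY [a _ <-]] [Z TZ' [b _ <-]]].
    by apply: KD; [exact: ilie_torus_sub|exact: KZ].
  exact: pencil_commute (torus_comm TY TZ') (comX _ TY) (comX _ TZ').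
have TS : T `<=` closure [set mexp ('i%C *: Y) | Y in S].
  move=> g /(torus_exp gT uT torus_fclosed cT conT)[Y TY ->]; apply: subset_closure.
  by exists Y => //; exists Y => //; exists 0 => //; rewrite scale0r addr0.
apply/(ilieP _ uT); split=> [|t]; first exact: ilie_sub_herm KX.
rewrite -(maxT _ tor TS); apply: subset_closure; exists (t%:C *: X); last by rewrite scalerA.
by exists 0 => //; exists t => //; rewrite add0r.
Qed.

(** [X] is conjugated into the commutant of a basis of [ilie T], and that commutant within [ilie K]
    is [ilie T] by [torus_maximal]. *)
Lemma torus_conj X : ilie K X -> exists2 k, K k & ilie T (k *m X *m k^t*).
Proof.
move=> KX; have [m [e [[eT _] eX]]] := orthonormal_basis torus_ilie_subspace.
have [||k Kk hk] := @conj_commute_seq R n K X (codom e) gK uK clK KX _ _.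
- by move=> _ /codomP[i ->]; exact: ilie_torus_sub.
- by move=> _ _ /codomP[i ->] /codomP[j ->]; exact: torus_comm.
exists k => //; apply: torus_maximal; first exact: ilie_conj.
move=> Y TY; rewrite (eX Y TY) mulmx_suml mulmx_sumr; apply: eq_bigr => i _.
by rewrite -scalemxAr -scalemxAl hk// codom_f.
Qed.

End Maximality.
End UnitaryLog.

(** * Rational matrix representations and their differential *)

Section MatrixRepresentations.
Variables (R : realType) (n N : nat).
Local Notation C := R[i].

(* The increment is only controlled in the ball [c * fnorm (h - 1) <= 1], so that a single
   constant can be enlarged at will. *)
Lemma quotient_derivative (S : set 'M[C]_n) phi p d : diffable 1%:M p -> diffable 1%:M d ->
  d 1%:M = 1 -> S 1%:M -> (forall h, S h -> phi h * d h = p h) ->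
  exists (D : 'M[C]_n -> C) (c : R), [/\ 0 <= c, forall X Y, D (X + Y) = D X + D Y,
    forall a X, D (a *: X) = a * D X & forall h, S h -> c * fnorm (h - 1%:M) <= 1 ->
    normc (phi h - phi 1%:M - D (h - 1%:M)) <= c * fnorm (h - 1%:M) ^+ 2].
Proof.
move=> [Dp Hp] [Dd Hd] d1 S1 hphi.
have [l l0 hl] := diffq_lip Hd.
have [c1 [c10 DpD DpZ Dpb] h1] := Hp; have [c2 [c20 DdD DdZ Ddb] h2] := Hd.
have p1 : p 1%:M = phi 1%:M by rewrite -hphi// d1 mulr1.
pose K := normc (phi 1%:M); have K0 : 0 <= K by exact: normc_ge0.
(* The quotient rule at 1, where the denominator equals 1. *)
pose D X := Dp X - phi 1%:M * Dd X.
pose b := c1 + K * c2; have b0 : 0 <= b by rewrite addr_ge0// mulr_ge0.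
have Db X : normc (D X) <= b * fnorm X.
  apply: le_trans (normcB_le _ _) _; rewrite Normc.normcM mulrDl -mulrA.
  by apply: lerD => //; rewrite ler_wpM2l.
(* The summand [2 l] keeps [|d h|] above 1/2 on the ball, so that dividing by it costs a factor 2;
   the last summand is twice the error of the numerator. *)
exists D, (1 + 2 * l + 2 * (b + b * l)); split.
- by rewrite !addr_ge0 ?mulr_ge0// addr_ge0// mulr_ge0.
- by move=> X Y; rewrite /D DpD DdD; ring.
- by move=> a X; rewrite /D DpZ DdZ; ring.
move=> h Sh; set r := fnorm _ => hr; have r0 : 0 <= r by exact: fnorm_ge0.
have bl0 : 0 <= b * l by exact: mulr_ge0.
have lr0 : 0 <= l * r by exact: mulr_ge0.
have br0 : 0 <= b * r by exact: mulr_ge0.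
have blr0 : 0 <= b * l * r by exact: mulr_ge0.
have {}hr : r + 2 * (l * r) + 2 * (b * r + b * l * r) <= 1.
  by apply: le_trans hr; rewrite le_eqVlt; apply/orP; left; apply/eqP; ring.
have r1 : r <= 1 by move: hr; lra.
have lr : l * r <= 1 / 2 by move: hr; lra.
have dh := hl h r1; rewrite d1 -/r in dh.
have dh2 : 1 / 2 <= normc (d h).
  have := normcB_le (d h) (d h - 1); rewrite subKr.
  by rewrite normc1; move: dh lr; lra.
set E := phi h - _ - _.
have EE : E * d h = (p h - p 1%:M - Dp (h - 1%:M)) - phi 1%:M * (d h - d 1%:M - Dd (h - 1%:M))
    - D (h - 1%:M) * (d h - 1).
  by rewrite /E /D d1 p1 -hphi//; ring.
have hE : normc E * normc (d h) <= (b + b * l) * r ^+ 2.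
  rewrite -Normc.normcM EE; apply: le_trans (normcB_le _ _) _; rewrite (mulrDl b); apply: lerD.
    apply: le_trans (normcB_le _ _) _; rewrite Normc.normcM (mulrDl c1) -(mulrA K).
    by apply: lerD; [exact: h1|rewrite ler_wpM2l// h2].
  rewrite Normc.normcM.
  have -> : b * l * r ^+ 2 = (b * r) * (l * r) by rewrite expr2; ring.
  by apply: ler_pM => //; exact: normc_ge0.
have E0 := normc_ge0 E.
have : normc E * (1 / 2) <= (b + b * l) * r ^+ 2.
  by apply: le_trans hE; rewrite ler_wpM2l.
have : 0 <= (1 + 2 * l) * r ^+ 2 by rewrite mulr_ge0 ?sqr_ge0// addr_ge0// mulr_ge0.
rewrite [X in _ -> _ -> _ <= X]mulrDl; lra.
Qed.

Definition regular_on (G : set 'M[C]_n) (phi : 'M[C]_n -> C) :=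
  exists p k, forall g, G g -> phi g = eval_entries p g / \det g ^+ k.

Definition matrix_rep (G : set 'M[C]_n) (rho : 'M[C]_n -> 'M[C]_N) :=
  [/\ rho 1%:M = 1%:M, forall g h, G g -> G h -> rho (g *m h) = rho g *m rho h,
    forall i j, regular_on G (fun g => rho g i j) &
    forall k, maxcompact G k -> rho k \is unitarymx].

Section Fixed.
Variables (G : set 'M[C]_n) (rho : 'M[C]_n -> 'M[C]_N).
Hypotheses (aG : algebraic_group G) (hadj : forall h, G h -> G (h^t*)) (hrho : matrix_rep G rho).

Let G1 : G 1%:M. Proof. by have [[_ + _ _] _] := aG. Qed.
Let Gu g : G g -> g \in unitmx. Proof. by have [[+ _ _ _] _] := aG; apply. Qed.
Let GM g h : G g -> G h -> G (g *m h). Proof. by have [[_ _ + _] _] := aG; apply. Qed.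
Let GV g : G g -> G (invmx g). Proof. by have [[_ _ _ +] _] := aG; apply. Qed.

Lemma rho_local : exists (D : 'M[C]_n -> 'M[C]_N) (c : R), [/\ 0 <= c,
  forall X Y, D (X + Y) = D X + D Y, forall a X, D (a *: X) = a *: D X &
  forall h, G h -> c * fnorm (h - 1%:M) <= 1 ->
    fnorm (rho h - 1%:M - D (h - 1%:M)) <= c * fnorm (h - 1%:M) ^+ 2].
Proof.
have [rho1 _ reg _] := hrho.
have /choice[D hD] : forall ij : 'I_N * 'I_N, exists D : ('M[C]_n -> C) * R,
    [/\ 0 <= D.2, forall X Y, D.1 (X + Y) = D.1 X + D.1 Y,
    forall a X, D.1 (a *: X) = a * D.1 X & forall h, G h -> D.2 * fnorm (h - 1%:M) <= 1 ->
    normc (rho h ij.1 ij.2 - rho 1%:M ij.1 ij.2 - D.1 (h - 1%:M)) <= D.2 * fnorm (h - 1%:M) ^+ 2].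
  move=> [i j]; have [p [k hpk]] := reg i j.
  have [|h Gh|D [c hDc]] := @quotient_derivative G (fun g => rho g i j) (eval_entries p)
    (fun g => \det g ^+ k) (diffable_eval _ p) (diffableX k (@diffable_det R n _)) _ G1 _.
  - by rewrite det1 expr1n.
  - rewrite hpk// divfK// expf_neq0// -unitfE; exact: Gu.
  by exists (D, c).
pose c := \sum_i \sum_j (D (i, j)).2.
have c0 i j : 0 <= (D (i, j)).2 by have [] := hD (i, j).
have cij i j : (D (i, j)).2 <= c.
  rewrite /c (bigD1 i)//= (bigD1 j)//= -addrA lerDl addr_ge0// sumr_ge0// => k _.
  exact: sumr_ge0.
exists (fun X => \matrix_(i, j) (D (i, j)).1 X), c; split.
- by rewrite sumr_ge0// => i _; exact: sumr_ge0.
- by move=> X Y; apply/matrixP => i j; rewrite !mxE; have [_ -> _ _] := hD (i, j).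
- by move=> a X; apply/matrixP => i j; rewrite !mxE; have [_ _ -> _] := hD (i, j).
move=> h Gh hc; apply: le_trans (fnorm_le_sum _) _; rewrite mulr_suml.
apply: ler_sum => i _; rewrite mulr_suml; apply: ler_sum => j _.
have [_ _ _ /(_ h Gh)] := hD (i, j); rewrite rho1 !mxE; apply.
by apply: le_trans hc; rewrite ler_wpM2r ?fnorm_ge0.
Qed.

(** A complex linear derivative of the entries at 1, defined on all matrices; on [ik] it is the
    differential of [rho] in the sense of [rho_mexp]. *)
Definition drho : 'M[C]_n -> 'M[C]_N := projT1 (cid rho_local).

Lemma drhoD X Y : drho (X + Y) = drho X + drho Y.
Proof. by rewrite /drho; case: cid => D [c []]. Qed.

Lemma drhoZ a X : drho (a *: X) = a *: drho X.
Proof. by rewrite /drho; case: cid => D [c []]. Qed.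

Lemma drho0 : drho 0 = 0.
Proof. by rewrite -(scale0r (0 : 'M[C]_n)) drhoZ scale0r. Qed.

Lemma drhoB X Y : drho (X - Y) = drho X - drho Y.
Proof. by rewrite drhoD -scaleN1r drhoZ scaleN1r. Qed.

Lemma drho_sum I (r : seq I) (F : I -> 'M[C]_n) :
  drho (\sum_(i <- r) F i) = \sum_(i <- r) drho (F i).
Proof. by elim: r => [|i r IH]; rewrite ?big_nil ?drho0// !big_cons drhoD IH. Qed.

Lemma drho_lip : exists2 d : R, 0 <= d & forall X, fnorm (drho X) <= d * fnorm X.
Proof.
exists (\sum_i \sum_j fnorm (drho (delta_mx i j))) => [|X].
  by rewrite sumr_ge0// => i _; rewrite sumr_ge0// => j _; exact: fnorm_ge0.
rewrite {1}(matrix_sum_delta X) drho_sum; apply: le_trans (fnorm_sum _ _ _) _.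
rewrite mulr_suml; apply: ler_sum => i _; rewrite drho_sum mulr_suml.
apply: le_trans (fnorm_sum _ _ _) _; apply: ler_sum => j _; rewrite drhoZ fnormZ mulrC.
by rewrite ler_wpM2l ?fnorm_ge0// normc_le_fnorm.
Qed.

Lemma drho_local : exists2 e : R, 0 <= e & forall h, G h -> e * fnorm (h - 1%:M) <= 1 ->
    fnorm (rho h - 1%:M - drho (h - 1%:M)) <= e * fnorm (h - 1%:M) ^+ 2.
Proof. by rewrite /drho; case: cid => D [e []] /=; exists e. Qed.

(** The expansion must hold up to [|t| = 1], beyond the ball of [drho_local]. Outside that ball
    [e b |t| > 1], and since [rho] is unitary on the compact group a constant bound there is also a
    bound by a multiple of [t^2]; this is the second summand of [M]. *)
Lemma tay2_rho (f : R -> 'M[C]_n) A : (forall t, maxcompact G (f t)) -> tay2 f A ->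
  tay2 (fun t => rho (f t)) (drho A).
Proof.
move=> fK [c c0 hc]; have [_ _ _ rhoU] := hrho; have [d d0 hd] := drho_lip.
have [e e0 he] := drho_local.
pose b := c + fnorm A; have b0 : 0 <= b by rewrite addr_ge0 ?fnorm_ge0.
pose U := fnorm (1%:M : 'M[C]_N); have U0 : 0 <= U by exact: fnorm_ge0.
pose M := (e * b ^+ 2 + d * c) + (U + U + fnorm (drho A)) * (e * b) ^+ 2.
have M1 : 0 <= e * b ^+ 2 + d * c by exact: addr_ge0 (mulr_ge0 e0 (sqr_ge0 _)) (mulr_ge0 d0 c0).
have M2 : 0 <= (U + U + fnorm (drho A)) * (e * b) ^+ 2.
  by rewrite mulr_ge0 ?sqr_ge0// !addr_ge0// fnorm_ge0.
exists M => [|t t1]; first by rewrite addr_ge0.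
have [Gf uf] := fK t; have h1 := hc t t1.
have fb : fnorm (f t - 1%:M) <= b * `|t|.
  have -> : f t - 1%:M = (f t - 1%:M - t%:C *: A) + t%:C *: A by rewrite subrK.
  apply: le_trans (fnormD _ _) _; rewrite fnormZr mulrDl (mulrC (fnorm A)) lerD2r.
  apply: le_trans h1 _; rewrite ler_wpM2l// -real_normK ?num_real// expr2 ler_piMl//.
have [small|big] := leP (e * b * `|t|) 1.
  apply: (@le_trans _ _ ((e * b ^+ 2 + d * c) * t ^+ 2)); last first.
    by rewrite ler_wpM2r ?sqr_ge0// lerDl.
  have -> : rho (f t) - 1%:M - t%:C *: drho A =
      (rho (f t) - 1%:M - drho (f t - 1%:M)) + drho (f t - 1%:M - t%:C *: A).
    by rewrite (drhoB (f t - 1%:M)) drhoZ addrA subrK.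
  apply: le_trans (fnormD _ _) _; rewrite mulrDl; apply: lerD.
    apply: le_trans (he _ Gf _) _.
      by apply: le_trans small; rewrite -mulrA ler_wpM2l.
    rewrite -mulrA ler_wpM2l// -(real_normK (num_real t)) -exprMn.
    by rewrite ler_sqr// nnegrE ?fnorm_ge0// mulr_ge0.
  by apply: le_trans (hd _) _; rewrite -mulrA ler_wpM2l.
apply: (@le_trans _ _ ((U + U + fnorm (drho A)) * (e * b) ^+ 2 * t ^+ 2)); last first.
  by rewrite ler_wpM2r ?sqr_ge0// lerDr.
rewrite -mulrA -exprMn -(real_normK (num_real (_ * t))) normrM (ger0_norm (mulr_ge0 e0 b0)).
apply: (@le_trans _ _ (U + U + fnorm (drho A))); last first.
  apply: ler_peMr; first by apply: addr_ge0; [exact: addr_ge0|exact: fnorm_ge0].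
  by rewrite exprn_ege1// ltW.
apply: le_trans (fnormB _ _) _; apply: lerD.
  by apply: le_trans (fnormB _ _) _; rewrite lerD2r; apply: fnorm_unitary_le; exact: rhoU.
by rewrite fnormZr ler_piMl ?fnorm_ge0.
Qed.

Lemma ik_maxcompact X (t : R) : ik G X -> maxcompact G (mexp (('i%C * t%:C) *: X)).
Proof. by move=> [hX hG]; split; [apply: hG; exact: axialI|exact: mexp_skew_unitary]. Qed.

Lemma tay2_rho_mexp X : ik G X -> tay2 (fun t => rho (mexp (('i%C * t%:C) *: X))) ('i%C *: drho X).
Proof.
move=> kX; rewrite -drhoZ; apply: tay2_rho; last exact: tay2_mexpi.
by move=> t; exact: ik_maxcompact.
Qed.

Lemma drho_herm X : ik G X -> (drho X)^t* = drho X.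
Proof.
move=> kX; have [_ _ _ rhoU] := hrho; have h1 := tay2_rho_mexp kX.
have h2 : tay2 (fun t => (rho (mexp (('i%C * t%:C) *: X)))^t*) (('i%C *: drho X)^t*).
  by have := o2_adj h1; rewrite adjmx1.
have h3 : tay2 (fun=> 1%:M) ('i%C *: drho X + ('i%C *: drho X)^t*).
  apply: o2_ext (tay2M h1 h2) => t.
  by have [-> _] := unitaryP (rhoU _ (ik_maxcompact t kX)).
have /eqP := o2_unique h3 (o2_cst 1%:M); rewrite adjmxZ.
have -> : ('i%C : C)^*%C = - 'i%C by apply/eqP; rewrite eq_complex /= oppr0 !eqxx.
rewrite scaleNr -scalerBr scaler_eq0 => /orP[|]; last by rewrite subr_eq0 => /eqP.
by rewrite eq_complex /= oner_eq0 andbF.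
Qed.

Lemma rho_mexpi X (t : R) : ik G X -> rho (mexp (('i%C * t%:C) *: X)) = mexp (('i%C * t%:C) *: drho X).
Proof.
move=> kX; have [_ rhoM _ rhoU] := hrho; have [hX _] := kX.
pose f t := rho (mexp (('i%C * t%:C) *: X)).
have := @one_param_unitary R N f (drho X); rewrite /f => -> //.
- by move=> s; apply: rhoU; exact: ik_maxcompact.
- move=> s u; rewrite mexp_hermMi// rhoM//; first by have [] := ik_maxcompact s kX.
  by have [] := ik_maxcompact u kX.
- exact: drho_herm.
- exact: tay2_rho_mexp.
Qed.

(** At imaginary times the identity comes from [one_param_unitary]. After clearing the denominator
    [det^k] the difference of two entries is an exponential sum, so vanishing on the imaginary axis
    extends to real times. *)
Lemma rho_mexp X (t : R) : ik G X -> rho (mexp (t%:C *: X)) = mexp (t%:C *: drho X).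
Proof.
move=> kX; have [hX kG] := kX; have [_ _ reg _] := hrho.
have [U [a [hU XE]]] := herm_spectral hX.
have [W [b [hW DE]]] := herm_spectral (drho_herm kX).
apply/matrixP => i j; have [p [k hpk]] := reg i j.
have at_R : axial (t%:C : C) by exact: axialR.
rewrite hpk; last exact: kG.
rewrite DE XE !mexp_specz//.
have dU z : \det (specz U a z) ^+ k != 0 by rewrite expf_neq0// -unitfE; exact: specz_unit.
apply: (mulIf (dU t%:C)); rewrite divfK//; apply/eqP; rewrite -subr_eq0; apply/eqP.
pose phi z := eval_entries p (specz U a z) - specz W b z i j * \det (specz U a z) ^+ k.
rewrite -/(phi t%:C); apply: expsum_imag_eq0 => [|s].
  apply: expsumB; first by apply: expsum_eval; exact: expsum_specz.
  apply: expsumM; first exact: expsum_specz.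
  apply: expsumX; apply: (@expsum_ext _ (fun z => cexp (z * (\sum_i a i)%:C))) => [z|].
    by rewrite det_specz.
  exact: expsum_exp.
have ai : axial ('i%C * s%:C : C) by exact: axialI.
have := congr1 (fun M : 'M[C]_N => M i j) (rho_mexpi s kX).
rewrite hpk; last exact: kG.
by rewrite DE XE !mexp_specz// /phi => <-; rewrite divfK ?subrr.
Qed.

Lemma rho_mexp1 X : ik G X -> rho (mexp X) = mexp (drho X).
Proof. by move=> kX; have := rho_mexp 1 kX; rewrite !scale1r. Qed.

Lemma rho_unit g : G g -> rho g \in unitmx.
Proof.
move=> Gg; have [rho1 rhoM _ _] := hrho.
have : rho g *m rho (invmx g) = 1%:M by rewrite -rhoM ?mulmxV ?rho1//; [exact: Gu|exact: GV].
by move/mulmx1_unit => [].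
Qed.

Lemma rho_maxcompact_inv k : maxcompact G k -> rho (k^t*) = (rho k)^t*.
Proof.
move=> Kk; have [Gk uk] := Kk; have [rho1 rhoM _ rhoU] := hrho.
have ur := rhoU _ Kk; rewrite -(invmx_unitary ur).
apply: (can_inj (mulKmx (rho_unit Gk))); rewrite mulmxV ?rho_unit// -rhoM//; last exact: hadj.
by have [-> _] := unitaryP uk.
Qed.

(** By the polar decomposition: [rho] is unitary on the compact factor and Hermitian on the positive
    one. *)
Lemma rho_adj g : G g -> rho (g^t*) = (rho g)^t*.
Proof.
move=> Gg; have [k [X [Kk kX ->]]] := polar aG hadj Gg; have [_ rhoM _ _] := hrho.
have [hX _] := kX; have GX := ik_mexp kX; have [Gk _] := Kk.
rewrite adjmxM -mexp_adj hX !rhoM//; last exact: hadj.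
by rewrite adjmxM rho_maxcompact_inv// rho_mexp1// -mexp_adj drho_herm.
Qed.

Lemma drho_conj k X : maxcompact G k -> ik G X ->
  drho (k *m X *m k^t*) = rho k *m drho X *m (rho k)^t*.
Proof.
move=> Kk kX; have [_ rhoM _ rhoU] := hrho; have [Gk uk] := Kk; have kY := ik_conj aG Kk kX.
apply: mexp_herm_inj; first exact: drho_herm.
  by rewrite !adjmxM trmxCK drho_herm// mulmxA.
have ur := rhoU _ Kk; have GX := ik_mexp kX; have Gk' := hadj Gk.
rewrite -rho_mexp1// (mexp_conjU _ uk) (mexp_conjU _ ur) rhoM//; last exact: GM.
by rewrite rhoM// rho_mexp1// rho_maxcompact_inv.
Qed.

Lemma drho_comm X Y : ik G X -> ik G Y -> X *m Y = Y *m X -> drho X *m drho Y = drho Y *m drho X.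
Proof.
move=> kX kY XY; have [_ rhoM _ _] := hrho; have [hX hY] := (drho_herm kX, drho_herm kY).
apply: (mexp_intertwine_inv hY hY); apply/esym; apply: (mexp_intertwine_inv hX hX).
rewrite -!rho_mexp1// -!rhoM; try exact: ik_mexp.
congr rho; apply/esym; apply: mexp_intertwine; apply/esym; apply: mexp_intertwine; exact: (esym XY).
Qed.

End Fixed.
End MatrixRepresentations.

(** * Weights of a maximal torus and the Hilbert-Mumford criterion *)

Section TorusWeights.
Variables (R : realType) (n N : nat).
Local Notation C := R[i].

(** A Hermitian triangular matrix is diagonal, so a common unitary triangularization already
    diagonalizes. *)
Lemma simultaneous_spectral (s : seq 'M[C]_N) : (forall A, A \in s -> A^t* = A) ->
  {in s &, forall A B, A *m B = B *m A} -> exists2 U : 'M[C]_N, U \is unitarymx &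
  forall A, A \in s -> exists a, A = U *m dg a *m U^t*.
Proof.
move=> hs cs; have [P uP /allP hP] := cotrigonalization cs.
exists (P^t*); first by rewrite trmxC_unitary.
have [p1 p2] := unitaryP uP.
move=> A As; have hA := hs A As.
have /is_trig_mxP tA : is_trig_mx (P *m A *m P^t*).
  by have := hP A As; rewrite /= /similar_to mxred.conjumx ?unitarymx_unit// (invmx_unitary uP).
have hB : (P *m A *m P^t*)^t* = P *m A *m P^t* by rewrite !adjmxM trmxCK hA mulmxA.
move: tA hB; set B := P *m A *m P^t* => tA hB.
have Bij i j : B i j = (B j i)^*%C by rewrite -{1}hB adjmxE.
exists (fun i => complex.Re (B i i)); rewrite trmxCK.
have -> : dg (fun i => complex.Re (B i i)) = B.
  apply/matrixP => i j; rewrite dgE dgcE; have [->|ij] := eqVneq i j.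
    rewrite mulr1n; have := Bij j j; case: (B j j) => x y [] /eqP.
    by rewrite -subr_eq0 opprK -mulr2n mulrn_eq0 => /eqP ->.
  rewrite mulr0n; case: (ltngtP i j) => [lij|lij|/val_inj ijE].
  - by rewrite tA.
  - by rewrite Bij tA// conjc0.
  - by rewrite ijE eqxx in ij.
by rewrite /B -!mulmxA p2 mulmx1 !mulmxA p2 mul1mx.
Qed.

Variables (G : set 'M[C]_n) (rho : 'M[C]_n -> 'M[C]_N).
Hypotheses (aG : algebraic_group G) (hadj : forall h, G h -> G (h^t*)) (hrho : matrix_rep G rho).
Variable (T : set 'M[C]_n).
Hypothesis mT : maximal_torus T (maxcompact G).
Local Notation D := (drho aG hrho).

Let gK : matrix_group (maxcompact G).
Proof. by have [gG _] := aG; exact: maxcompact_group. Qed.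
Let clK : fclosed (maxcompact G).
Proof. by have [_ zG] := aG; exact: maxcompact_fclosed. Qed.
Let uK := @maxcompact_unitary R n G.

Lemma torus_ik X : ilie T X -> ik G X.
Proof. by move=> /(ilie_torus_sub uK mT); rewrite ilie_ik. Qed.

(** The joint eigenvalues on an orthonormal basis of [ilie T], read as coefficients in that basis,
    give the weights as vectors of [ilie T]. *)
Lemma torus_weights : exists (U : 'M[C]_N) (om : 'I_N -> 'M[C]_n),
  [/\ U \is unitarymx, forall a, ilie T (om a) &
    forall H, ilie T H -> D H = U *m dg (fun a => fdot (om a) H) *m U^t*].
Proof.
have hT := torus_ilie_subspace uK mT.
have [m [e [[eT _] eX]]] := orthonormal_basis hT.
have [||U uU hU] := @simultaneous_spectral (codom (fun i => D (e i))).
- by move=> _ /codomP[i ->]; apply: drho_herm; exact: torus_ik.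
- move=> _ _ /codomP[i ->] /codomP[j ->]; apply: (drho_comm aG hrho); try exact: torus_ik.
  exact: (torus_comm uK mT).
have /choice[a ha] : forall i, exists a, D (e i) = U *m dg a *m U^t*.
  by move=> i; apply: hU; exact: codom_f.
exists U, (fun b => \sum_i (a i b)%:C *: e i); split => //.
  by move=> b; apply: real_subspace_sum => // i; have [_ _] := hT; apply.
move=> H TH; rewrite {1}(eX H TH) drho_sum.
have -> : dg (fun b => fdot (\sum_i (a i b)%:C *: e i) H) = \sum_i (fdot H (e i))%:C *: dg (a i).
  apply/matrixP => b c; rewrite dgE dgcE summxE fdot_suml rmorph_sum /= -sumrMnl.
  apply: eq_bigr => i _; rewrite mxE dgE dgcE fdotZl fdotC rmorphM mulrC mulrnAr.
  by [].
rewrite mulmx_sumr mulmx_suml; apply: eq_bigr => i _.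
by rewrite drhoZ ha -scalemxAr -scalemxAl.
Qed.

Lemma ik_torus_conj X : ik G X -> exists2 k, maxcompact G k & ilie T (k *m X *m k^t*).
Proof. by rewrite -(ilie_ik aG); exact: torus_conj. Qed.

Lemma fnorm_dg_mul (a : 'I_N -> R) (c : R) (w : 'cV[C]_N) : (forall i, `|a i| <= c) ->
  fnorm (dg a *m w) <= c * fnorm w.
Proof.
move=> ac; have [N0|] := posnP N.
  have -> : dg a *m w = 0 by apply/matrixP => i; have := ltn_ord i; rewrite {2}N0.
  have -> : w = 0 by apply/matrixP => i; have := ltn_ord i; rewrite {2}N0.
  by rewrite fnorm0 mulr0.
move=> N0; have c0 : 0 <= c by apply: le_trans (ac (Ordinal N0)).
rewrite -ler_sqr ?nnegrE ?mulr_ge0 ?fnorm_ge0// exprMn !fnorm_sqr !fdotXX mulr_sumr.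
apply: ler_sum => i _; rewrite !big_ord1 dgE mul_dgcl Normc.normcM normcR exprMn.
by rewrite ler_wpM2r ?sqr_ge0// ler_sqr ?nnegrE.
Qed.

(** Every [X] in [ik] is conjugate into the torus, where [D X] is diagonal with entries
    [fdot (om a) X]; unitary conjugation preserves all norms involved. The hypothesis ranges over
    all diagonalizations, which leaves the choice of one to the proof. *)
Lemma weight_bound (c : R) : (forall U (om : 'I_N -> 'M[C]_n), U \is unitarymx ->
    (forall a, ilie T (om a)) ->
    (forall H, ilie T H -> D H = U *m dg (fun a => fdot (om a) H) *m U^t*) ->
    forall a, fnorm (om a) <= c) ->
  forall X (w : 'cV[C]_N), ik G X -> fnorm (D X *m w) <= c * fnorm X * fnorm w.
Proof.
move=> hc X w kX; have [U [om [uU omT DU]]] := torus_weights.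
have [k Kk Tk] := ik_torus_conj kX; have := drho_conj aG hadj hrho Kk kX.
have [_ _ _ rhoU] := hrho; have ur := rhoU _ Kk; have [r1 r2] := unitaryP ur.
have uU' : U^t* \is unitarymx by rewrite trmxC_unitary.
have uk := uK Kk; have uk' : k^t* \is unitarymx by rewrite trmxC_unitary.
rewrite DU// => h.
have -> : fnorm (D X *m w) = fnorm (rho k *m (D X *m w)) by rewrite (fnorm_unitaryl _ ur).
have -> : rho k *m (D X *m w) = rho k *m D X *m (rho k)^t* *m (rho k *m w).
  by rewrite -!mulmxA (mulmxA (_^t*)) r2 mul1mx.
rewrite -h -!mulmxA (fnorm_unitaryl _ uU).
apply: le_trans (_ : c * fnorm X * fnorm (U^t* *m (rho k *m w)) <= _); last first.
  by rewrite (fnorm_unitaryl _ uU') (fnorm_unitaryl _ ur).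
apply: fnorm_dg_mul => a; apply: le_trans (fdot_le _ _) _.
rewrite (fnorm_unitaryl _ uk) (fnorm_unitaryr _ uk').
by rewrite ler_wpM2r ?fnorm_ge0//; exact: hc uU omT DU a.
Qed.

(** Multiplying by the unitary [l^*] moves the difference to 1, where [drho_local] applies. *)
Lemma rho_maxcompact_lip : exists2 c : R, 0 <= c & forall k l, maxcompact G k -> maxcompact G l ->
  c * fnorm (k - l) <= 1 -> fnorm (rho k - rho l) <= c * fnorm (k - l).
Proof.
have [e e0 he] := drho_local aG hrho.
have [d d0 hd] := drho_lip aG hrho; have [_ rhoM _ rhoU] := hrho.
exists (e + 1 + d); first by rewrite !addr_ge0.
move=> k l Kk Kl; have [[Gk uk] [Gl ul]] := (Kk, Kl); have [l1 l2] := unitaryP ul.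
have Gl' := hadj Gl; have ul' : l^t* \is unitarymx by rewrite trmxC_unitary.
have [[_ _ GM _] _] := aG; have Gh := GM _ _ Gk Gl'.
have r0 := fnorm_ge0 (k - l); have er0 := mulr_ge0 e0 r0; have dr0 := mulr_ge0 d0 r0.
have rE : fnorm (k *m l^t* - 1%:M) = fnorm (k - l).
  by rewrite -l1 -mulmxBl (fnorm_unitaryr _ ul').
have -> : fnorm (rho k - rho l) = fnorm (rho (k *m l^t*) - 1%:M).
  have [v1 _] := unitaryP (rhoU _ Kl).
  have uv' : (rho l)^t* \is unitarymx by rewrite trmxC_unitary; exact: rhoU.
  by rewrite rhoM// (rho_maxcompact_inv aG hadj hrho Kl) -v1 -mulmxBl (fnorm_unitaryr _ uv').
rewrite !mulrDl mul1r => hr.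
have er1 : e * fnorm (k *m l^t* - 1%:M) <= 1 by rewrite rE; move: hr; lra.
have := he _ Gh er1; have := hd (k *m l^t* - 1%:M); rewrite rE => h1 h2.
have h3 : e * fnorm (k - l) ^+ 2 <= fnorm (k - l).
  by rewrite expr2 mulrA ler_piMl//; move: er1; rewrite rE.
rewrite -(subrK (D (k *m l^t* - 1%:M)) (rho _ - _)); apply: le_trans (fnormD _ _) _.
by move: h1 h2 h3 er0; lra.
Qed.

(** The 1 is the value for an empty index set and keeps the minimum positive. *)
Lemma bigmin1_gt0 (I : finType) (P : pred I) (F : I -> R) : (forall i, P i -> 0 < F i) ->
  0 < \big[Num.min/1]_(i | P i) F i.
Proof. by move=> h; elim/big_ind: _ => [|a b a0 b0|//]; [exact: ltr01|rewrite lt_min a0]. Qed.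

Lemma bigmin1_le (I : finType) (P : pred I) (F : I -> R) i : P i ->
  \big[Num.min/1]_(j | P j) F j <= F i.
Proof. by move=> Pi; rewrite (bigminD1 i)// ge_min lexx. Qed.

(* Write [g_j = k_j' e^(H_j) k_j] with [H_j] in the torus and let [k] be a limit of the [k_j].
   For large [j] every weight occurring in [rho k u] is negative on [H_j], since
   [e^(D H_j) (rho k_j u)] tends to 0. *)
Lemma hilbert_mumford (u : 'cV[C]_N) : (forall e : R, 0 < e -> exists2 g, G g & fnorm (rho g *m u) < e) ->
  exists2 H, ik G H & exists2 c : R, 0 < c & forall t : R, 0 <= t ->
  fdot (rho (mexp (t%:C *: H)) *m u) u <= expR (- (c * t)) * fdot u u.
Proof.
move=> hu; have [U [om [uU omT DU]]] := torus_weights.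
have [_ rhoM _ rhoU] := hrho.
have uU' : U^t* \is unitarymx by rewrite trmxC_unitary.
have [u1 u2] := unitaryP uU.
have /choice[f hf] : forall j : nat, exists kH : 'M[C]_n * 'M[C]_n,
    [/\ maxcompact G kH.1, ilie T kH.2 & fnorm (mexp (D kH.2) *m (rho kH.1 *m u)) < 2 ^- j].
  move=> j; have p0 : 0 < (2 ^- j : R) by rewrite invr_gt0 exprn_gt0.
  have [g Gg gu] := hu _ p0; have [k' [A [Kk' kA gE]]] := polar aG hadj Gg.
  have [k Kk TH] := ik_torus_conj kA; exists (k, k *m A *m k^t*); split=> //=.
  have [Gk uk] := Kk; have [Gk' uk'] := Kk'; have GA := ik_mexp kA.
  have [r1 r2] := unitaryP (rhoU _ Kk).
  have -> : mexp (D (k *m A *m k^t*)) = rho k *m rho (mexp A) *m (rho k)^t*.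
    by rewrite (drho_conj aG hadj hrho Kk kA) (mexp_conjU _ (rhoU _ Kk)) (rho_mexp1 aG hrho kA).
  rewrite -!mulmxA (mulmxA (_^t*)) r2 mul1mx (fnorm_unitaryl _ (rhoU _ Kk)).
  by rewrite -(fnorm_unitaryl _ (rhoU _ Kk')) mulmxA -rhoM// -gE.
have [|k hk] := @cluster_seq R n n (fun j => (f j).1) (fnorm (1%:M : 'M[C]_n)).
  by move=> j; apply: fnorm_unitary_le; apply: uK; have [] := hf j.
have Kk : maxcompact G k.
  by apply: clK => e e0; have [j _ hj] := hk e 0%N e0; exists (f j).1 => //; have [] := hf j.
pose y := U^t* *m (rho k *m u).
pose S := [pred a | y a 0 != 0].
pose m := \big[Num.min/1]_(a | S a) normc (y a 0).
have m0 : 0 < m.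
  apply: bigmin1_gt0 => a ya; rewrite lt_neqAle normc_ge0 andbT eq_sym.
  by apply: contra_neq ya => /eq0_normc.
have mle a : S a -> m <= normc (y a 0).
  by move=> Sa; exact: bigmin1_le.
have [c0' c0'0 hc0] := rho_maxcompact_lip.
have [j hj] : exists j, forall a, S a -> fdot (om a) (f j).2 < 0.
  (* The first bound brings [k_j] and [k] into the range of [rho_maxcompact_lip]; the second keeps
     [z] within [m / 2] of [y], so that its coordinates on the support of [y] stay above [m / 2]. *)
  pose d := Num.min (1 / (c0' + 1)) (m / 2 / (c0' * fnorm u + 1)).
  have cu0 : 0 < c0' * fnorm u + 1 by rewrite ltr_wpDl// mulr_ge0 ?fnorm_ge0.
  have m2 : 0 < m / 2 by rewrite divr_gt0.
  have d0 : 0 < d by rewrite lt_min !divr_gt0// ltr_wpDl.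
  have [M hM] := pow2_small m2; have [j Mj] := hk d M d0.
  rewrite lt_min => /andP[k1 k2]; exists j => a Sa.
  have [Kj Tj hj] := hf j; rewrite ltNge; apply/negP => oma.
  have hlip : c0' * fnorm ((f j).1 - k) <= 1.
    apply: le_trans (_ : (c0' + 1) * fnorm ((f j).1 - k) <= 1).
      by rewrite ler_wpM2r ?fnorm_ge0// lerDl.
    by rewrite mulrC -ler_pdivlMr ?ltr_wpDl// ltW.
  have {}hlip := hc0 _ _ Kj Kk hlip.
  pose z := U^t* *m (rho (f j).1 *m u).
  have zy : fnorm (z - y) < m / 2.
    rewrite /z /y -mulmxBr (fnorm_unitaryl _ uU') -mulmxBl; apply: le_lt_trans (fnormM _ _) _.
    apply: le_lt_trans (_ : (c0' * fnorm u + 1) * fnorm ((f j).1 - k) < _); last first.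
      by rewrite mulrC -ltr_pdivlMr.
    apply: le_trans (ler_wpM2r (fnorm_ge0 u) hlip) _.
    by rewrite mulrAC ler_wpM2r ?fnorm_ge0// lerDl.
  have za : m / 2 <= normc (z a 0).
    have h1 := mle a Sa; have h2 := normc_le_fnorm (z - y) a 0.
    have := normcB_le (z a 0) (z a 0 - y a 0); rewrite subKr.
    by move: h2; rewrite !mxE; move: zy h1; rewrite /z /y !mxE; lra.
  have : m / 2 <= 2 ^- j.
    apply: ltW; apply: le_lt_trans hj; rewrite (DU _ Tj) mexp_spectral1// -!mulmxA.
    rewrite (fnorm_unitaryl _ uU) -/z; apply: le_trans (normc_le_fnorm _ a 0).
    rewrite dgE mul_dgcl Normc.normcM normcR ger0_norm ?expR_ge0//.
    by apply: le_trans za _; rewrite ler_peMl ?normc_ge0// -expR0 ler_expR.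
  by rewrite leNgt hM.
pose H := (f j).2; have TH : ilie T H by have [] := hf j.
pose c := \big[Num.min/1]_(a | S a) (- fdot (om a) H).
have c0 : 0 < c.
  by apply: bigmin1_gt0 => a Sa; rewrite oppr_gt0; exact: hj.
have cle a : S a -> fdot (om a) H <= - c.
  by move=> Sa; rewrite lerNr; exact: (bigmin1_le (fun a => - fdot (om a) H) Sa).
have Kk' : maxcompact G (k^t*).
  have [_ _ _ KV] := gK; rewrite -(invmx_unitary (uK Kk)); exact: KV.
have kH := torus_ik TH.
have kE : ik G (k^t* *m H *m (k^t*)^t*) by exact: ik_conj.
(* The torus direction [H] conjugated back by the limit [k]: on the support of [y], the coordinates
   of [rho k u], all its exponents are at most [- c]. *)
exists (k^t* *m H *m (k^t*)^t*) => //; exists c => // t t0.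
have hV := rhoU _ Kk; have [v1 v2] := unitaryP hV.
rewrite (rho_mexp aG hrho t kE) (drho_conj aG hadj hrho Kk' kH) (rho_maxcompact_inv aG hadj hrho Kk).
rewrite trmxCK DU//.
pose W := (rho k)^t* *m U; have uW : W \is unitarymx.
  by apply: mul_unitarymx uU; rewrite trmxC_unitary.
have -> : t%:C *: ((rho k)^t* *m (U *m dg (fun a => fdot (om a) H) *m U^t*) *m rho k) =
    W *m dg (fun a => t * fdot (om a) H) *m W^t*.
  have -> : dg (fun a => t * fdot (om a) H) = t%:C *: dg (fun a => fdot (om a) H).
    by rewrite !dgE dgcZ; congr dgc; apply/funext => a; rewrite rmorphM.
  by rewrite -scalemxAr -scalemxAl /W adjmxM trmxCK !mulmxA.
rewrite mexp_spectral1// fdot_spectral -(fdot_unitaryT u uW) mulr_sumr.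
apply: ler_sum => a _; have -> : W^t* *m u = y by rewrite /W adjmxM trmxCK -mulmxA.
have [ya|ya] := eqVneq (y a 0) 0; first by rewrite ya normc0 expr0n !mulr0.
rewrite ler_wpM2r ?sqr_ge0// ler_expR -mulNr mulrC.
by rewrite ler_wpM2r// cle.
Qed.

End TorusWeights.

(** * Orthonormal coordinates on the representation space *)

Section HermitianCoordinates.
Variables (R : realType) (V : vectType R[i]) (ip : {dot V for conjC}).
Local Notation C := R[i].

(** The last clause presents coordinates as elements of ['Hom(V, C^o)], the form in which
    [rational_representation] speaks of matrix coefficients. *)
Definition hermitian_coordinates N (psi : V -> 'cV[C]_N) (phi : 'cV[C]_N -> V) :=
  [/\ forall (a : C) w z, psi (a *: w + z) = a *: psi w + psi z, cancel psi phi,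
    cancel phi psi, forall w z, ip w z = ((psi z)^t* *m psi w) 0 0 &
    forall i, exists l : 'Hom(V, C^o), forall w, l w = psi w i 0].

Lemma hermitian_coordinates_exist : exists N psi phi, @hermitian_coordinates N psi phi.
Proof.
pose N := \dim {:V}; pose b := vbasis {:V}; exists N.
have fb : free b := basis_free (vbasisP {:V}).
have bE w : w = \sum_i coord b i w *: b`_i by apply: coord_vbasis; exact: memvf.
pose M : 'M[C]_N := \matrix_(i, j) ip b`_j b`_i.
pose co w : 'cV[C]_N := \col_i coord b i w.
have ipE w z : ip w z = ((co z)^t* *m M *m co w) 0 0.
  rewrite {1}(bE w) {1}(bE z) linear_sumlz mxE; apply: eq_bigr => j _.
  rewrite linearZl_LR linear_sumr /= mxE mulr_suml mulr_sumr; apply: eq_bigr => i _.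
  by rewrite linearZr_LR /= !mxE [LHS]mulrC mulrAC.
have ipC w z : (ip w z)^*%C = ip z w.
  by rewrite (hermC ip z w) expr0 mul1r.
have pM : posdef M.
  split=> [|w w0].
    by apply/matrixP => i j; rewrite adjmxE !mxE ipC.
  pose z := \sum_i w i 0 *: b`_i.
  have zE : co z = w by apply/matrixP => i j; rewrite mxE ord1 coord_sum_free.
  rewrite -{1 2}zE -ipE lt_neqAle dnorm_ge0 eq_sym andbT dnorm_eq0.
  by apply: contra_neq w0 => z0; rewrite -zE z0; apply/matrixP => i j; rewrite !mxE linear0.
have [X hX MX] := posdef_log pM.
(* The square root of the Gram matrix [M] turns coordinates in the basis [b] into orthonormal
   ones. *)
pose B := mexp ((2^-1 : R)%:C *: X).
have BB : M = B^t* *m B by rewrite mexp_hermZ_adj// MX mexp_half.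
have uB : B \in unitmx by exact: mexp_hermZ_unit hX.
exists (fun w => B *m co w), (fun u => \sum_i (invmx B *m u) i 0 *: b`_i); split.
- move=> a w z; rewrite scalemxAr -mulmxDr; congr (_ *m _).
  by apply/matrixP => i j; rewrite !mxE linearP.
- by move=> w; rewrite mulKmx// [RHS]bE; apply: eq_bigr => i _; rewrite mxE.
- move=> u; rewrite -[RHS](mulKVmx uB); congr (_ *m _).
  by apply/matrixP => i j; rewrite [LHS]mxE ord1 coord_sum_free.
- by move=> w z; rewrite ipE BB adjmxM !mulmxA.
move=> i; exists (\sum_j B i j *: linfun (coord b j : V -> C^o)) => w.
rewrite sum_lfunE mxE; apply: eq_bigr => j _.
by rewrite scale_lfunE lfunE /= mxE.
Qed.

Section Representation.
Variables (n : nat) (G : set 'M[C]_n) (pi : 'M[C]_n -> 'End(V)).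
Hypotheses (aG : algebraic_group G) (hadj : forall h, G h -> G (h^t*))
  (hpi : rational_representation G pi) (hip : invariant_under ip pi (maxcompact G)).
Variables (N : nat) (psi : V -> 'cV[C]_N) (phi : 'cV[C]_N -> V)
  (hc : hermitian_coordinates psi phi).

Definition rep_mx g : 'M[C]_N := \matrix_(i, j) psi (pi g (phi (delta_mx j 0))) i 0.

Lemma coordsD w z : psi (w + z) = psi w + psi z.
Proof. by have [psiP _ _ _ _] := hc; have := psiP 1 w z; rewrite !scale1r. Qed.

Lemma coords0 : psi 0 = 0.
Proof. by apply: (addrI (psi 0)); rewrite -coordsD !addr0. Qed.

Lemma coordsZ a w : psi (a *: w) = a *: psi w.
Proof. by have [psiP _ _ _ _] := hc; have := psiP a w 0; rewrite coords0 !addr0. Qed.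

Lemma coordsB w z : psi (w - z) = psi w - psi z.
Proof. by rewrite coordsD -scaleN1r coordsZ scaleN1r. Qed.

Lemma coords_sum I (r : seq I) (F : I -> V) : psi (\sum_(i <- r) F i) = \sum_(i <- r) psi (F i).
Proof. by elim: r => [|i r IH]; rewrite ?big_nil ?coords0// !big_cons coordsD IH. Qed.

Lemma coords_pi g w : psi (pi g w) = rep_mx g *m psi w.
Proof.
have [_ psiK phiK _ _] := hc.
have wE : w = \sum_j psi w j 0 *: phi (delta_mx j 0).
  apply: (can_inj psiK); rewrite coords_sum {1}(matrix_sum_delta (psi w)).
  by apply: eq_bigr => j _; rewrite big_ord1 coordsZ phiK.
rewrite {1}wE linear_sum coords_sum; apply/matrixP => i j; rewrite summxE mxE ord1.
by apply: eq_bigr => k _; rewrite linearZ coordsZ !mxE mulrC.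
Qed.

Lemma coords_inner w z : ip w z = ((psi z)^t* *m psi w) 0 0.
Proof. by have [_ _ _ -> _] := hc. Qed.

Lemma mul_delta_col (A : 'M[C]_N) i j : (A *m delta_mx j (0 : 'I_1)) i 0 = A i j.
Proof. by rewrite -colE mxE. Qed.

Lemma rep_mx_matrix_rep : matrix_rep G rep_mx.
Proof.
have [_ psiK phiK _ reg] := hc; have [pi1 piM piR] := hpi; split.
- by apply/matrixP => i j; rewrite !mxE pi1 id_lfunE phiK mxE andbT.
- move=> g h Gg Gh; apply/matrixP => i j.
  by rewrite -[LHS]mul_delta_col -[in LHS](phiK (delta_mx j 0)) -coords_pi piM// comp_lfunE !coords_pi phiK mulmxA mul_delta_col.
- move=> i j; have [l hl] := reg i; have [p [k hpk]] := piR (phi (delta_mx j 0)) l.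
  by exists p, k => g Gg; rewrite mxE -hl hpk.
move=> k Kk; apply: unitaryI; apply: mulmx1C; apply/matrixP => i j.
have := hip Kk (phi (delta_mx j 0)) (phi (delta_mx i 0)).
rewrite !coords_inner !coords_pi !phiK adjmxM -!mulmxA (mulmxA ((rep_mx k)^t*)).
have delta_row (A : 'M[C]_N) : ((delta_mx i (0 : 'I_1))^t* *m (A *m delta_mx j (0 : 'I_1))) 0 0 = A i j.
  have c1 : (1 : C)^*%C = 1 by apply/eqP; rewrite eq_complex /= oppr0 !eqxx.
  have dE l : ((delta_mx i (0 : 'I_1) : 'cV[C]_N)^t*) 0 l = (l == i)%:R.
    by rewrite adjmxE mxE andbT; case: eqP; rewrite ?c1 ?conjc0.
  rewrite -[RHS]mul_delta_col mxE (bigD1 i)//= big1 ?addr0 => [|l li].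
    by rewrite dE eqxx mul1r.
  by rewrite dE (negPf li) mul0r.
rewrite delta_row => ->; rewrite -[delta_mx j 0]mul1mx.
by rewrite delta_row.
Qed.

Lemma vnormE w : vnorm ip w = fnorm (psi w).
Proof.
rewrite /vnorm coords_inner fnorm.unlock; congr Num.sqrt.
by have := quad_fdot 1%:M (psi w); rewrite mul1mx mulmx1.
Qed.

Lemma kempf_nessE v x : kempf_ness ip pi v x = ln (fdot (rep_mx x *m psi v) (psi v)).
Proof. by rewrite /kempf_ness coords_inner coords_pi mulmxA quad_fdot. Qed.

Local Notation D := (drho aG rep_mx_matrix_rep).

(** [lie_rep] is a chosen limit; in coordinates the limit exists by the expansion of [mexp] and is
    unique. *)
Lemma lie_repE X w : ik G X -> psi (lie_rep ip pi X w) = D X *m psi w.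
Proof.
move=> kX; have [_ psiK phiK _ _] := hc.
pose q (t : R) := (t^-1)%:C *: (pi (expmx (t%:C *: X)) w - w).
have limE z : ((fun t => vnorm ip (q t - z)) @ 0^' --> (0 : R)) <->
    (fun t => psi (q t)) @ 0^' --> psi z.
  rewrite cvg_fnorm0P; have -> : (fun t => vnorm ip (q t - z)) = (fun t => fnorm (psi (q t) - psi z)).
    by apply/funext => t; rewrite vnormE coordsB.
  by [].
have qlim : (fun t => psi (q t)) @ 0^' --> D X *m psi w.
  apply/cvg_fnormP => e e0.
  have [c c0 hcc] := o2M (tay2_mexp (D X)) (o2_cst (psi w)).
  rewrite mul1mx mulmx0 addr0 in hcc.
  apply/nbhs_ballP; exists (Num.min 1 (e / (c + 1))).
    by rewrite /= lt_min ltr01 divr_gt0// ltr_wpDl.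
  move=> t; rewrite /ball /= sub0r normrN lt_min => /andP[/ltW t1 te] t0.
  rewrite /q coordsZ coordsB coords_pi mexpE (rho_mexp _ rep_mx_matrix_rep t kX).
  have -> : (t^-1)%:C *: (mexp (t%:C *: D X) *m psi w - psi w) - D X *m psi w =
      (t^-1)%:C *: (mexp (t%:C *: D X) *m psi w - psi w - t%:C *: (D X *m psi w)).
    rewrite [RHS]scalerBr; congr (_ - _); rewrite scalerA -(rmorphM (real_complex R)).
    by rewrite mulVf// rmorph1 scale1r.
  rewrite fnormZr normfV ltr_pdivrMl ?normr_gt0//.
  apply: le_lt_trans (hcc t t1) _; rewrite -(real_normK (num_real t)) expr2 mulrA mulrC.
  rewrite ltr_pM2l ?normr_gt0//; apply: le_lt_trans (_ : (c + 1) * `|t| < e).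
    by rewrite ler_wpM2r// lerDl.
  by rewrite mulrC -ltr_pdivlMr// ltr_wpDl.
have -> : lie_rep ip pi X w = phi (D X *m psi w); last exact: phiK.
apply: xget_unique => [|z /limE hz]; first by apply/limE; rewrite phiK.
by rewrite -(cvg_fnorm_unique hz qlim) psiK.
Qed.

Variable (T : set 'M[C]_n).
Hypothesis mT : maximal_torus T (maxcompact G).

Lemma weight_norm_bound X (w : 'cV[C]_N) : ik G X ->
  fnorm (D X *m w) <= weight_norm ip pi T * fnorm X * fnorm w.
Proof.
have [_ psiK phiK _ _] := hc.
apply: (weight_bound hadj mT) => U om uU omT DU a; have [u1 u2] := unitaryP uU.
have fE (Y : 'M[C]_n) : fnorm Y = mxnorm Y by rewrite fnorm.unlock fdot.unlock.
have dE (Y Z : 'M[C]_n) : fdot Y Z = mxdot Y Z by rewrite fdot.unlock.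
have colU b c : (U^t* *m (U *m delta_mx b (0 : 'I_1))) c 0 = (c == b)%:R.
  by rewrite mulmxA u2 mul1mx mxE andbT.
have omW b : weight ip pi T (om b).
  split=> //; exists (phi (U *m delta_mx b 0)).
    apply/eqP => h; have := congr1 psi h; rewrite phiK coords0 => h0.
    by have := colU b b; rewrite h0 mulmx0 mxE eqxx => /eqP; rewrite eq_sym oner_eq0.
  move=> H TH; apply: (can_inj psiK); rewrite lie_repE; last exact: torus_ik TH.
  rewrite coordsZ phiK DU// -dE -!mulmxA (mulmxA (U^t*)) u2 mul1mx [RHS]scalemxAr; congr (_ *m _).
  apply/matrixP => c d; rewrite !ord1 dgE mul_dgcl !mxE andbT.
  by case: eqP => [->|_]; rewrite ?mulr0.
(* All weights occur among the finitely many [om b], so their norms are bounded and the [sup]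
   dominates each of them. *)
have Wom omega : weight ip pi T omega -> exists b, omega = om b.
  move=> [Tom [z z0 hz]]; pose y := U^t* *m psi z.
  have [b yb] : exists b, y b 0 != 0.
    apply: contrapT => hy; case/eqP: z0; apply: (can_inj psiK); rewrite coords0.
    rewrite -[psi z]mul1mx -u1 -mulmxA -/y.
    have -> : y = 0; last by rewrite mulmx0.
    apply/matrixP => b c; rewrite ord1 [RHS]mxE; apply/eqP/negPn/negP => yb; apply: hy.
    by exists b.
  exists b.
  have key H : ilie T H -> fdot (omega - om b) H = 0.
    move=> TH; have := congr1 (fun v => U^t* *m psi v) (hz H TH).
    rewrite coordsZ lie_repE; last exact: torus_ik TH.
    rewrite DU// -!mulmxA (mulmxA (U^t*) U) u2 mul1mx -scalemxAr -/y.
    move/(congr1 (fun v : 'cV[C]_N => v b 0)); rewrite dgE mul_dgcl [(_ *: y) b 0]mxE -dE => h.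
    have /complexI := mulIf yb h.
    by rewrite fdotBl => ->; rewrite subrr.
  have uK := @maxcompact_unitary R n G.
  have Td := real_subspaceB (torus_ilie_subspace uK mT) Tom (omT b).
  by apply/eqP; rewrite -subr_eq0; apply/eqP/fnorm_eq0/eqP; rewrite -sqrf_eq0 fnorm_sqr key.
rewrite /weight_norm fE; apply: ub_le_sup; last by exists (om a).
exists (\sum_b mxnorm (om b)) => _ [omega /Wom[b ->] <-].
by rewrite (bigD1 b)//= lerDl sumr_ge0// => c _; rewrite -fE fnorm_ge0.
Qed.

End Representation.
End HermitianCoordinates.

(** * Real derivatives from quadratic error bounds *)

Section RealDerivatives.
Variable R : realType.
Local Notation C := R[i].

Lemma is_derive_limit (f : R -> R) (t l : R) :
  (fun h => h^-1 * (f (t + h) - f t)) @ 0^' --> l -> is_derive t 1 f l.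
Proof.
move=> hl; have hE : (fun h => h^-1 *: ((f \o shift t) (h *: 1) - f t)) = (fun h => h^-1 * (f (t + h) - f t)).
  apply/funext => h; congr (_ * (f _ - _)); rewrite /= addrC; congr (_ + _); exact: mulr1.
split; first by rewrite /derivable hE; apply: cvgP hl.
by rewrite /derive hE; apply: cvg_lim hl.
Qed.

Lemma dnbhs0_lim (f : R -> R) (l : R) : (forall e, 0 < e -> exists2 d : R, 0 < d &
  forall h, h != 0 -> `|h| < d -> `|f h - l| < e) -> f @ 0^' --> l.
Proof.
move=> hf; apply/cvgrPdist_lt => e e0; have [d d0 hd] := hf e e0.
apply/nbhs_ballP; exists d => // h; rewrite /ball /= sub0r normrN => hh h0.
by rewrite distrC; exact: hd.
Qed.

Lemma is_derive_quadratic (f : R -> R) (t l c : R) :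
  (forall s, `|s| <= 1 -> `|f (t + s) - f t - s * l| <= c * s ^+ 2) -> is_derive t 1 f l.
Proof.
move=> hc; apply: is_derive_limit; apply: dnbhs0_lim => e e0.
have c0 : 0 <= c.
  by have := hc 1; rewrite normr1 lexx expr1n mulr1 => /(_ isT); apply: le_trans.
exists (Num.min 1 (e / (c + 1))) => [|h h0]; first by rewrite lt_min ltr01 divr_gt0// ltr_wpDl.
rewrite lt_min => /andP[/ltW h1 he].
have -> : h^-1 * (f (t + h) - f t) - l = h^-1 * (f (t + h) - f t - h * l).
  by rewrite [RHS]mulrBr mulKf.
rewrite normrM normfV ltr_pdivrMl ?normr_gt0//; apply: le_lt_trans (hc h h1) _.
rewrite -(real_normK (num_real h)) expr2 mulrA mulrC ltr_pM2l ?normr_gt0//.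
apply: le_lt_trans (_ : (c + 1) * `|h| < e); first by rewrite ler_wpM2r// lerDl.
by rewrite mulrC -ltr_pdivlMr// ltr_wpDl.
Qed.

Lemma fdot_mul_adj m n (X Y : 'M[C]_(m, n)) : fdot X Y = fdot (X *m Y^t*) 1%:M.
Proof. by rewrite !fdot.unlock adjmx1 mulmx1. Qed.

Lemma o2_fdot m n (f g : R -> 'M[C]_(m, n)) f0 g0 A B : o2 f f0 A -> o2 g g0 B ->
  exists2 c : R, 0 <= c & forall s : R, `|s| <= 1 ->
  `|fdot (f s) (g s) - fdot f0 g0 - s * (fdot A g0 + fdot f0 B)| <= c * s ^+ 2.
Proof.
move=> hf hg; have [c c0 hc] := o2M hf (o2_adj hg).
exists (c * fnorm (1%:M : 'M[C]_m)) => [|s s1]; first by rewrite mulr_ge0 ?fnorm_ge0.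
rewrite (fdot_mul_adj (f s)) (fdot_mul_adj f0 g0) (fdot_mul_adj A) (fdot_mul_adj f0 B) -!fdotDl -fdotZl -!fdotBl.
by rewrite mulrAC; apply: le_trans (fdot_le _ _) _; rewrite ler_wpM2r ?fnorm_ge0// hc.
Qed.

End RealDerivatives.

(** * Quadratic forms along one-parameter groups: logarithmic convexity and derivatives *)

Section QuadraticForms.
Variables (R : realType) (N : nat).
Local Notation C := R[i].
Implicit Types (A B : 'M[C]_N) (w : 'cV[C]_N).

(** [exp_quad_le] for the normalized vector. After taking logarithms it is the tangent inequality at
    0 for [t |-> ln (e^(tB) w, w)], the source of all convexity used below. *)
Lemma jensen_exp B w : B^t* = B ->
  fdot w w * expR (fdot (B *m w) w / fdot w w) <= fdot (mexp B *m w) w.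
Proof.
move=> hB; have [->|w0] := eqVneq w 0; first by rewrite !mulmx0 !fdot0l mul0r.
have n0 : 0 < fnorm w := fnorm_gt0 w0.
pose p := (fnorm w)^-1%:C *: w.
have wE : w = (fnorm w)%:C *: p.
  by rewrite scalerA -(rmorphM (real_complex R)) mulfV ?gt_eqF// rmorph1 scale1r.
have p1 : fdot p p = 1.
  by rewrite fdotZl fdotZr -fnorm_sqr; field; rewrite gt_eqF.
have h := @exp_quad_le R N B p hB; rewrite p1 lexx subrr addr0 in h.
have sc (M : 'M[C]_N) : fdot (M *m w) w = fdot w w * fdot (M *m p) p.
  by rewrite {1 2}wE -scalemxAr fdotZl fdotZr -fnorm_sqr mulrA.
have w2 : 0 < fdot w w by rewrite -fnorm_sqr exprn_gt0.
rewrite !sc mulrAC mulfV ?gt_eqF// mul1r ler_pM2l//; exact: h.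
Qed.

Lemma fdot_mexp_gt0 A w : A^t* = A -> w != 0 -> 0 < fdot (mexp A *m w) w.
Proof.
move=> hA w0; apply: lt_le_trans (jensen_exp w hA).
by rewrite mulr_gt0 ?expR_gt0// -fnorm_sqr exprn_gt0// fnorm_gt0.
Qed.

Definition logq A w (t : R) := ln (fdot (mexp (t%:C *: A) *m w) w).

Lemma logq_shift A w (s t : R) : A^t* = A ->
  fdot (mexp (s%:C *: A) *m (mexp ((t / 2)%:C *: A) *m w)) (mexp ((t / 2)%:C *: A) *m w) =
  fdot (mexp ((s + t)%:C *: A) *m w) w.
Proof.
move=> hA; rewrite fdotC fdot_mulmxl mexp_hermZ_adj// fdotC; congr (fdot _ w).
rewrite (mulmxA (mexp (s%:C *: A))) -(mexp_hermM s (t / 2) hA) mulmxA -(mexp_hermM _ _ hA).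
by rewrite addrCA -splitr.
Qed.

(** The tangent at time [t], obtained from [jensen_exp] at the vector [y = e^(tA/2) w], lies below
    the function at both ends; the two inequalities are combined with weights [d - t] and [t]. *)
Lemma logq_convex A w (t d : R) : A^t* = A -> w != 0 -> 0 <= t <= d ->
  d * logq A w t <= (d - t) * logq A w 0 + t * logq A w d.
Proof.
move=> hA w0 /andP[t0 td].
pose y := mexp ((t / 2)%:C *: A) *m w.
have y0 : y != 0.
  by apply: contra_neq w0 => h; rewrite -(mulKmx (mexp_hermZ_unit (t / 2) hA) w) -/y h mulmx0.
pose m := fdot (A *m y) y / fdot y y.
have y2 : 0 < fdot y y by rewrite -fnorm_sqr exprn_gt0// fnorm_gt0.
have ft : fdot y y = fdot (mexp (t%:C *: A) *m w) w.
  by have := logq_shift w 0 t hA; rewrite scale0r mexp0 mul1mx add0r.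
have grad s : logq A w t + s * m <= logq A w (s + t).
  have hsA : (s%:C *: A)^t* = s%:C *: A by exact: herm_scale.
  have := jensen_exp y hsA; rewrite logq_shift// -scalemxAl fdotZl -mulrA -/m.
  rewrite -ler_ln ?posrE ?mulr_gt0 ?expR_gt0//; last by apply: fdot_mexp_gt0 => //; exact: herm_scale.
  by rewrite lnM ?posrE ?expR_gt0// expRK /logq ft.
have h1 := grad (- t); have h2 := grad (d - t); rewrite addNr in h1; rewrite subrK in h2.
have dt0 : 0 <= d - t by rewrite subr_ge0.
apply: le_trans (lerD (ler_wpM2l dt0 h1) (ler_wpM2l t0 h2)).
by rewrite le_eqVlt; apply/orP; left; apply/eqP; ring.
Qed.

Lemma is_derive_quad A B w (a t : R) : A^t* = A -> B^t* = B ->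
  is_derive t 1 (fun s => fdot (B *m (mexp ((a * s)%:C *: A) *m w)) (mexp ((a * s)%:C *: A) *m w))
   (2 * a * fdot (B *m (mexp ((a * t)%:C *: A) *m w)) (A *m (mexp ((a * t)%:C *: A) *m w))).
Proof.
move=> hA hB; set e := mexp ((a * t)%:C *: A) *m w.
have haA : (a%:C *: A)^t* = a%:C *: A by exact: herm_scale.
have h1 : o2 (fun s => mexp (s%:C *: (a%:C *: A)) *m e) e ((a%:C *: A) *m e).
  by have := o2M (tay2_mexp (a%:C *: A)) (o2_cst e); rewrite mul1mx mulmx0 addr0.
have h2 : o2 (fun s => B *m (mexp (s%:C *: (a%:C *: A)) *m e)) (B *m e) (B *m ((a%:C *: A) *m e)).
  by have := o2M (o2_cst B) h1; rewrite mul0mx add0r.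
have [c c0 hc] := o2_fdot h2 h1.
apply: (@is_derive_quadratic _ _ _ _ c) => s s1.
have eE : mexp ((a * (t + s))%:C *: A) *m w = mexp (s%:C *: (a%:C *: A)) *m e.
  rewrite /e mulmxA scalerA -(rmorphM (real_complex R)) -mexp_hermM//.
  by congr (mexp (_%:C *: _) *m _); ring.
rewrite eE; apply: le_trans (hc s s1); rewrite le_eqVlt; apply/orP; left; apply/eqP.
congr (`|_ - _ * _|); rewrite -!scalemxAl -!scalemxAr fdotZl fdotZr.
have -> : fdot (B *m (A *m e)) e = fdot (B *m e) (A *m e) by rewrite fdot_mulmxl hB fdotC.
by ring.
Qed.

End QuadraticForms.

(** * Velocities of curves and the logarithm near the identity *)

Section Curves.
Variables (R : realType) (n : nat).
Local Notation C := R[i].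

Lemma has_velocityP (c : R -> 'M[C]_n) t X : has_velocity c t X <->
  forall e : R, 0 < e -> exists2 d : R, 0 < d & forall h, h != 0 -> `|h| < d ->
    fnorm ((h^-1)%:C *: (c (t + h) - c t) - X) < e.
Proof.
rewrite /has_velocity cvg_fnormP; split=> hX e e0.
  have /nbhs_ballP[d d0 hd] := hX e e0; exists d => // h h0 hh.
  by apply: hd => //; rewrite /ball /= sub0r normrN.
have [d d0 hd] := hX e e0; apply/nbhs_ballP; exists d => // h; rewrite /ball /= sub0r normrN => hh h0.
exact: hd.
Qed.

(** On eigenvalues: if [y = e^a - 1] is at least [-1/2], then [y - 2 y^2 <= a <= y]. *)
Lemma log_near1 (A : 'M[C]_n) : A^t* = A -> fnorm (mexp A - 1%:M) <= 1 / 2 ->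
  fnorm (A - (mexp A - 1%:M)) <= 2 * fnorm (mexp A - 1%:M) ^+ 2.
Proof.
case/herm_spectral => U [a [hU ->]]; have [u1 _] := unitaryP hU.
rewrite mexp_spectral1//; set r := fnorm _.
have specB (b c : 'I_n -> R) : U *m dg b *m U^t* - U *m dg c *m U^t* =
    U *m dg (fun i => b i - c i) *m U^t*.
  rewrite -mulmxBl -mulmxBr; congr (_ *m _ *m _); apply/matrixP => i j.
  by rewrite !dgE !mxE rmorphB mulrnBl.
have E1 : U *m dg (fun i => expR (a i)) *m U^t* - 1%:M = U *m dg (fun i => expR (a i) - 1) *m U^t*.
  rewrite -(specB _ (fun=> 1)); congr (_ - _); rewrite dgE.
  have -> : dgc (fun=> (1 : R)%:C) = 1%:M :> 'M[C]_n by exact: dgc1.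
  by rewrite mulmx1 u1.
rewrite /r E1 specB; set y := fun i => expR (a i) - 1 => hr.
set s := fnorm _ in hr *; have s0 : 0 <= s by exact: fnorm_ge0.
have s2 : s ^+ 2 = \sum_i y i ^+ 2 by exact: fnorm_spectral.
have yi i : `|y i| <= s.
  rewrite -ler_sqr ?nnegrE// real_normK ?num_real// s2 (bigD1 i)//= lerDl sumr_ge0// => j _.
  exact: sqr_ge0.
have ay i : (a i - y i) ^+ 2 <= 4 * s ^+ 2 * y i ^+ 2.
  have h1 : a i <= y i by have := expR_ge1Dx (a i); rewrite /y; lra.
  have yh : - (1 / 2) <= y i by have := yi i; rewrite ler_norml => /andP[+ _]; move: hr; lra.
  have h2 : y i - 2 * y i ^+ 2 <= a i.
    have y1 : 0 < 1 + y i by move: yh; lra.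
    have := expR_ge1Dx (- a i); rewrite expRN -(ler_pM2r y1).
    have -> : expR (a i) = 1 + y i by rewrite /y; ring.
    rewrite mulVf ?gt_eqF// => h.
    have : (y i - 2 * y i ^+ 2) * (1 + y i) <= a i * (1 + y i); last by rewrite ler_pM2r.
    apply: (@le_trans _ _ (y i)); last by move: h; rewrite mulrDl mul1r mulNr; lra.
    have y2 : 0 <= y i ^+ 2 := sqr_ge0 _.
    have : 0 <= y i ^+ 2 * (1 + 2 * y i) by rewrite mulr_ge0//; move: yh; lra.
    move=> h4; rewrite -subr_ge0.
    have -> : y i - (y i - 2 * y i ^+ 2) * (1 + y i) = y i ^+ 2 * (1 + 2 * y i) by ring.
    exact: h4.
  have h3 : `|a i - y i| <= 2 * y i ^+ 2.
    by rewrite ler0_norm ?subr_le0//; move: h2; lra.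
  have h4 : y i ^+ 2 <= s * `|y i|.
    by rewrite -(real_normK (num_real (y i))) expr2 ler_wpM2r.
  have -> : 4 * s ^+ 2 * y i ^+ 2 = (2 * (s * `|y i|)) ^+ 2.
    by rewrite -(real_normK (num_real (y i))); ring.
  rewrite -(real_normK (num_real (a i - y i))) ler_sqr ?nnegrE ?normr_ge0//.
    by apply: le_trans h3 _; rewrite ler_wpM2l.
  by rewrite !mulr_ge0.
rewrite -ler_sqr ?nnegrE ?fnorm_ge0 ?mulr_ge0 ?sqr_ge0// fnorm_spectral//.
apply: le_trans (ler_sum _ (fun i _ => ay i)) _.
by rewrite -mulr_sumr -s2 le_eqVlt; apply/orP; left; apply/eqP; ring.
Qed.

End Curves.

(** * The Kempf-Ness function and the moment map *)

Section KempfNess.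
Variables (R : realType) (n N : nat).
Local Notation C := R[i].
Variables (G : set 'M[C]_n) (rho : 'M[C]_n -> 'M[C]_N).
Hypotheses (aG : algebraic_group G) (hadj : forall h, G h -> G (h^t*)) (hrho : matrix_rep G rho).
Local Notation D := (drho aG hrho).
Variable u : 'cV[C]_N.
Hypothesis u0 : u != 0.

Let GM g h : G g -> G h -> G (g *m h). Proof. by have [[_ _ + _] _] := aG; apply. Qed.
Let GV g : G g -> G (invmx g). Proof. by have [[_ _ _ +] _] := aG; apply. Qed.
Let Gu g : G g -> g \in unitmx. Proof. by have [[+ _ _ _] _] := aG; apply. Qed.

Definition moment_map (w : 'cV[C]_N) : 'M[C]_n := xget 0 [set m | ik G m /\
  forall Z, ik G Z -> fdot m Z = fdot (D Z *m w) w / fdot w w].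

Lemma mu_spec w : ik G (moment_map w) /\
  forall Z, ik G Z -> fdot (moment_map w) Z = fdot (D Z *m w) w / fdot w w.
Proof.
have [||m km hm] := @riesz R n (ik G) (fun Z => fdot (D Z *m w) w / fdot w w) (ik_subspace aG).
- by move=> X Y _ _; rewrite drhoD mulmxDl fdotDl mulrDl.
- by move=> a X _; rewrite drhoZ -scalemxAl fdotZl mulrA.
have := @xgetPex 'M[C]_n 0 [set m | ik G m /\ forall Z, ik G Z -> fdot m Z = fdot (D Z *m w) w / fdot w w].
by apply; exists m; split=> // Z kZ; rewrite hm.
Qed.

Lemma mu_ik w : ik G (moment_map w). Proof. by have [] := mu_spec w. Qed.

Lemma muE w Z : ik G Z -> fdot (moment_map w) Z = fdot (D Z *m w) w / fdot w w.
Proof. by have [_] := mu_spec w; apply. Qed.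

Definition kempf_ness_mx x := ln (fdot (rho x *m u) u).

Lemma rho_u_neq0 g : G g -> rho g *m u != 0.
Proof.
move=> Gg; have ug := rho_unit aG hrho Gg.
by apply: contra_neq u0 => h; rewrite -(mulKmx ug u) h mulmx0.
Qed.

(** Moving the base point [g^* g] to 1 amounts to replacing the vector [u] by [rho g u]; the local
    computations are made there. *)
Lemma rho_gram g y : G g -> G y ->
  fdot (rho (g^t* *m y *m g) *m u) u = fdot (rho y *m (rho g *m u)) (rho g *m u).
Proof.
move=> Gg Gy; have [_ rhoM _ _] := hrho; have Gg' := hadj Gg.
rewrite rhoM//; last exact: GM.
by rewrite rhoM// (rho_adj aG hadj hrho Gg) -!mulmxA fdot_mulmxl trmxCK.
Qed.

Lemma kn_gram g Y : G g -> ik G Y -> kempf_ness_mx (g^t* *m mexp Y *m g) =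
  ln (fdot (mexp (D Y) *m (rho g *m u)) (rho g *m u)).
Proof.
by move=> Gg kY; rewrite /kempf_ness_mx rho_gram//; [rewrite (rho_mexp1 aG hrho kY)|exact: ik_mexp].
Qed.

Lemma pospart_conj g Y : G g -> ik G Y -> exists2 P, ik G P & mexp P = g^t* *m mexp Y *m g.
Proof.
move=> Gg kY; have [hY _] := kY.
have kY2 : ik G ((2^-1)%:C *: Y) by exact: ikZ.
have hh := mexp_hermZ_adj (2^-1) hY.
have E : g^t* *m mexp Y *m g = (mexp ((2^-1)%:C *: Y) *m g)^t* *m (mexp ((2^-1)%:C *: Y) *m g).
  by rewrite adjmxM hh -[in LHS](mexp_half hY) !mulmxA.
have Gh : G (mexp ((2^-1)%:C *: Y) *m g) by apply: GM => //; exact: ik_mexp.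
have [|P kP ->] := @pospart_log R n G aG (g^t* *m mexp Y *m g); last by exists P.
split; first by rewrite E; apply: posdef_gram; exact: Gu.
by rewrite E; apply: GM => //; exact: hadj.
Qed.

(** Transported to 1 by the inverse of [g], the curve becomes [h] with velocity [Z]. The logarithms
    of the points [h s] lie in [ik], so their rescaled limit [Z] does; the derivative is the
    logarithmic derivative of the quadratic form of [rho (h s)]. *)
Lemma curve_derivative g (c : R -> 'M[C]_n) X : G g -> curve_at G (g^t* *m g) c X ->
  let Z := (invmx g)^t* *m X *m invmx g in
  ik G Z /\ is_derive (0 : R) (1 : R) (kempf_ness_mx \o c) (fdot (moment_map (rho g *m u)) Z).
Proof.
move=> Gg [cP c0 cX] Z; set v := invmx g in Z *; set w := rho g *m u.
have ug := Gu Gg; have Gv : G v by exact: GV.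
have gv : g *m v = 1%:M by exact: mulmxV.
have vg : v *m g = 1%:M by exact: mulVmx.
pose h s := v^t* *m c s *m v.
have /choice[A hA] : forall s, exists A, ik G A /\ mexp A = h s.
  move=> s; have [Y kY cY] := pospart_log aG (cP s).
  by have [P kP PE] := pospart_conj Gv kY; exists P; rewrite /h cY.
have Gh s : G (h s) by have [kA <-] := hA s; exact: ik_mexp.
have ch s : c s = g^t* *m h s *m g.
  by rewrite /h !mulmxA -adjmxM vg adjmx1 mul1mx -mulmxA vg mulmx1.
have h0 : h 0 = 1%:M by rewrite /h c0 !mulmxA -adjmxM gv adjmx1 mul1mx gv.
pose M := fnorm Z + 1; have M0 : 0 < M by rewrite ltr_wpDl// fnorm_ge0.
have loc e : 0 < e -> exists2 d : R, 0 < d & forall s, s != 0 -> `|s| < d ->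
    fnorm ((s^-1)%:C *: (h s - 1%:M) - Z) < e /\ fnorm (h s - 1%:M) <= `|s| * M.
  move=> e0; pose e' := Num.min e 1; have e'0 : 0 < e' by rewrite lt_min e0 ltr01.
  have K0 : 0 < fnorm (v^t*) * fnorm v + 1 by rewrite ltr_wpDl// mulr_ge0 ?fnorm_ge0.
  have /has_velocityP/(_ _ (divr_gt0 e'0 K0))[d d0 hd] := cX.
  exists d => // s s0 sd; have {hd} := hd s s0 sd; rewrite add0r ltr_pdivlMr// => hs.
  have hZ : fnorm ((s^-1)%:C *: (h s - 1%:M) - Z) < e'.
    have -> : (s^-1)%:C *: (h s - 1%:M) - Z = v^t* *m ((s^-1)%:C *: (c s - c 0) - X) *m v.
      by rewrite mulmxBr mulmxBl -/Z -scalemxAr -scalemxAl mulmxBr mulmxBl -/(h s) -/(h 0) h0.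
    apply: le_lt_trans hs; apply: le_trans (fnormM _ _) _.
    apply: le_trans (ler_wpM2r (fnorm_ge0 _) (fnormM _ _)) _.
    by rewrite mulrAC mulrC ler_wpM2l ?fnorm_ge0// lerDl.
  move: hZ; rewrite lt_min => /andP[he h1]; split=> //.
  have -> : h s - 1%:M = s%:C *: (((s^-1)%:C *: (h s - 1%:M) - Z) + Z).
    by rewrite subrK scalerA -(rmorphM (real_complex R)) mulfV// rmorph1 scale1r.
  rewrite fnormZr ler_wpM2l//; apply: le_trans (fnormD _ _) _.
  by rewrite addrC lerD2l ltW.
have kZ : ik G Z.
  apply: (real_subspace_closed (ik_subspace aG)) => e e0.
  have e2 : 0 < e / 2 by rewrite divr_gt0.
  have [d d0 hd] := loc _ e2.
  have MM : 0 < 4 * M ^+ 2 + 2 * M by rewrite addr_gt0// mulr_gt0// exprn_gt0.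
  (* Small enough for the velocity estimate, for [log_near1] through [s M <= 1/2], and for a
     logarithm error [2 M^2 s] below [e / 2]. *)
  pose s := Num.min (d / 2) (Num.min (1 / (2 * M)) (e / (4 * M ^+ 2 + 1))).
  have M4 : 0 < 4 * M ^+ 2 + 1 by rewrite addr_gt0// mulr_gt0// exprn_gt0.
  have s0 : 0 < s by rewrite !lt_min !divr_gt0// mulr_gt0.
  have sd : `|s| < d.
    by rewrite gtr0_norm// (@le_lt_trans _ _ (d / 2))// ?ge_min ?lexx// ltr_pdivrMr// mulr_natr mulr2n ltrDl.
  have sM : s * (2 * M) <= 1.
    by rewrite -ler_pdivlMr ?mulr_gt0// !ge_min lexx orbT.
  have se : s * (4 * M ^+ 2 + 1) <= e.
    by rewrite -ler_pdivlMr// !ge_min lexx !orbT.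
  have [hZ hM] := hd s (lt0r_neq0 s0) sd; rewrite gtr0_norm// in hM.
  have [kA AE] := hA s; have [hAs _] := kA.
  exists ((s^-1)%:C *: A s); first exact: ikZ.
  have h12 : fnorm (mexp (A s) - 1%:M) <= 1 / 2.
    by rewrite AE; apply: le_trans hM _; move: sM; lra.
  have := log_near1 hAs h12; rewrite AE => hl.
  have -> : (s^-1)%:C *: A s - Z = (s^-1)%:C *: (A s - (h s - 1%:M)) + ((s^-1)%:C *: (h s - 1%:M) - Z).
    by rewrite scalerBr addrA subrK.
  apply: le_lt_trans (fnormD _ _) _; rewrite fnormZr gtr0_norm ?invr_gt0//.
  have : s^-1 * fnorm (A s - (h s - 1%:M)) <= 2 * M ^+ 2 * s.
    rewrite ler_pdivrMl//; apply: le_trans hl _.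
    have : fnorm (h s - 1%:M) ^+ 2 <= (s * M) ^+ 2.
      by rewrite ler_sqr ?nnegrE ?fnorm_ge0// mulr_ge0// ltW.
    rewrite -(ler_pM2l (ltr0Sn R 1)) => /le_trans; apply.
    by rewrite le_eqVlt; apply/orP; left; apply/eqP; ring.
  by move: hZ se s0; rewrite mulrDr mulr1 => h1 h2 h3 h4; move: h1 h2 h3 h4; lra.
split=> //.
pose F s := fdot (rho (c s) *m u) u.
have FE s : F s = fdot (rho (h s) *m w) w by rewrite /F ch rho_gram.
have [rho1 _ _ _] := hrho.
have F0 : F 0 = fdot w w by rewrite FE h0 rho1 mul1mx.
have w2 : 0 < fdot w w by rewrite -fnorm_sqr exprn_gt0// fnorm_gt0// rho_u_neq0.
have dF : is_derive (0 : R) (1 : R) F (fdot (D Z *m w) w).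
  apply: is_derive_limit; apply: dnbhs0_lim => e e0.
  have [e1 e10 he1] := drho_local aG hrho; have [d1 d10 hd1] := drho_lip aG hrho.
  have B0 : 0 < fdot w w * (d1 + 1) by rewrite mulr_gt0// ltr_wpDl.
  have [d d0 hd] := loc (e / 2 / (fdot w w * (d1 + 1))) (divr_gt0 (divr_gt0 e0 (ltr0Sn R 1)) B0).
  have Q0 : 0 < e1 * M + 1 by rewrite ltr_wpDl// mulr_ge0// ltW.
  have P0 : 0 < fdot w w * (e1 * M ^+ 2) + 1.
    by rewrite ltr_wpDl// !mulr_ge0// ?sqr_ge0// ltW.
  exists (Num.min d (Num.min (1 / (e1 * M + 1)) (e / 2 / (fdot w w * (e1 * M ^+ 2) + 1)))).
    by rewrite !lt_min d0 !divr_gt0.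
  move=> s s0; rewrite !lt_min => /and3P[sd s1 se].
  have [hZ hM] := hd s s0 sd.
  have hr : e1 * fnorm (h s - 1%:M) <= 1.
    apply: le_trans (ler_wpM2l e10 hM) _; rewrite ltr_pdivlMr// mulrDr mulr1 in s1.
    by move: s1 (normr_ge0 s); rewrite mulrCA; lra.
  have hl := he1 _ (Gh s) hr.
  rewrite add0r F0 FE -[fdot w w]/(fdot w w).
  have -> : s^-1 * (fdot (rho (h s) *m w) w - fdot w w) - fdot (D Z *m w) w =
      fdot (((s^-1)%:C *: (rho (h s) - 1%:M - D (h s - 1%:M)) + D ((s^-1)%:C *: (h s - 1%:M) - Z)) *m w) w.
    rewrite (drhoB aG hrho ((s^-1)%:C *: (h s - 1%:M)) Z) drhoZ addrA -scalerDr subrK mulmxBl fdotBl -scalemxAl fdotZl.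
    by rewrite mulmxBl mul1mx fdotBl.
  apply: le_lt_trans (fdot_le _ _) _.
  apply: le_lt_trans (ler_wpM2r (fnorm_ge0 _) (fnormM _ _)) _.
  rewrite -mulrA -expr2 fnorm_sqr mulrC.
  apply: le_lt_trans (ler_wpM2l (ltW w2) (fnormD _ _)) _.
  have h1 : fnorm ((s^-1)%:C *: (rho (h s) - 1%:M - D (h s - 1%:M))) <= e1 * M ^+ 2 * `|s|.
    rewrite fnormZr normfV ler_pdivrMl ?normr_gt0//; apply: le_trans hl _.
    have : fnorm (h s - 1%:M) ^+ 2 <= (`|s| * M) ^+ 2.
      by rewrite ler_sqr ?nnegrE ?fnorm_ge0// mulr_ge0// ltW.
    move=> /(ler_wpM2l e10)/le_trans; apply.
    by rewrite le_eqVlt; apply/orP; left; apply/eqP; ring.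
  have h2 := hd1 ((s^-1)%:C *: (h s - 1%:M) - Z).
  rewrite ltr_pdivlMr// in se; rewrite ltr_pdivlMr// in hZ.
  have h3 : fdot w w * fnorm (D ((s^-1)%:C *: (h s - 1%:M) - Z)) < e / 2.
    apply: le_lt_trans hZ; apply: le_trans (ler_wpM2l (ltW w2) h2) _.
    rewrite -subr_ge0; set q := fnorm _; have -> : q * (fdot w w * (d1 + 1)) - fdot w w * (d1 * q) = fdot w w * q by ring.
    by rewrite mulr_ge0 ?fnorm_ge0// ltW.
  have h4 : fdot w w * fnorm ((s^-1)%:C *: (rho (h s) - 1%:M - D (h s - 1%:M))) < e / 2.
    apply: le_lt_trans (ler_wpM2l (ltW w2) h1) _; apply: le_lt_trans se.
    rewrite -subr_ge0 (_ : _ - _ = `|s|) ?normr_ge0//; ring.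
  by rewrite mulrDr [ltRHS](splitr e) addrC; apply: ltrD.
rewrite muE// mulrC; apply: is_derive1_comp.
by rewrite -/(F 0) F0; exact: is_derive1_ln.
Qed.

End KempfNess.

(** * The Riemannian gradient, and contraction of the moment map under a descent step *)

Section Gradient.
Variables (R : realType) (n N : nat).
Local Notation C := R[i].

Lemma sqrtmxP (x : 'M[C]_n) : posdef x -> posdef (sqrtmx x) /\ sqrtmx x *m sqrtmx x = x.
Proof.
move=> px; have [X hX xE] := posdef_log px.
have := @xgetPex 'M[C]_n 0 [set y | posdef y /\ y *m y = x]; apply.
exists (mexp ((2^-1)%:C *: X)); split; last by rewrite (mexp_half hX).
by apply: posdef_mexp; exact: herm_scale.
Qed.

Lemma posdef_unit (x : 'M[C]_n) : posdef x -> x \in unitmx.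
Proof. by move=> px; have [X hX ->] := posdef_log px; exact: mexp_herm_unit. Qed.

(** If [s] is the positive square root of [g^* g], then [g = k s] with [k] unitary, and [k] passes
    through the exponential; so [g] may replace [s] in the definition of the exponential map. *)
Lemma riem_exp_gram (g Z : 'M[C]_n) : g \in unitmx ->
  riem_exp (g^t* *m g) (g^t* *m Z *m g) = g^t* *m mexp Z *m g.
Proof.
move=> ug; have [ps ss] := sqrtmxP (posdef_gram ug).
rewrite /riem_exp; move: ps ss; set s := sqrtmx _ => ps ss.
have us := posdef_unit ps; have [hs _] := ps.
pose k := g *m invmx s.
have hsi : (invmx s)^t* = invmx s.
  apply: (can_inj (mulKmx us)); rewrite mulmxV// -{1}hs -adjmxM mulVmx// adjmx1//.
have ks : k *m s = g by rewrite /k mulmxKV.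
have sk : s *m k^t* = g^t* by rewrite -[in RHS]ks (adjmxM k s) hs.
have uk : k \is unitarymx.
  apply: unitaryI; apply: mulmx1C; rewrite /k adjmxM hsi !mulmxA -(mulmxA (invmx s)) -ss mulmxA.
  by rewrite mulVmx// mul1mx mulmxV.
have -> : invmx s *m (g^t* *m Z *m g) *m invmx s = k^t* *m Z *m k.
  by rewrite /k adjmxM hsi !mulmxA.
clearbody k; by rewrite mexpE (mexp_conjUt _ uk) !mulmxA sk -(mulmxA (g^t* *m mexp Z) k s) ks.
Qed.

Variables (G : set 'M[C]_n) (rho : 'M[C]_n -> 'M[C]_N).
Hypotheses (aG : algebraic_group G) (hadj : forall h, G h -> G (h^t*)) (hrho : matrix_rep G rho).
Local Notation D := (drho aG hrho).
Variable u : 'cV[C]_N.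
Hypothesis u0 : u != 0.
Local Notation mu := (moment_map aG hrho).

Lemma riem_gram (g Z Y : 'M[C]_n) : g \in unitmx ->
  let W := (invmx g)^t* *m Y *m invmx g in W^t* = W ->
  riem (g^t* *m g) (g^t* *m Z *m g) Y = fdot Z W.
Proof.
move=> ug W hW; rewrite fdot.unlock hW /riem; congr complex.Re.
set v := invmx g in W hW *.
have gv : g *m v = 1%:M by exact: mulmxV.
have vg : v *m g = 1%:M by exact: mulVmx.
have vg' : v^t* *m g^t* = 1%:M by rewrite -adjmxM gv adjmx1.
have gv' : g^t* *m v^t* = 1%:M by rewrite -adjmxM vg adjmx1.
have -> : invmx (g^t* *m g) = v *m v^t*.
  have ux : g^t* *m g \in unitmx by exact: posdef_unit (posdef_gram ug).
  apply: (can_inj (mulKmx ux)); rewrite mulmxV// !mulmxA -(mulmxA _ g) gv mulmx1.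
  by rewrite gv'.
have -> : v *m v^t* *m (g^t* *m Z *m g) *m (v *m v^t*) *m Y = v *m (Z *m (v^t* *m Y)).
  by rewrite -!mulmxA (mulmxA (v^t*) (g^t*)) vg' mul1mx (mulmxA g v) gv mul1mx.
by rewrite mxtrace_mulC /W !mulmxA.
Qed.

Lemma curve_gram g Z : G g -> ik G Z ->
  curve_at G (g^t* *m g) (fun t => g^t* *m mexp (t%:C *: Z) *m g) (g^t* *m Z *m g).
Proof.
move=> Gg kZ; split.
- move=> t; have [P kP <-] := pospart_conj aG hadj Gg (ikZ aG t kZ); exact: pospart_exp.
- by rewrite scale0r mexp0 mulmx1.
apply/has_velocityP => e e0; have [c c0 hc] := tay2_mexp Z.
pose K := fnorm (g^t*) * fnorm g; have K0 : 0 <= K by rewrite mulr_ge0 ?fnorm_ge0.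
have cK : 0 < c * K + 1 by rewrite ltr_wpDl// mulr_ge0.
exists (Num.min 1 (e / (c * K + 1))); first by rewrite lt_min ltr01 divr_gt0.
move=> h h0; rewrite lt_min => /andP[/ltW h1]; rewrite ltr_pdivlMr// add0r => he.
rewrite scale0r mexp0.
have -> : (h^-1)%:C *: (g^t* *m mexp (h%:C *: Z) *m g - g^t* *m 1%:M *m g) - g^t* *m Z *m g =
    (h^-1)%:C *: (g^t* *m (mexp (h%:C *: Z) - 1%:M - h%:C *: Z) *m g).
  rewrite mulmxBr mulmxBl -scalemxAr -scalemxAl [RHS]scalerBr -mulmxBl -mulmxBr.
  by congr (_ - _); rewrite scalerA -(rmorphM (real_complex R)) mulVf// rmorph1 scale1r.
rewrite fnormZr normfV ltr_pdivrMl ?normr_gt0//; apply: le_lt_trans (fnormM _ _) _.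
apply: le_lt_trans (ler_wpM2r (fnorm_ge0 _) (fnormM _ _)) _.
rewrite mulrAC -/K; apply: le_lt_trans (ler_wpM2l K0 (hc h h1)) _.
rewrite -(real_normK (num_real h)); apply: le_lt_trans (_ : `|h| * (`|h| * (c * K + 1)) < _).
  rewrite -subr_ge0 (_ : _ - _ = `|h| ^+ 2) ?sqr_ge0//; ring.
by rewrite ltr_pM2l ?normr_gt0.
Qed.

(** Moved to 1, a velocity [Y] becomes [W]; the derivative is [fdot m W], which is the metric
    pairing of [g^* m g] with [Y]. Another gradient is excluded by testing on the geodesic in the
    direction of the difference. *)
Lemma gradient_gram g : G g ->
  gradient G (kempf_ness_mx rho u) (g^t* *m g) = g^t* *m mu (rho g *m u) *m g.
Proof.
move=> Gg; have [[GU _ _ _] _] := aG; have ug := GU _ Gg.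
set m := mu _; have km : ik G m by exact: mu_ik.
have grad c Y : curve_at G (g^t* *m g) c Y -> forall Z,
    is_derive (0 : R) (1 : R) (kempf_ness_mx rho u \o c) (fdot m ((invmx g)^t* *m Y *m invmx g)) /\
    riem (g^t* *m g) (g^t* *m Z *m g) Y = fdot Z ((invmx g)^t* *m Y *m invmx g).
  move=> cY Z; have [[hW _] dW] := curve_derivative aG hadj hrho u0 Gg cY.
  by split; [exact: dW|exact: riem_gram].
have conj_inv X : g^t* *m ((invmx g)^t* *m X *m invmx g) *m g = X.
  by rewrite !mulmxA -adjmxM mulVmx// adjmx1 mul1mx mulmxKV.
have inv_conj X : (invmx g)^t* *m (g^t* *m X *m g) *m invmx g = X.
  by rewrite !mulmxA -adjmxM mulmxV// adjmx1 mul1mx mulmxK.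
apply: xget_unique => [|X [[c' cX] hX]].
  split; first by exists (fun t => g^t* *m mexp (t%:C *: m) *m g); exact: curve_gram.
  by move=> c Y cY; have [dc ->] := grad c Y cY m.
have [kZ _] := curve_derivative aG hadj hrho u0 Gg cX.
set Z := (invmx g)^t* *m X *m invmx g in kZ.
have XE : X = g^t* *m Z *m g by rewrite conj_inv.
pose E := Z - m; have kE : ik G E by apply: ikD => //; exact: ikN.
have cE := curve_gram Gg kE; have [[_ d1] r1] := grad _ _ cE Z.
have [_ d2] := hX _ _ cE; move: d2; rewrite d1 XE r1 !inv_conj => /eqP.
rewrite eq_sym -subr_eq0 -fdotBl -/E -fnorm_sqr sqrf_eq0 => /eqP/fnorm_eq0/eqP.
by rewrite subr_eq0 => /eqP ->.
Qed.

(* With [d := mu w - mu w1] and [E := 2 d - mu w], the quotient [Q E / Q 1] of quadratic forms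
   along the step has derivative at least [- fnorm d ^+ 2], by the bound on [D d] and
   Cauchy-Schwarz; integrating over the step gives the claim. *)
Lemma mu_contraction (c L : R) (w : 'cV[C]_N) : w != 0 -> 0 < c -> L = c ^+ 2 ->
  (forall X (z : 'cV[C]_N), ik G X -> fnorm (D X *m z) <= c * fnorm X * fnorm z) ->
  forall w1, w1 = mexp ((- (1 / (2 * L)))%:C *: D (mu w)) *m w ->
  0 <= fdot (mu w1) (mu w - mu w1).
Proof.
move=> w0 c0 LE hc w1 w1E; have L0 : 0 < L by rewrite LE exprn_gt0.
pose a := - (1 / (2 * L)); set m0 := mu w; set m1 := mu w1.
pose d := m0 - m1; pose E := (2 : R)%:C *: d - m0.
have k0 : ik G m0 := mu_ik aG hrho w; have k1 : ik G m1 := mu_ik aG hrho w1.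
have kd : ik G d by apply: ikD => //; exact: ikN.
have kE : ik G E := ikD aG (ikZ aG 2 kd) (ikN aG k0).
have hA := drho_herm aG hrho k0; have hB := drho_herm aG hrho kE.
pose A := D m0; pose B := D E.
pose e (t : R) := mexp ((a * t)%:C *: A) *m w.
pose Q (M : 'M[C]_N) (t : R) := fdot (M *m e t) (e t).
have e_neq0 (t : R) : e t != 0.
  by apply: contra_neq w0 => h; rewrite -(mulKmx (mexp_hermZ_unit (a * t) hA) w) -/A -/(e t) h mulmx0.
have al0 (t : R) : 0 < fdot (e t) (e t) by rewrite -fnorm_sqr exprn_gt0// fnorm_gt0.
have Q1 (t : R) : Q 1%:M t = fdot (e t) (e t) by rewrite /Q mul1mx.
(* The linear term compensates the lower bound [- fnorm d ^+ 2] for the derivative of the quotient,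
   so that [psi] is nondecreasing. *)
pose psi (t : R) := Q B t * (Q 1%:M t)^-1 + fnorm d ^+ 2 * t.
pose dpsi (t : R) : R := Q B t *: (- (Q 1%:M t) ^- 2 *: (2 * a * fdot (1%:M *m e t) (A *m e t)))
  + (Q 1%:M t)^-1 *: (2 * a * fdot (B *m e t) (A *m e t)) + fnorm d ^+ 2 *: (1 : R).
have h1 : (1%:M : 'M[C]_N)^t* = 1%:M by exact: adjmx1.
have der (t : R) : is_derive t (1 : R) psi (dpsi t).
  have dB : is_derive t (1 : R) (Q B) (2 * a * fdot (B *m e t) (A *m e t)) := is_derive_quad w a t hA hB.
  have d1 : is_derive t (1 : R) (Q 1%:M) (2 * a * fdot (1%:M *m e t) (A *m e t)) := is_derive_quad w a t hA h1.
  have d2 := @is_deriveV R (Q 1%:M) t _ 1 _ d1.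
  have nz : Q 1%:M t != 0 by rewrite Q1 gt_eqF.
  exact: is_deriveD (is_deriveM dB (d2 nz)) (is_deriveZ (fnorm d ^+ 2) (is_derive_id t (1 : R))).
have dpos (t : R) : 0 <= dpsi t.
  rewrite /dpsi !Q1 mul1mx; set P := A *m e t; set q := D d *m e t; set al := fdot (e t) (e t).
  have al1 : 0 < al by exact: al0.
  have Be : B *m e t = (2 : R)%:C *: q - P by rewrite /B /E drhoB drhoZ mulmxBl -scalemxAl.
  rewrite /Q Be !fdotBl !fdotZl (fdotC (e t) P).
  have hq : fdot q q <= L * fnorm d ^+ 2 * al.
    have := hc d (e t) kd; rewrite -/q => h.
    have -> : L * fnorm d ^+ 2 * al = (c * fnorm d * fnorm (e t)) ^+ 2.
      by rewrite LE -[al]fnorm_sqr; ring.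
    by rewrite -fnorm_sqr ler_sqr ?nnegrE ?fnorm_ge0// !mulr_ge0 ?fnorm_ge0// ltW.
  have hpq : (fdot P (e t) - fdot q (e t)) ^+ 2 <= (fdot P P - 2 * fdot q P + fdot q q) * al.
    have := fdot_le (P - q) (e t); rewrite -(ler_sqr (normr_ge0 _)) ?nnegrE ?mulr_ge0 ?fnorm_ge0//.
    rewrite real_normK ?num_real// exprMn !fnorm_sqr -/al fdotBl => /le_trans; apply.
    by rewrite !fdotBl !fdotBr (fdotC P q) le_eqVlt; apply/orP; left; apply/eqP; ring.
  set p := fdot P (e t) in hpq *; set r := fdot q (e t) in hpq *.
  set PP := fdot P P in hpq *; set QP := fdot q P in hpq *; set QQ := fdot q q in hq hpq *.
  (* Clears the denominators [L] and [al ^+ 2]; the rest is the sum of [hpq], [al] times [hq], and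
     the square of [r]. *)
  rewrite -(pmulr_rge0 _ (mulr_gt0 L0 (exprn_gt0 2 al1))).
  apply: (@le_trans _ _ (al * (PP - 2 * QP) + 2 * p * r - p ^+ 2 + al * (L * fnorm d ^+ 2 * al))).
    have := sqr_ge0 r; have := ler_wpM2l (ltW al1) hq; move: hpq.
    rewrite sqrrB !mulrDl !mulrBr; lra.
  rewrite /a /GRing.scale /= le_eqVlt; apply/orP; left; apply/eqP; field.
  by rewrite !gt_eqF.
have cont : {within `[0, 1], continuous psi}.
  by apply: derivable_within_continuous => t _; have [] := der t.
have [t _] := MVT ltr01 (fun t _ => der t) cont.
rewrite subr0 mulr1 => psi01.
have : 0 <= psi 1 - psi 0 by rewrite psi01.
have e0E : e 0 = w by rewrite /e mulr0 scale0r mexp0 mul1mx.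
have e1E : e 1 = w1 by rewrite /e mulr1 w1E.
have -> : psi 1 = fdot m1 E + fnorm d ^+ 2.
  by rewrite /m1 (muE aG hrho w1 kE) -e1E -Q1 /psi /= ; congr (_ + _); exact: mulr1.
have -> : psi 0 = fdot m0 E.
  by rewrite /m0 (muE aG hrho w kE) -/m0 -e0E -Q1; rewrite -[RHS]addr0; congr (_ + _); exact: mulr0.
have -> : fdot m1 E + fnorm d ^+ 2 - fdot m0 E = fdot m1 d.
  rewrite addrAC -fdotBl -opprB fdotNl -/d /E fdotBr fdotZr -fnorm_sqr.
  have -> : fdot d m0 = fdot d d + fdot d m1 by rewrite -fdotDr subrK.
  by rewrite -fnorm_sqr (fdotC m1); ring.
by [].
Qed.

End Gradient.

(** * Growth of the Kempf-Ness function along geodesics *)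

Section Descent.
Variables (R : realType) (n N : nat).
Local Notation C := R[i].
Variables (G : set 'M[C]_n) (rho : 'M[C]_n -> 'M[C]_N).
Hypotheses (aG : algebraic_group G) (hadj : forall h, G h -> G (h^t*)) (hrho : matrix_rep G rho).
Local Notation D := (drho aG hrho).
Variable u : 'cV[C]_N.
Hypothesis u0 : u != 0.
Local Notation mu := (moment_map aG hrho).
Local Notation kn := (kempf_ness_mx rho u).

Let G1 : G 1%:M. Proof. by have [[_ + _ _] _] := aG. Qed.
Let GM g h : G g -> G h -> G (g *m h). Proof. by have [[_ _ + _] _] := aG; apply. Qed.
Let GV g : G g -> G (invmx g). Proof. by have [[_ _ _ +] _] := aG; apply. Qed.
Let Gu g : G g -> g \in unitmx. Proof. by have [[+ _ _ _] _] := aG; apply. Qed.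
Let rho1 : rho 1%:M = 1%:M. Proof. by have [] := hrho. Qed.

Lemma kn1 : kn 1%:M = ln (fdot u u).
Proof. by rewrite /kempf_ness_mx rho1 mul1mx. Qed.

Lemma kn_line X (t : R) : ik G X -> kn (mexp (t%:C *: X)) = logq (D X) u t.
Proof. by move=> kX; rewrite /kempf_ness_mx (rho_mexp aG hrho t kX). Qed.

Lemma kn_gram1 g : G g -> kn (g^t* *m g) = ln (fdot (rho g *m u) (rho g *m u)).
Proof.
move=> Gg; have := rho_gram aG hadj hrho u Gg G1.
by rewrite mulmx1 rho1 mul1mx /kempf_ness_mx => ->.
Qed.

(** Convexity at [g^* g]: the function lies above its tangent there, whose slope is at most the norm
    of the moment map, and the distance from [g^* g] to [e^X] is at most [fnorm X + fnorm B] by the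
    triangle inequality through 1. *)
Lemma kn_lower g B X : G g -> ik G B -> mexp B = g^t* *m g -> ik G X ->
  ln (fdot (rho g *m u) (rho g *m u)) - fnorm (mu (rho g *m u)) * (fnorm X + fnorm B)
    <= kn (mexp X).
Proof.
move=> Gg kB BE kX; have Gv := GV Gg; have ug := Gu Gg; have uv := Gu Gv.
have [hB _] := kB; have [hX _] := kX; set w := rho g *m u.
have w0 : w != 0 := rho_u_neq0 aG hrho u0 Gg.
have [P kP PE] := pospart_conj aG hadj Gv kX; have [hP _] := kP.
(* [e^Q] is the image of 1 under the isometry that moves [g^* g] to 1; [Q] is similar to [- B],
   hence of the same norm. *)
have [Q hQ QE] := gram_log uv.
have XE : mexp X = g^t* *m mexp P *m g.
  by rewrite PE !mulmxA -adjmxM mulVmx// adjmx1 mul1mx mulmxKV.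
have QB : fnorm Q = fnorm B.
  have hNQ : (- Q)^t* = - Q by rewrite adjmxN hQ.
  rewrite -fnormN; apply/esym; apply: (mexp_similar ug hB hNQ).
  rewrite -mexp_herm_inv// -QE BE; apply: (can_inj (mulKmx (posdef_unit (posdef_gram uv)))).
  rewrite (mulKVmx (posdef_unit (posdef_gram uv))) -!mulmxA (mulmxA (invmx g) g) mulVmx//.
  by rewrite mul1mx mulmxA -adjmxM mulmxV// adjmx1 mul1mx.
have hPQ : fnorm P <= fnorm X + fnorm B.
  by rewrite -QB; exact: (log_triangle uv hP hX hQ PE (esym QE)).
have w2 : 0 < fdot w w by rewrite -fnorm_sqr exprn_gt0// fnorm_gt0.
rewrite XE (kn_gram aG hadj hrho u Gg kP) -/w.
apply: (@le_trans _ _ (ln (fdot w w) + fdot (mu w) P)).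
  rewrite lerD2l lerNl; apply: le_trans (ler_norm _) _; rewrite normrN.
  by apply: le_trans (fdot_le _ _) _; rewrite ler_wpM2l ?fnorm_ge0.
rewrite (muE aG hrho w kP) -[X in _ + X]expRK -lnM ?posrE ?expR_gt0// ler_ln ?posrE.
- by apply: jensen_exp; exact: drho_herm.
- by rewrite mulr_gt0// expR_gt0.
- by apply: fdot_mexp_gt0 => //; exact: drho_herm.
Qed.

(** Along the ray the function is the logarithm of a finite exponential sum. The largest exponent
    [a j] with positive mass is the slope; its mass and the total mass give the constants of the
    lower and upper bounds. *)
Lemma recession_linear X : ik G X -> exists2 M : R, recession kn X = M &
  (forall t, 0 <= t -> kn (mexp (t%:C *: X)) <= kn 1%:M + t * M) /\
  exists E : R, forall t, 0 <= t -> E + t * M <= kn (mexp (t%:C *: X)).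
Proof.
move=> kX; have [U [a [hU DE]]] := herm_spectral (drho_herm aG hrho kX).
pose y := U^t* *m u; pose p i := normc (y i 0) ^+ 2.
have p0 i : 0 <= p i by exact: sqr_ge0.
have qE t : fdot (rho (mexp (t%:C *: X)) *m u) u = \sum_i expR (t * a i) * p i.
  rewrite (rho_mexp aG hrho t kX) DE.
  have -> : t%:C *: (U *m dg a *m U^t*) = U *m dg (fun i => t * a i) *m U^t*.
    rewrite scalemxAl scalemxAr !dgE dgcZ; congr (_ *m dgc _ *m _); apply/funext => i.
    by rewrite rmorphM.
  by rewrite mexp_spectral1// fdot_spectral.
have uuE : fdot u u = \sum_i p i by rewrite -(fdot_unitaryT u hU).
have uu0 : 0 < fdot u u by rewrite -fnorm_sqr exprn_gt0// fnorm_gt0.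
have [i0 pi0] : exists i, 0 < p i.
  apply: contrapT => h; move: uu0; rewrite uuE ltNge; apply/negP; rewrite negbK.
  by apply: sumr_le0 => i _; rewrite leNgt; apply/negP => pi; apply: h; exists i.
pose j := [arg max_(i > i0 | 0 < p i) a i]%O.
have [pj aj] : 0 < p j /\ forall i, 0 < p i -> a i <= a j.
  by rewrite /j; case: arg_maxP => // k pk hk.
have q0 t : 0 < \sum_i expR (t * a i) * p i.
  by rewrite -qE (rho_mexp aG hrho t kX) fdot_mexp_gt0//; apply: herm_scale; exact: drho_herm.
have lo t : 0 <= t -> ln (p j) + t * a j <= kn (mexp (t%:C *: X)).
  move=> t0; have pe : 0 < p j * expR (t * a j) := mulr_gt0 pj (expR_gt0 _).
  rewrite /kempf_ness_mx qE -[X in _ + X]expRK -lnM ?posrE ?expR_gt0// ler_ln ?posrE ?pe ?q0//.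
  by rewrite (bigD1 j)//= mulrC lerDl sumr_ge0// => i _; rewrite mulr_ge0 ?expR_ge0.
have up t : 0 <= t -> kn (mexp (t%:C *: X)) <= kn 1%:M + t * a j.
  move=> t0; have pe : 0 < fdot u u * expR (t * a j) := mulr_gt0 uu0 (expR_gt0 _).
  rewrite kn1 /kempf_ness_mx qE -[X in _ + X]expRK -lnM ?posrE ?expR_gt0// ler_ln ?posrE ?pe ?q0//.
  rewrite uuE mulr_suml; apply: ler_sum => i _; rewrite mulrC.
  have [pi|pi] := leP (p i) 0.
    have -> : p i = 0 by apply/le_anti; rewrite pi p0.
    by rewrite !mul0r.
  by rewrite ler_wpM2l// ler_expR ler_wpM2l// aj.
exists (a j); last by split=> //; exists (ln (p j)).
rewrite /recession; apply: cvg_lim => //; apply/cvgrPdist_lt => e e0.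
pose K := `|ln (p j)| + `|kn 1%:M| + 1.
have K0 : 0 < K by rewrite ltr_wpDl// addr_ge0.
exists (K / e); split; first exact: num_real.
move=> t /= Kt; have t0 : 0 < t by apply: lt_trans Kt; exact: divr_gt0.
have := lo t (ltW t0); have := up t (ltW t0); rewrite mexpE; set f := kn _ => h1 h2.
have -> : a j - f / t = (t * a j - f) / t by field; rewrite gt_eqF.
rewrite normrM normfV (gtr0_norm t0) ltr_pdivrMr//.
apply: (@lt_trans _ _ K); last by rewrite mulrC -ltr_pdivrMr.
have n1 := ler_norm (kn 1%:M); have n2 : - ln (p j) <= `|ln (p j)| by rewrite -normrN ler_norm.
have n3 := normr_ge0 (kn 1%:M); have n4 := normr_ge0 (ln (p j)).
by rewrite ltr_norml /K; apply/andP; split; move: h1 h2 n1 n2 n3 n4; lra.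
Qed.

(** [e^W] is the geodesic midpoint: moving [e^X] to 1 by [g = e^(X/2)] sends [e^Y] to [e^P], and the
    exponential of [Z = P / 2] is moved back. *)
Lemma kn_midpoint X Y : ik G X -> ik G Y -> exists2 W, ik G W &
  2 * kn (mexp W) <= kn (mexp X) + kn (mexp Y) /\
  fnorm W ^+ 2 <= (fnorm X ^+ 2 + fnorm Y ^+ 2) / 2 - fnorm (X - Y) ^+ 2 / 4.
Proof.
move=> kX kY; have [[hX _] [hY _]] := (kX, kY).
pose g := mexp ((2^-1 : R)%:C *: X).
have Gg : G g by apply: ik_mexp; exact: ikZ.
have gh : g^t* = g by exact: mexp_hermZ_adj hX.
have [P kP PE] := pospart_conj aG hadj (GV Gg) kY.
pose Z := (2^-1 : R)%:C *: P; have kZ : ik G Z by exact: ikZ.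
have [hZ _] := kZ.
have Z2 : (2 : R)%:C *: Z = P.
  by rewrite /Z scalerA -(rmorphM (real_complex R)) mulfV ?pnatr_eq0// rmorph1 scale1r.
have [W kW WE] := pospart_conj aG hadj Gg kZ; have [hW _] := kW.
have YE : mexp Y = g^t* *m mexp P *m g.
  by rewrite PE !mulmxA -adjmxM mulVmx ?Gu// adjmx1 mul1mx mulmxKV ?Gu.
exists W => //; split; last first.
  apply: (log_midpoint hX hY hZ hW); first by rewrite Z2 YE gh.
  by rewrite WE gh.
have XE : mexp X = g^t* *m g by rewrite gh /g mexp_half.
have w0 := rho_u_neq0 aG hrho u0 Gg.
have := logq_convex (t := 1) (d := 2) (drho_herm aG hrho kZ) w0.
rewrite ler01 ler1n => /(_ isT).
have -> : logq (D Z) (rho g *m u) 1 = kn (mexp W).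
  by rewrite WE (kn_gram aG hadj hrho u Gg kZ) /logq scale1r.
have -> : logq (D Z) (rho g *m u) 0 = kn (mexp X).
  by rewrite XE kn_gram1// /logq scale0r mexp0 mul1mx.
have -> : logq (D Z) (rho g *m u) 2 = kn (mexp Y).
  by rewrite YE (kn_gram aG hadj hrho u Gg kP) /logq -drhoZ Z2.
have -> : (2 - 1 : R) = 1 by rewrite -[2]/(1 + 1) addrK.
by rewrite !mul1r.
Qed.

Lemma kn_sphere_limit (eta : nat -> 'M[C]_n) (xi : 'M[C]_n) (t E : R) (K : nat) :
  (forall k, (K <= k)%N -> ik G (eta k) /\ kn (mexp (t%:C *: eta k)) <= E) -> ik G xi ->
  (forall (e : R) M, 0 < e -> exists2 k, (M <= k)%N & fnorm (eta k - xi) < e) ->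
  kn (mexp (t%:C *: xi)) <= E.
Proof.
move=> heta kxi hxi; pose q X := fdot (rho (mexp (t%:C *: X)) *m u) u.
have qE X : ik G X -> q X = fdot (mexp (t%:C *: D X) *m u) u.
  by move=> kX; rewrite /q (rho_mexp aG hrho t kX).
have q0 X : ik G X -> 0 < q X.
  move=> kX; rewrite qE//; apply: fdot_mexp_gt0 => //; apply: herm_scale; exact: drho_herm.
have [d d0 hd] := drho_lip aG hrho.
pose c := `|t| * (d * (fnorm xi + 1)).
have c0 : 0 <= c by rewrite !mulr_ge0// addr_ge0// fnorm_ge0.
pose b := expR c * (`|t| * d) * fdot u u.
have b0 : 0 <= b by rewrite !mulr_ge0 ?expR_ge0// -fnorm_sqr sqr_ge0.
suff : q xi <= expR E by rewrite -ler_ln ?posrE ?expR_gt0 ?q0// expRK.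
rewrite leNgt; apply/negP => lt.
pose e := q xi - expR E; have e0 : 0 < e by rewrite subr_gt0.
have m0 : 0 < Num.min 1 (e / (b + 1)) by rewrite lt_min ltr01 divr_gt0// ltr_wpDl.
have [k Kk] := hxi _ K m0; rewrite lt_min => /andP[k1 ke].
have [kk hk] := heta k Kk.
have hqk : q (eta k) <= expR E by rewrite -ler_ln ?posrE ?expR_gt0 ?q0// expRK.
have bnd X : fnorm (X - xi) < 1 -> fnorm (t%:C *: D X) <= c.
  move=> X1; rewrite fnormZr ler_wpM2l//; apply: le_trans (hd _) _; rewrite ler_wpM2l//.
  by have := fnormD (X - xi) xi; rewrite subrK => /le_trans; apply; rewrite addrC lerD2l ltW.
have b1 := bnd _ k1; have b2 := bnd xi; rewrite subrr fnorm0 ltr01 in b2; have {}b2 := b2 isT.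
have : e <= b * fnorm (eta k - xi).
  apply: (@le_trans _ _ (q xi - q (eta k))); first by rewrite /e; move: hqk; lra.
  rewrite !qE// -fdotBl -mulmxBl; apply: le_trans (ler_norm _) _.
  apply: le_trans (fdot_le _ _) _; apply: le_trans (ler_wpM2r (fnorm_ge0 _) (fnormM _ _)) _.
  rewrite -mulrA -expr2 fnorm_sqr.
  have h := mexp_lip b2 b1.
  have h2 : fnorm (t%:C *: D xi - t%:C *: D (eta k)) <= `|t| * (d * fnorm (eta k - xi)).
    by rewrite -scalerBr -drhoB fnormZr ler_wpM2l// fnormBC hd.
  have uu0 : 0 <= fdot u u by rewrite -fnorm_sqr sqr_ge0.
  apply: le_trans (ler_wpM2r uu0 (le_trans h (ler_wpM2l (expR_ge0 c) h2))) _.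
  by rewrite /b le_eqVlt; apply/orP; left; apply/eqP; ring.
apply/negP; rewrite -ltNge; apply: le_lt_trans (_ : (b + 1) * fnorm (eta k - xi) < e).
  by rewrite ler_wpM2r ?fnorm_ge0// lerDl.
by rewrite mulrC -ltr_pdivlMr// ltr_wpDl.
Qed.

End Descent.

(** * The arithmetic of a descent step and of two diverging rays *)

Section SequenceEstimates.
Variable R : realType.
Implicit Types (e f a d k q s t x y : R).

(** The function drops by means of the new gradient norm [a1], while the distance grows by means of
    the old one [a0]; carrying the next step length [a q] in the bound absorbs this shift of
    index. *)
Lemma seq_upper_step k q a1 a0 d1 d0 f1 f0 e : 0 <= k -> 0 <= q -> 0 <= a1 -> k <= a1 ->
  f1 + a1 ^+ 2 * q <= f0 -> d1 <= d0 + a0 * q -> f0 <= e - k * (d0 + a0 * q) ->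
  f1 <= e - k * (d1 + a1 * q).
Proof.
move=> k0 q0 a0' ka h1 h2 h3.
have h4 : k * (a1 * q) <= a1 ^+ 2 * q by rewrite mulrA ler_wpM2r// expr2 ler_wpM2r.
have h5 : k * d1 <= k * (d0 + a0 * q) by rewrite ler_wpM2l.
by rewrite mulrDr; move: h1 h3 h4 h5; lra.
Qed.

(** At the midpoint the value is at most [e - k t] and at least [c - k (1 + s) t (1 - s)]; the
    difference [t k s^2] outgrows [e - c]. *)
Lemma ray_contradiction k s t e a w f1 f2 fw c : 0 < t -> 0 <= 1 - s -> 0 <= a ->
  a <= k + k * s -> w <= t * (1 - s) -> 2 * fw <= f1 + f2 -> f1 <= e - k * t -> f2 <= e - k * t ->
  c - a * w <= fw -> `|e - c| + 1 <= t * (k * s ^+ 2) -> False.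
Proof.
move=> t0 s1 a0 ha hw h h1 h2 hc ht.
have h5 : a * w <= (k + k * s) * (t * (1 - s)).
  apply: le_trans (ler_wpM2l a0 hw) _; apply: ler_wpM2r => //; exact: (mulr_ge0 (ltW t0)).
have h6 : (k + k * s) * (t * (1 - s)) = k * t - t * (k * s ^+ 2) by ring.
have h7 := ler_norm (e - c); rewrite h6 in h5.
by move: h1 h2 h hc h5 h7 ht; lra.
Qed.

End SequenceEstimates.

(** * Convergence of the directions of the descent *)

Section Convergence.
Variables (R : realType) (n N : nat).
Local Notation C := R[i].
Variables (G : set 'M[C]_n) (rho : 'M[C]_n -> 'M[C]_N).
Hypotheses (aG : algebraic_group G) (hadj : forall h, G h -> G (h^t*)) (hrho : matrix_rep G rho).
Local Notation D := (drho aG hrho).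
Variable u : 'cV[C]_N.
Hypothesis u0 : u != 0.
Local Notation mu := (moment_map aG hrho).
Local Notation kn := (kempf_ness_mx rho u).
Variables (c L : R).
Hypotheses (hc : forall X (z : 'cV[C]_N), ik G X -> fnorm (D X *m z) <= c * fnorm X * fnorm z)
  (LE : L = c ^+ 2).
Variables (H : 'M[C]_n) (c' : R).
Hypotheses (kH : ik G H) (c'0 : 0 < c') (hH : forall t : R, 0 <= t ->
  fdot (rho (mexp (t%:C *: H)) *m u) u <= expR (- (c' * t)) * fdot u u).

Let G1 : G 1%:M. Proof. by have [[_ + _ _] _] := aG. Qed.
Let GM g h : G g -> G h -> G (g *m h). Proof. by have [[_ _ + _] _] := aG; apply. Qed.
Let Gu g : G g -> g \in unitmx. Proof. by have [[+ _ _ _] _] := aG; apply. Qed.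
Let rho1 : rho 1%:M = 1%:M. Proof. by have [] := hrho. Qed.
Let ik0 : ik G 0. Proof. by have [] := ik_subspace aG. Qed.

(** Along [H] the function falls at rate at least [c'], whereas [kn_lower] at [g^* g] limits the
    rate to [fnorm H] times the norm of the moment map. *)
Lemma mu_lower : exists2 k0 : R, 0 < k0 & forall g, G g -> k0 <= fnorm (mu (rho g *m u)).
Proof.
have H1 : 0 < fnorm H + 1 by rewrite ltr_wpDl// fnorm_ge0.
exists (c' / (fnorm H + 1)) => [|g Gg]; first exact: divr_gt0.
rewrite ler_pdivrMr//; set a := fnorm _; have a0 : 0 <= a by exact: fnorm_ge0.
have [B kB BE] := pospart_conj aG hadj Gg ik0; rewrite mexp0 mulmx1 in BE.
have uu0 : 0 < fdot u u by rewrite -fnorm_sqr exprn_gt0// fnorm_gt0.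
rewrite mulrDr mulr1; suff : c' <= a * fnorm H by move/le_trans; apply; rewrite lerDl.
rewrite leNgt; apply/negP => lt; set d := c' - a * fnorm H.
have d0 : 0 < d by rewrite subr_gt0.
pose K := ln (fdot u u) - ln (fdot (rho g *m u) (rho g *m u)) + a * fnorm B.
have hK t : 0 <= t -> d * t <= K.
  move=> t0; have kt := ikZ aG t kH; have := kn_lower aG hadj hrho u0 Gg kB BE kt.
  rewrite fnormZr (ger0_norm t0) -/a.
  have : kn (mexp (t%:C *: H)) <= - (c' * t) + ln (fdot u u).
    rewrite -[X in X + _]expRK -lnM ?posrE ?expR_gt0// ler_ln ?posrE ?hH// ?mulr_gt0 ?expR_gt0//.
    rewrite (rho_mexp aG hrho t kH) fdot_mexp_gt0//; apply: herm_scale; exact: drho_herm.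
  by rewrite /K /d mulrDr mulrBl mulrCA mulrA (mulrC t); lra.
have := hK ((`|K| + 1) / d); rewrite mulrCA divff ?gt_eqF// mulr1.
rewrite (divr_ge0 (addr_ge0 (normr_ge0 _) ler01) (ltW d0)) => /(_ isT).
apply/negP; rewrite -ltNge; apply: le_lt_trans (ler_norm K) _; by rewrite ltrDl ltr01.
Qed.

(** The moment map at [u] is nonzero by [mu_lower] and, paired with itself, has norm at most [c].
    This makes the step length [1 / L] meaningful. *)
Lemma c_gt0 : 0 < c.
Proof.
have [k0 k00 hk0] := mu_lower; have := hk0 _ G1; rewrite rho1 mul1mx.
set m := mu u => km; have m0 : 0 < fnorm m := lt_le_trans k00 km.
suff : fnorm m <= c by exact: lt_le_trans.
have u2 : 0 < fnorm u := fnorm_gt0 u0.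
have kmu : ik G m := mu_ik aG hrho u.
rewrite -(ler_pM2r m0) -expr2 fnorm_sqr {1}/m (muE aG hrho u kmu) -fnorm_sqr.
rewrite ler_pdivrMr ?exprn_gt0//; apply: le_trans (ler_norm _) _.
by apply: le_trans (fdot_le _ _) _; rewrite expr2 mulrA ler_wpM2r ?fnorm_ge0// hc.
Qed.

Let L0 : 0 < L. Proof. by rewrite LE exprn_gt0// c_gt0. Qed.

Let Li0 : 0 <= L^-1. Proof. by rewrite invr_ge0 ltW. Qed.

(* The descent iterate [x_k] is [g^t* *m g] for [g := descent_lift k]. *)
Fixpoint descent_lift k : 'M[C]_n := if k is j.+1 then
  mexp ((- (1 / (2 * L)))%:C *: mu (rho (descent_lift j) *m u)) *m descent_lift j else 1%:M.

Local Notation g := descent_lift.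
Let w k := rho (g k) *m u.
Let m k := mu (w k).
Let a k := fnorm (m k).
Let f k := ln (fdot (w k) (w k)).

Lemma lift_G k : G (g k).
Proof.
elim: k => [|k IH]; [exact: G1|exact: (GM (ik_mexp (ikZ aG _ (mu_ik aG hrho _))) IH)].
Qed.

Let km k : ik G (m k). Proof. exact: mu_ik. Qed.
Let w0 k : w k != 0. Proof. exact: (rho_u_neq0 aG hrho u0 (lift_G k)). Qed.
Let ww0 k : 0 < fdot (w k) (w k). Proof. by rewrite -fnorm_sqr exprn_gt0// fnorm_gt0. Qed.

Lemma lift_rho k : w k.+1 = mexp ((- (1 / (2 * L)))%:C *: D (m k)) *m w k.
Proof.
have [_ rhoM _ _] := hrho; rewrite /w /= rhoM; last 2 first.
- exact: (ik_mexp (ikZ aG _ (mu_ik aG hrho _))).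
- exact: lift_G.
by rewrite (rho_mexp aG hrho _ (km k)) mulmxA.
Qed.

Lemma lift_gram k : (g k.+1)^t* *m g k.+1 =
  (g k)^t* *m mexp ((- (1 / L))%:C *: m k) *m g k.
Proof.
have [hm _] := km k; rewrite /= -/(w k) -/(m k) adjmxM (mexp_hermZ_adj _ hm).
rewrite -!mulmxA; congr (_ *m _); rewrite mulmxA -(mexp_hermM _ _ hm).
by congr (mexp (_%:C *: _) *m _); field; rewrite gt_eqF.
Qed.

Let contr k : a k.+1 ^+ 2 <= fdot (m k.+1) (m k).
Proof.
have := mu_contraction (w0 k) c_gt0 LE hc (lift_rho k); rewrite -/(m k.+1) -/(m k).
by rewrite fdotBr -fnorm_sqr subr_ge0.
Qed.

(** The tangent inequality is taken at the new point rather than the old one: its slope there is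
    [fdot (m k.+1) (m k)], which [contr] bounds below by [a k.+1 ^+ 2]. *)
Lemma lift_decrease k : f k.+1 + a k.+1 ^+ 2 / L <= f k.
Proof.
have hA := drho_herm aG hrho (km k).
have hsA : ((1 / L)%:C *: D (m k))^t* = (1 / L)%:C *: D (m k) by exact: herm_scale.
have := jensen_exp (w k.+1) hsA.
have := @logq_shift R N (D (m k)) (w k) (1 / L) (- (1 / L)) hA.
have -> : - (1 / L) / 2 = - (1 / (2 * L)) by field; rewrite gt_eqF.
rewrite -lift_rho subrr scale0r mexp0 mul1mx => ->.
rewrite -scalemxAl fdotZl -mulrA -(muE aG hrho (w k.+1) (km k)) -/(m k.+1) => h.
have h2 : fdot (w k.+1) (w k.+1) * expR (a k.+1 ^+ 2 / L) <= fdot (w k) (w k).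
  apply: le_trans h; rewrite (ler_wpM2l (ltW (ww0 k.+1)))// ler_expR mulrC div1r.
  exact: (ler_wpM2l Li0 (contr k)).
have pe := mulr_gt0 (ww0 k.+1) (expR_gt0 (a k.+1 ^+ 2 / L)).
by rewrite /f -[X in _ + X]expRK -lnM ?posrE ?expR_gt0// ler_ln ?posrE.
Qed.

Variable A : nat -> 'M[C]_n.
Hypothesis hA : forall k, ik G (A k) /\ mexp (A k) = (g k)^t* *m g k.
Let d k := fnorm (A k).

Lemma log0 : A 0%N = 0.
Proof.
have [[hA0 _]] := hA 0%N; rewrite /= adjmx1 mul1mx -(mexp0 R n) => h.
by apply: mexp_herm_inj h => //; exact: adjmx0.
Qed.

Lemma log_step k : d k.+1 <= d k + a k / L.
Proof.
have [[h1 _] E1] := hA k.+1; have [[h2 _] E2] := hA k; have [hm _] := km k.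
have hY : ((- (1 / L))%:C *: m k)^t* = (- (1 / L))%:C *: m k by exact: herm_scale.
rewrite lift_gram in E1.
have := log_triangle (Gu (lift_G k)) h1 hY h2 E1 E2.
by rewrite fnormZr normrN normrM normr1 mul1r gtr0_norm ?invr_gt0// addrC mulrC.
Qed.

(** By [contr] and Cauchy-Schwarz the [a k] decrease, so this is their limit; as an infimum it gives
    [kappa_le] and [kappa_approx] at once. *)
Let kappa := inf (range a).

Let kappa_inf : has_inf (range a).
Proof. by split; [exists (a 0%N), 0%N|exists 0 => _ [k _ <-]; exact: fnorm_ge0]. Qed.

Lemma kappa_le k : kappa <= a k.
Proof. by apply: ge_inf; [have [] := kappa_inf|exists k]. Qed.

Lemma kappa_gt0 : 0 < kappa.
Proof.
have [k0 k00 hk0] := mu_lower; apply: lt_le_trans k00 _.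
by apply: lb_le_inf; [exists (a 0%N), 0%N|move=> _ [k _ <-]; exact: hk0 (lift_G k)].
Qed.

Lemma kappa_approx e : 0 < e -> exists k, a k < kappa + e.
Proof. by move=> e0; have [_ [k _ <-] hk] := inf_adherent e0 kappa_inf; exists k. Qed.

(** Chosen to make [f_upper] an equality at [k = 0], where the distance is 0. *)
Let B := kappa * a 0%N / L.
Let B0 : 0 <= B.
Proof. by rewrite !mulr_ge0 ?invr_ge0 ?fnorm_ge0// ltW// kappa_gt0. Qed.

Lemma f_upper k : f k <= f 0%N + B - kappa * (d k + a k / L).
Proof.
elim: k => [|k IH]; first by rewrite /d log0 fnorm0 add0r /B mulrA addrK.
have k0 := ltW kappa_gt0; exact: (seq_upper_step k0 Li0 (fnorm_ge0 _) (kappa_le k.+1)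
  (lift_decrease k) (log_step k) IH).
Qed.

Lemma f_linear k : f k <= f 0%N - k%:R * (kappa ^+ 2 / L).
Proof.
elim: k => [|k IH]; first by rewrite mul0r subr0.
have h1 := lift_decrease k.
have h3 : kappa ^+ 2 / L <= a k.+1 ^+ 2 / L.
  rewrite (ler_wpM2r Li0)// ler_sqr ?nnegrE; [exact: kappa_le|exact: ltW kappa_gt0|exact: fnorm_ge0].
by rewrite -natr1 mulrDl mul1r; move: h1 h3 IH; lra.
Qed.

Let fE k : kn (mexp (A k)) = f k.
Proof. by have [_ ->] := hA k; rewrite (kn_gram1 aG hadj hrho u (lift_G k)). Qed.

Let f0E : f 0%N = kn 1%:M.
Proof. by rewrite -fE log0 mexp0. Qed.

(** By [f_linear] the values fall at least linearly in [k], while [kn_lower] at 1 lets them fall by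
    at most [a 0] times the distance. *)
Lemma log_unbounded M : exists K, forall k, (K <= k)%N -> M <= d k.
Proof.
have k0 := kappa_gt0; have a0 : 0 < a 0%N := lt_le_trans k0 (kappa_le 0%N).
pose q := kappa ^+ 2 / L; have q0 : 0 < q by rewrite divr_gt0// exprn_gt0.
exists (Num.truncn (`|M| * a 0%N / q)).+1 => k hk.
have hk2 : `|M| * a 0%N / q < k%:R by apply: lt_le_trans (truncnS_gt _) _; rewrite ler_nat.
rewrite ltr_pdivrMr// in hk2.
have [kA _] := hA k; have E0 : mexp 0 = (1%:M : 'M[C]_n)^t* *m 1%:M by rewrite mexp0 adjmx1 mul1mx.
have := kn_lower aG hadj hrho u0 G1 ik0 E0 kA; rewrite fE -/(w 0%N) -/(f 0%N) -/(m 0%N) -/(a 0%N) fnorm0 addr0 -/(d k) => h.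
have h1 := f_linear k; rewrite -/q in h1.
have : M * a 0%N <= d k * a 0%N; last by rewrite ler_pM2r.
have : M * a 0%N <= `|M| * a 0%N by rewrite ler_wpM2r ?fnorm_ge0// ler_norm.
by rewrite (mulrC (d k)); move: h h1 hk2; lra.
Qed.

(** Formulated at a single time [t], because an iterate provides the bound for [t <= d k]; the limit
    direction has it at all times. *)
Definition descent_ray (eta : 'M[C]_n) (t : R) := [/\ ik G eta, fnorm eta = 1 &
  kn (mexp (t%:C *: eta)) <= f 0%N + B - kappa * t].

Lemma rays_close (e : R) : 0 < e <= 1 -> exists2 t0 : R, 0 < t0 & forall t e1 e2, t0 <= t ->
  descent_ray e1 t -> descent_ray e2 t -> fnorm (e1 - e2) <= e.
Proof.
move=> /andP[e0 e1']; have k0 := kappa_gt0.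
(* By CAT(0), directions more than [e] apart have a midpoint within [t sqrt (1 - e^2/4)] of 1, and
   this is at most [t (1 - s)]. *)
pose s := e ^+ 2 / 8; have s0 : 0 < s by rewrite divr_gt0// exprn_gt0.
have e21 : e ^+ 2 <= 1 by rewrite expr_le1// ltW.
have s1 : s <= 1 / 8 by rewrite /s; lra.
have s1' : 0 <= 1 - s by move: s1; lra.
(* An iterate whose gradient norm is below [kappa (1 + s)]; convexity there supplies the lower bound
   at the midpoint. *)
have [j hj] := kappa_approx (mulr_gt0 k0 s0).
pose Cj := f j - a j * d j; pose E := f 0%N + B - Cj.
have ks : 0 < kappa * s ^+ 2 by rewrite mulr_gt0// exprn_gt0.
exists ((`|E| + 1) / (kappa * s ^+ 2)); first by rewrite divr_gt0// ltr_wpDl.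
move=> t e1 e2; rewrite ler_pdivrMr// => ht [k1 n1 h1] [k2 n2 h2].
have t0 : 0 < t.
  by rewrite -(pmulr_lgt0 _ ks); apply: lt_le_trans ht; rewrite ltr_wpDl.
rewrite leNgt; apply/negP => hlt.
have [W kW [hW1 hW2]] := kn_midpoint aG hadj hrho u0 (ikZ aG t k1) (ikZ aG t k2).
rewrite -scalerBr !fnormZr n1 n2 mulr1 (gtr0_norm t0) exprMn in hW2.
have he : e ^+ 2 < fnorm (e1 - e2) ^+ 2 by rewrite ltr_sqr ?nnegrE ?fnorm_ge0// ltW.
have hWt : fnorm W <= t * (1 - s).
  rewrite -ler_sqr ?nnegrE ?fnorm_ge0 ?mulr_ge0 ?(ltW t0)//.
  apply: le_trans hW2 _; have t2 : 0 < t ^+ 2 by rewrite exprn_gt0.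
  have h3 : t ^+ 2 * e ^+ 2 <= t ^+ 2 * fnorm (e1 - e2) ^+ 2 by rewrite ler_pM2l// ltW.
  have -> : (t * (1 - s)) ^+ 2 = t ^+ 2 - t ^+ 2 * e ^+ 2 / 4 + (t * s) ^+ 2 by rewrite /s; field.
  by have := sqr_ge0 (t * s); move: h3; lra.
have [kA AE] := hA j.
have hlow := kn_lower aG hadj hrho u0 (lift_G j) kA AE kW.
rewrite -/(w j) -/(f j) -/(m j) -/(a j) -/(d j) mulrDr opprD addrA addrAC in hlow.
have aj0 : 0 <= a j := fnorm_ge0 _.
have := ray_contradiction t0 s1' aj0 (ltW hj) hWt hW1 h1 h2 hlow; apply; exact: ht.
Qed.

(** Convexity on the geodesic from 1 to the k-th iterate: the bound holds at the far end by
    [f_upper] and at 1 because [B] is nonnegative. *)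
Lemma iterate_ray k (v : 'M[C]_n) t : ik G v -> fnorm v = 1 -> A k = (d k)%:C *: v ->
  0 < d k -> 0 <= t <= d k -> descent_ray v t.
Proof.
move=> kv nv AE d0 /andP[t0 td]; split=> //; rewrite (kn_line aG hrho u t kv).
have h0 : 0 <= t <= d k by rewrite t0.
have := logq_convex (drho_herm aG hrho kv) u0 h0; rewrite -!(kn_line aG hrho u _ kv) -AE fE.
rewrite scale0r mexp0 -f0E => h.
have h2 := f_upper k; have a0 : 0 <= a k / L by rewrite divr_ge0 ?fnorm_ge0// ltW.
have h3 : f k <= f 0%N + B - kappa * d k.
  by apply: le_trans h2 _; rewrite lerD2l lerN2 ler_pM2l ?kappa_gt0// lerDl.
have h4 := ler_wpM2l t0 h3; have h5 : t * B <= d k * B by rewrite ler_wpM2r.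
rewrite -(ler_pM2l d0); apply: le_trans h _.
rewrite mulrBl; move: h4 h5; rewrite !mulrBr !mulrDr (mulrCA t kappa) (mulrCA (d k) kappa) (mulrC (d k) t).
lra.
Qed.

(** A slope below [- kappa] would contradict [kn_lower] at an iterate whose gradient norm is close
    enough to [kappa]. *)
Lemma recession_lower eta : ik G eta -> fnorm eta = 1 -> - kappa <= recession kn eta.
Proof.
move=> ke ne; have [M -> [hup _]] := recession_linear aG hrho u0 ke.
rewrite leNgt; apply/negP => hM.
pose e := (- kappa - M) / 2; have e0 : 0 < e by rewrite divr_gt0// subr_gt0.
have [j hj] := kappa_approx e0; have [kA AE] := hA j.
pose K := kn 1%:M - f j + a j * d j.
have hK t : 0 <= t -> t * e <= K.
  move=> t0; have := kn_lower aG hadj hrho u0 (lift_G j) kA AE (ikZ aG t ke).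
  rewrite -/(w j) -/(f j) -/(m j) -/(a j) -/(d j) fnormZr ne mulr1 (ger0_norm t0) mulrDr => h1.
  have h2 := hup t t0.
  have h3 : a j * t <= (kappa + e) * t by rewrite ler_wpM2r// ltW.
  have h4 : t * e + t * e = - (kappa * t) - t * M by rewrite /e; field.
  by move: h1 h2 h3; rewrite /K mulrDl (mulrC e); lra.
have K0 : 0 <= (`|K| + 1) / e := divr_ge0 (addr_ge0 (normr_ge0 _) ler01) (ltW e0).
have := hK _ K0; rewrite mulfVK ?gt_eqF//; apply/negP; rewrite -ltNge; apply: le_lt_trans (ler_norm K) _; by rewrite ltrDl ltr01.
Qed.

Lemma recession_ray eta : ik G eta -> fnorm eta = 1 -> recession kn eta <= - kappa ->
  forall t, 0 <= t -> descent_ray eta t.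
Proof.
move=> ke ne; have [M -> [hup _]] := recession_linear aG hrho u0 ke => hM t t0.
split=> //; apply: le_trans (hup t t0) _; rewrite -f0E.
have := ler_wpM2l t0 hM; rewrite mulrN (mulrC t kappa); move: B0; lra.
Qed.

Lemma ray_recession eta : (forall t, 0 <= t -> descent_ray eta t) -> recession kn eta <= - kappa.
Proof.
move=> hray; have [ke _ _] := hray 0 (lexx _).
have [M -> [_ [E hE]]] := recession_linear aG hrho u0 ke.
rewrite leNgt; apply/negP => hM; pose e := M + kappa.
have e0 : 0 < e by rewrite /e; move: hM; lra.
pose K := f 0%N + B - E.
have hK t : 0 <= t -> t * e <= K.
  move=> t0; have h1 := hE t t0; have [_ _ h2] := hray t t0.
  by rewrite /e mulrDr /K (mulrC t kappa); move: h1 h2; lra.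
have K0 : 0 <= (`|K| + 1) / e := divr_ge0 (addr_ge0 (normr_ge0 _) ler01) (ltW e0).
have := hK _ K0; rewrite mulfVK ?gt_eqF//; apply/negP; rewrite -ltNge; apply: le_lt_trans (ler_norm K) _; by rewrite ltrDl ltr01.
Qed.

Lemma descent_converges (v : nat -> 'M[C]_n) :
  (forall k, (1 <= k)%N -> [/\ ik G (v k), fnorm (v k) = 1 & A k = (d k)%:C *: v k]) ->
  exists xi, [/\ ik G xi /\ fnorm xi = 1,
    forall e : R, 0 < e -> exists K, forall k, (K <= k)%N -> fnorm (v k - xi) < e,
    exists E q : R, 0 < q /\ forall t, 0 <= t -> kn (mexp (t%:C *: xi)) <= E - q * t,
    forall eta, ik G eta -> fnorm eta = 1 -> recession kn xi <= recession kn eta &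
    forall eta, ik G eta -> fnorm eta = 1 -> recession kn eta <= recession kn xi -> eta = xi].
Proof.
move=> hv.
have vray t : 0 < t -> exists K, forall k, (K <= k)%N -> descent_ray (v k) t.
  move=> t0; have [K hK] := log_unbounded t; exists K.+1 => k Kk.
  have [kv nv AE] := hv k (leq_trans (ltn0Sn _) Kk).
  have td := hK k (ltnW Kk).
  by apply: (iterate_ray (k := k)) => //; [exact: lt_le_trans t0 td|rewrite (ltW t0)].
(* The shift discards index 0, where the iterate is 1 and has no direction. *)
pose v' k := v k.+1.
have [|xi hxi] := @cluster_seq R n n v' 1.
  by move=> k; have [_ -> _] := hv k.+1 (ltn0Sn _).
have hcl e M : 0 < e -> exists2 k, (M <= k)%N & fnorm (v k - xi) < e.
  by move=> e0; have [k Mk hk] := hxi e M e0; exists k.+1 => //; exact: leqW.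
have cvg e : 0 < e -> exists K, forall k, (K <= k)%N -> fnorm (v k - xi) < e.
  move=> e0; pose e' := Num.min 1 (e / 2).
  have e'0 : 0 < e' by rewrite lt_min ltr01 divr_gt0.
  have e'1 : 0 < e' / 2 <= 1.
    rewrite divr_gt0//= ler_pdivrMr// mul1r (@le_trans _ _ 1)// ?ler1n//.
    by rewrite ge_min lexx.
  (* At the fixed time [t0] all late directions satisfy the bound and are pairwise close; comparison
     with a late one near [xi] turns the cluster point into the limit. *)
  have [t0 t00 hclose] := rays_close e'1; have [K hK] := vray t0 t00.
  exists K => k Kk; have e2 : 0 < e' / 2 by case/andP: e'1.
  have [l Kl hl] := hcl _ K e2.
  have h1 := hclose t0 _ _ (lexx _) (hK k Kk) (hK l Kl).
  have := fnormD (v k - v l) (v l - xi); rewrite addrA subrK.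
  have e'e : e' <= e / 2 by rewrite ge_min lexx orbT.
  by move: h1 hl e0; lra.
have kxi : ik G xi.
  apply: (real_subspace_closed (ik_subspace aG)) => e e0.
  have [k k1 hk] := hcl e 1%N e0; have [kv _ _] := hv k k1; by exists (v k).
have nxi : fnorm xi = 1.
  apply/eqP; rewrite -subr_eq0 -normr_eq0; apply/negPn/negP => h.
  have d0 : 0 < `|fnorm xi - 1| by rewrite lt_neqAle eq_sym h normr_ge0.
  have [j j1 hj] := hcl _ 1%N d0; have [_ nv _] := hv j j1.
  have h1 := fnormD (v j - xi) xi; rewrite subrK nv in h1.
  have h2 := fnormB (v j) (v j - xi); rewrite opprB addrC subrK nv in h2.
  by move: hj; rewrite ltr_normr => /orP[]; move: h1 h2; lra.
have xiray t : 0 <= t -> descent_ray xi t.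
  move=> t0; split=> //; have [->|tn0] := eqVneq t 0.
    by rewrite scale0r mexp0 mulr0 subr0 -f0E lerDl.
  have [K hK] := vray t (ltac:(by rewrite lt_neqAle eq_sym tn0)).
  apply: (kn_sphere_limit aG hrho u0 (K := K) (eta := v)) => //.
  by move=> k Kk; have [kv _ hk] := hK k Kk.
have rxi : recession kn xi = - kappa.
  by apply/le_anti; rewrite ray_recession//= recession_lower.
exists xi; split; [by split|exact: cvg| | |].
- exists (f 0%N + B), kappa; split; first exact: kappa_gt0.
  by move=> t t0; have [] := xiray t t0.
- by move=> eta ke ne; rewrite rxi; exact: recession_lower.
move=> eta ke ne; rewrite rxi => hle; have etaray := recession_ray ke ne hle.
apply/eqP; rewrite -subr_eq0; apply/negPn/negP => /fnorm_gt0 h.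
pose e := Num.min 1 (fnorm (eta - xi) / 2).
have e01 : 0 < e <= 1 by rewrite lt_min ltr01 divr_gt0//= ge_min lexx.
have [t0 t00 hclose] := rays_close e01.
have := hclose t0 _ _ (lexx _) (etaray t0 (ltW t00)) (xiray t0 (ltW t00)).
rewrite leNgt => /negP; apply; rewrite gt_min ltr_pdivrMr//.
by rewrite mulr_natr mulr2n ltrDl h orbT.
Qed.

End Convergence.

(** * Nonnegativity of the distance, and the return to the abstract representation *)

Section PathLength.
Variables (R : realType) (n : nat) (G : set 'M[R[i]]_n).

Lemma path_length_ge0 (c c' : R -> 'M[R[i]]_n) : 0 <= path_length c c'.
Proof. by apply: fine_ge0; apply: integral_ge0 => t _; rewrite lee_fin sqrtr_ge0. Qed.

Lemma riem_dist_ge0 (x y : 'M[R[i]]_n) : 0 <= riem_dist G x y.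
Proof.
rewrite /riem_dist; set S := [set l | _].
have [->|S0] := eqVneq S set0; first by rewrite inf_out// => -[[z]].
apply: lb_le_inf; first exact/set0P.
by move=> _ [c [c' [_ ->]]]; exact: path_length_ge0.
Qed.

End PathLength.

Lemma lt_of_ln_sqr_le (R : realType) (a e E q t : R) : 0 < a -> 0 < e ->
  ln (a ^+ 2) <= E - q * (t + t) -> E - ln (e ^+ 2) < t * (2 * q) -> a < e.
Proof.
move=> a0 e0 h ht; rewrite -(ltr_pXn2r (n := 2)) ?nnegrE ?ltW//.
rewrite -ltr_ln ?posrE ?exprn_gt0//; apply: le_lt_trans h _; lra.
Qed.

Theorem theorem4p5 (R : realType) (n : nat) (G : set 'M[R[i]]_n)
  (hG : reductive G) (hGconn : zariski_connected G)
  (hGadj : [set g^t* | g in G] = G)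
  (V : vectType R[i]) (ip : {dot V for conjC}) (pi : 'M[R[i]]_n -> 'End(V))
  (hpi : rational_representation G pi)
  (hip : invariant_under ip pi (maxcompact G))
  (T : set 'M[R[i]]_n) (hT : maximal_torus T (maxcompact G))
  (L : R) (hL : L = weight_norm ip pi T ^+ 2)
  (v : V) (hv : v != 0)
  (hinf : inf [set vnorm ip (pi g v) | g in G] = 0)
  (x : nat -> 'M[R[i]]_n) (hx0 : x 0%N = 1%:M)
  (hx : forall k : nat, x k.+1 =
     riem_exp (x k) (- (1 / L)%:C *: gradient G (kempf_ness ip pi v) (x k)))
  (u : nat -> 'M[R[i]]_n)
  (hu : forall k : nat, (1 <= k)%N -> unit_sphere G (u k) /\
     x k = expmx ((riem_dist G (x k) 1%:M)%:C *: u k)) :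
  exists xi : 'M[R[i]]_n,
    [/\ unique_minimizer (recession (kempf_ness ip pi v)) (unit_sphere G) xi,
        u @ \oo --> xi &
        maximally_destabilizing G ip pi v (fun t : R => expmx (t%:C *: xi))].
Proof.
have [aG _] := hG; have [[GU G1 GM GV] zG] := aG.
have hadj h : G h -> G (h^t*) by move=> Gh; rewrite -hGadj; exists h.
have [N [psi [phi hco]]] := hermitian_coordinates_exist ip.
have hbound := weight_norm_bound aG hadj hpi hip hco hT.
move: (rep_mx_matrix_rep hpi hip hco) hbound; set rho := rep_mx pi psi phi => hrho hbound.
pose w := psi v.
have [_ psiK _ _ _] := hco.
have w0 : w != 0.
  by apply: contra_neq hv => h; apply: (can_inj psiK); rewrite (coords0 hco).
have knE : kempf_ness ip pi v = kempf_ness_mx rho w.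
  by apply/funext => y; rewrite (kempf_nessE pi hco).
have small (e : R) : 0 < e -> exists2 g, G g & fnorm (rho g *m w) < e.
  move=> e0; have hS : has_inf [set vnorm ip (pi g v) | g in G].
    split; first by exists (vnorm ip (pi 1%:M v)), 1%:M.
    by exists 0 => _ [g _ <-]; exact: sqrtr_ge0.
  have [_ [g Gg <-]] := inf_adherent e0 hS.
  by rewrite hinf add0r (vnormE hco) (coords_pi pi hco) => h; exists g.
have [H kH [c' c'0 hH]] := hilbert_mumford aG hadj hrho hT small.
set c := weight_norm ip pi T in hL hbound.
pose g := descent_lift aG hrho w L.
have xE k : x k = (g k)^t* *m g k.
  elim: k => [|k IH]; first by rewrite hx0 /g /= adjmx1 mul1mx.
  have Gg : G (g k) := lift_G aG hrho w L k.
  rewrite hx IH knE (gradient_gram aG hadj hrho w0 Gg) -rmorphN.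
  rewrite scalemxAl scalemxAr (riem_exp_gram _ (GU _ Gg)).
  by rewrite /g (lift_gram hadj w0 hbound hL kH c'0 hH).
have /choice[A hA] : forall k, exists B, ik G B /\ mexp B = (g k)^t* *m g k.
  move=> k; have [ik0 _ _] := ik_subspace aG.
  have [B kB BE] := pospart_conj aG hadj (lift_G aG hrho w L k) ik0.
  by exists B; rewrite BE mexp0 mulmx1.
have sphereP X : unit_sphere G X <-> ik G X /\ fnorm X = 1.
  by rewrite /unit_sphere /= (ilie_ik aG) fnorm.unlock fdot.unlock.
have hA' k : (1 <= k)%N -> [/\ ik G (u k), fnorm (u k) = 1 & A k = (fnorm (A k))%:C *: u k].
  move=> k1; have [/sphereP[ku nu] xk] := hu k k1; have [kA AE] := hA k.
  have [[hk _] [hAk _]] := (ku, kA).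
  have AuE : A k = (riem_dist G (x k) 1%:M)%:C *: u k.
    apply: (mexp_herm_inj hAk); first exact: herm_scale.
    by rewrite AE -xE {1}xk mexpE.
  split=> //; rewrite {2}AuE fnormZr nu mulr1 ger0_norm ?riem_dist_ge0//.
have [xi [[kxi nxi] cvg [E [q [q0 hq]]] hmin huniq]] :=
  descent_converges hadj w0 hbound hL kH c'0 hH hA hA'.
have umin : unique_minimizer (recession (kempf_ness ip pi v)) (unit_sphere G) xi.
  rewrite knE; split; first split.
  - exact/sphereP.
  - by move=> Y /sphereP[kY nY]; exact: hmin.
  move=> Y [/sphereP[kY nY] hY].
  by exact: (huniq Y kY nY (hY xi (iffRL (sphereP xi) (conj kxi nxi)))).
exists xi; split; [exact: umin|by apply/cvg_fnormP => e /cvg[K hK]; exists K|].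
have hxi : xi^t* = xi by have [] := kxi.
split; last by exists xi.
split.
  split.
  - by move=> t; rewrite mexpE; apply: ik_mexp; exact: (ikZ aG t kxi).
  - by move=> s t; rewrite !mexpE mexp_hermM.
  - have -> : (fun t : R => expmx (t%:C *: xi)) = (fun t : R => mexp ((1 * t%:C) *: xi)).
      by apply/funext => t; rewrite mul1r mexpE.
    exact: mexp_continuous_line.
apply/cvgrPdist_lt => e e0; have q2 : 0 < 2 * q by rewrite mulr_gt0.
exists (Num.max 0 ((E - ln (e ^+ 2)) / (2 * q))); split; first exact: num_real.
move=> t /=; rewrite gt_max => /andP[t0]; rewrite ltr_pdivrMr// => ht.
rewrite sub0r normrN ger0_norm ?sqrtr_ge0// (vnormE hco) (coords_pi pi hco) -/rho -/w mexpE.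
have Gt : G (mexp (t%:C *: xi)) by apply: ik_mexp; exact: (ikZ aG t kxi).
have := rho_gram aG hadj hrho w Gt G1; have [rho1 _ _ _] := hrho.
rewrite mulmx1 rho1 mul1mx (mexp_hermZ_adj t hxi) -mexp_hermM// -fnorm_sqr => h.
have t20 : 0 <= t + t by rewrite addr_ge0// ltW.
have hle := hq _ t20; rewrite /kempf_ness_mx h in hle.
have f0 : 0 < fnorm (rho (mexp (t%:C *: xi)) *m w).
  exact: (fnorm_gt0 (rho_u_neq0 aG hrho w0 Gt)).
exact: (lt_of_ln_sqr_le f0 e0 hle ht).
Qed.
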